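(* For each of the strategy classes of pure finite-state, finite-state, pure, and unrestricted strategies, TR-NCRSP$_{>}$ is undecidable. That is, there is no algorithm that, given a stochastic multiplayer game $\mathcal{G}$ in which every player has a terminal reachability objective and a rational number $\mu\in[0,1]$, decides whether there exists a strategy $\sigma_0$ of the system such that for every tuple $\bar\sigma_{-0}$ of environment strategies for which $(\sigma_0,\bar\sigma_{-0})$ is a 0-fixed Nash equilibrium, $\mathit{Pay}_0(\sigma_0,\bar\sigma_{-0})>\mu$ (all strategies ranging over the given class).
   Context: Game arena: a tuple $\mathcal{A}=\langle \Omega, V,(V_i)_{i\in\Omega\cup\{\mathit{nature}\}},\Delta,v_0\rangle$ where $\Omega=\{0,1,\dots,k\}$ is the set of players (player $0$ is the system, players $1,\dots,k$ are the environment players), $V$ is a finite set of vertices partitioned into sets $V_i$, $i\in\Omega\cup\{\mathit{nature}\}$, and $v_0$ is the initial vertex. $\Delta\subseteq (V_{\mathit{nature}}\times[0,1]\times V)\cup((\bigcup_{i\in\Omega}V_i)\times\{\bot\}\times V)$; for each $v\in V_{\mathit{nature}}$, $w\in V$ there is exactly one rational $p$ with $(v,p,w)\in\Delta$, forming a probability distribution over $V$. $\mathit{next}(v)=\{w\mid\exists p\in(0,1]\cup\{\bot\},(v,p,w)\in\Delta\}$, nonempty. A vertex $v$ is terminal if $\mathit{next}(v)=\{v\}$. Plays are infinite paths $\pi(0)\pi(1)\dots$ from $v_0$. For a set $F$ of terminal vertices, $\mathit{TR}(F)=\{\pi\mid\exists n.\ \pi(n)\in F\}$ is a terminal reachability objective;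 each player $i$ has such an objective $O_i$. Strategies: $\sigma_i:V^*V_i\to D(V)$ (distributions over successors). Pure: every value is a Dirac distribution. Finite-state: implementable by a Mealy machine with finitely many memory states (reading the history and outputting the distribution). A strategy profile $\bar\sigma$ determines a probability measure $\mathit{Pr}^{\bar\sigma}$ on plays; $\mathit{Pay}_i(\bar\sigma)=\mathit{Pr}^{\bar\sigma}(O_i)$. $\bar\sigma$ is a 0-fixed Nash equilibrium if for every environment player $i\ne0$ and every strategy $\tau$ of player $i$ in the class under consideration, $\mathit{Pay}_i(\bar\sigma_{-i},\tau)\le\mathit{Pay}_i(\bar\sigma)$, where $(\bar\sigma_{-i},\tau)$ replaces player $i$'s strategy by $\tau$. *)

(* Defs.v *)
From Stdlib Require Import Reals List Arith Lia.
From Coquelicot Require Import Coquelicot.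
Import ListNotations.

(* Model of computation: Minsky/register machines (Turing complete).   *)
(* Registers are indexed by nat; input in register 0, output in r. 0.  *)

Inductive instr : Type :=
| INC (r : nat)
| DEC (r : nat) (j : nat).

Definition program := list instr.

Definition mstate : Type := (nat * (nat -> nat))%type.

Definition set_reg (regs : nat -> nat) (r v : nat) : nat -> nat :=
  fun x => if Nat.eqb x r then v else regs x.

Definition mstep (P : program) (s : mstate) : mstate :=
  let (pc, regs) := s in
  match nth_error P pc with
  | None => s
  | Some (INC r) => (S pc, set_reg regs r (S (regs r)))
  | Some (DEC r j) =>
      match regs r with
      | O => (j, regs)
      | S n => (S pc, set_reg regs r n)
      end
  end.

Fixpoint mrun (P : program) (n : nat) (s : mstate) : mstate :=
  match n with O => s | S n' => mrun P n' (mstep P s) end.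

Definition init_state (x : nat) : mstate := (0%nat, fun r => if Nat.eqb r 0 then x else 0%nat).

Definition halts_with (P : program) (x y : nat) : Prop :=
  exists n, (length P <= fst (mrun P n (init_state x)))%nat /\
            snd (mrun P n (init_state x)) 0%nat = y.

(* Games (finite data, so that they can be given to an algorithm).     *)
(* Vertices are 0 .. nV-1; players are 0 .. k (0 = system).            *)

Record game : Type := mkGame {
  g_nV : nat;
  g_k : nat;                           (* number of environment players *)
  g_v0 : nat;
  g_owner : list (option nat);         (* Some i: v in V_i ; None: v in V_nature *)
  g_succ : list (list nat);            (* successors of player vertices *)
  g_prob : list (list (nat * nat));    (* nature: (num, den) of p(v,w) *)
  g_target : list (list nat)
}.

Definition owner (G : game) (v : nat) : option nat := nth v (g_owner G) None.

Definition qentry (G : game) (v w : nat) : nat * nat :=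
  nth w (nth v (g_prob G) []) (0%nat, 1%nat).

Definition natp (G : game) (v w : nat) : R :=
  INR (fst (qentry G v w)) / INR (snd (qentry G v w)).

Definition sumR (l : list R) : R := fold_right Rplus 0%R l.

Definition next (G : game) (v w : nat) : Prop :=
  match owner G v with
  | Some _ => In w (nth v (g_succ G) [])
  | None => (0 < fst (qentry G v w))%nat
  end.

Definition terminal (G : game) (v : nat) : Prop :=
  forall w, next G v w <-> w = v.

Definition target (G : game) (i v : nat) : Prop := In v (nth i (g_target G) []).

Definition target_b (G : game) (i v : nat) : bool :=
  existsb (Nat.eqb v) (nth i (g_target G) []).

Definition wf_game (G : game) : Prop :=
  (g_v0 G < g_nV G)%nat /\
  length (g_owner G) = g_nV G /\
  length (g_succ G) = g_nV G /\
  length (g_prob G) = g_nV G /\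
  length (g_target G) = S (g_k G) /\
  (forall v, (v < g_nV G)%nat ->
     match owner G v with
     | Some i => (i <= g_k G)%nat /\
                 (exists w, In w (nth v (g_succ G) [])) /\
                 (forall w, In w (nth v (g_succ G) []) -> (w < g_nV G)%nat)
     | None => length (nth v (g_prob G) []) = g_nV G /\
               (forall w, (w < g_nV G)%nat -> (0 < snd (qentry G v w))%nat) /\
               sumR (map (natp G v) (seq 0 (g_nV G))) = 1%R
     end) /\
  (forall i v, (i <= g_k G)%nat -> target G i v ->
     (v < g_nV G)%nat /\ terminal G v).

(* Strategies: histories (lists of vertices, last one owned by i)      *)
(* mapped to distributions over vertices.                              *)

Definition strategy : Type := list nat -> nat -> R.

Definition valid_hist (G : game) (h : list nat) : Prop :=
  List.Forall (fun v => (v < g_nV G)%nat) h.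

Definition is_strategy (G : game) (i : nat) (s : strategy) : Prop :=
  forall h v, valid_hist G (h ++ [v]) -> owner G v = Some i ->
    (forall w, (0 <= s (h ++ [v]) w)%R) /\
    (forall w, s (h ++ [v]) w <> 0%R -> next G v w) /\
    sumR (map (s (h ++ [v])) (seq 0 (g_nV G))) = 1%R.

Definition pure (G : game) (i : nat) (s : strategy) : Prop :=
  forall h v, valid_hist G (h ++ [v]) -> owner G v = Some i ->
    exists w, forall w', s (h ++ [v]) w' = if Nat.eqb w' w then 1%R else 0%R.

(* Implementable by a Mealy machine with memory states 0..m-1, initial
   memory m0, update upd (reads each vertex) and output out. *)
Definition finite_state (G : game) (i : nat) (s : strategy) : Prop :=
  exists (m m0 : nat) (upd : nat -> nat -> nat) (out : nat -> nat -> nat -> R),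
    (m0 < m)%nat /\ (forall q v, (q < m)%nat -> (upd q v < m)%nat) /\
    forall h v, valid_hist G (h ++ [v]) -> owner G v = Some i ->
      forall w, s (h ++ [v]) w = out (fold_left upd h m0) v w.

Inductive sclass : Type := PureFiniteState | FiniteState | Pure | Unrestricted.

Definition in_class (c : sclass) (G : game) (i : nat) (s : strategy) : Prop :=
  is_strategy G i s /\
  match c with
  | PureFiniteState => pure G i s /\ finite_state G i s
  | FiniteState => finite_state G i s
  | Pure => pure G i s
  | Unrestricted => True
  end.

(* Probability measure on plays, via cylinder sets.                    *)

Definition profile : Type := nat -> strategy.

Definition step (G : game) (p : profile) (h : list nat) (w : nat) : R :=
  let v := last h 0%nat in
  match owner G v with
  | None => natp G v w
  | Some i => p i h w
  end.

Fixpoint pprob (G : game) (p : profile) (pre rest : list nat) : R :=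
  match rest with
  | [] => 1%R
  | w :: r => (step G p pre w * pprob G p (pre ++ [w]) r)%R
  end.

Definition hprob (G : game) (p : profile) (h : list nat) : R :=
  match h with
  | [] => 0%R
  | v :: r => if Nat.eqb v (g_v0 G) then pprob G p [v] r else 0%R
  end.

Fixpoint all_lists (n len : nat) : list (list nat) :=
  match len with
  | O => [[]]
  | S l => flat_map (fun v => map (cons v) (all_lists n l)) (seq 0 n)
  end.

Definition reach_prob (G : game) (p : profile) (i n : nat) : R :=
  sumR (map (hprob G p)
         (filter (fun h => existsb (target_b G i) h) (all_lists (g_nV G) (S n)))).

(* Pay_i = Pr(TR(F_i)) = sup_n Pr(reach F_i within n steps) *)
Definition Pay (G : game) (p : profile) (i : nat) : Rbar :=
  Sup_seq (fun n => reach_prob G p i n).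

Definition update (p : profile) (i : nat) (t : strategy) : profile :=
  fun j => if Nat.eqb j i then t else p j.

Definition is_NE0 (c : sclass) (G : game) (p : profile) : Prop :=
  forall i, (1 <= i <= g_k G)%nat -> forall t, in_class c G i t ->
    Rbar_le (Pay G (update p i t) i) (Pay G p i).

Definition NCRSP_gt (c : sclass) (G : game) (mu : R) : Prop :=
  exists s0, in_class c G 0 s0 /\
    forall env : profile,
      (forall i, (1 <= i <= g_k G)%nat -> in_class c G i (env i)) ->
      is_NE0 c G (update env 0 s0) ->
      Rbar_lt (Finite mu) (Pay G (update env 0 s0) 0).

Definition cpair (a b : nat) : nat := ((a + b) * (a + b + 1) / 2 + b)%nat.

Fixpoint enc_list {A : Type} (e : A -> nat) (l : list A) : nat :=
  match l with
  | [] => 0%nat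
  | x :: r => S (cpair (e x) (enc_list e r))
  end.

Definition enc_opt (o : option nat) : nat :=
  match o with None => 0%nat | Some i => S i end.

Definition enc_qn (q : nat * nat) : nat := cpair (fst q) (snd q).

Definition encode_instance (G : game) (a b : nat) : nat :=
  enc_list (fun x => x)
    [g_nV G; g_k G; g_v0 G;
     enc_list enc_opt (g_owner G);
     enc_list (enc_list (fun x => x)) (g_succ G);
     enc_list (enc_list enc_qn) (g_prob G);
     enc_list (enc_list (fun x => x)) (g_target G);
     a; b].

(* An instance: a well-formed game and mu = a/b in [0,1]. *)
Definition valid_instance (G : game) (a b : nat) : Prop :=
  wf_game G /\ (0 < b)%nat /\ (a <= b)%nat.

(* Main.v *)
(** The system owns no vertex and the threshold is 0, so the question becomes whether some
    equilibrium of the environment gives the system payoff 0.  The game simulates a register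
    machine: a value [c] of register [r] is the probability [2^-c] with which player 1, who has no
    target, lets a side gadget succeed.  For each register and each parity of the step there is a
    checker and an opponent with disjoint targets, both of which may leave to a lottery giving them
    [kappa] and [1 - kappa] while the system wins.  Hence in an equilibrium without payoff for the
    system the checker gets exactly [kappa] from there on; as it is paid by the gadgets of two
    consecutive steps only, this is a linear equation between the register contents before and
    after the step, which holds for mixed strategies too.  Player 2 guesses the outcome of the zero
    tests and cannot randomise, because the two branches give it at most 3/8 and at least 5/8.

    The simulated machine is diagonal: from its input it computes the code of the very game that
    simulates it on this input, runs the alleged decision procedure on it, and stops at one of two
    locations according to the answer.  One location ends the simulation harmlessly, and the run
    gives a pure finite-state equilibrium; the other makes the system win, and there is no
    equilibrium giving it 0.  Either way the answer was wrong, for all four classes at once. *)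

Require Import Defs.
From Stdlib Require Import Reals List Arith Lia Lra Bool Classical FunctionalExtensionality.
From Coquelicot Require Import Coquelicot.
Import ListNotations.
Open Scope R_scope.
Set Bullet Behavior "Strict Subproofs".

(** * Sums and values of plays *)

(** The constants come from one computation. Let [z] be the success probability of a register gadget
    now and [z'] that of the next half step. A checker checked now is worth [kappa]; one checked a
    half step later collects [rho * (1 - z)] from failures now and a quarter of its next [kappa],
    which makes [phi z]. The equation of the checker checked now is
    [kappa = rho * a * z + phi z' / 4], and it says [z' = 4 * a * z] as soon as
    [4 * kappa = rho + kappa / 4]. This fixes [rho / kappa = 15 / 4], and the weights [a] = 1/4,
    1/8, 1/2 for a register that is kept, incremented, decremented. A checker alone would give only
    an inequality; the opponent, with the complementary target, gives the other one. The
    self-reference needs no recursion theorem. [diag M] is fixed before its input [x], and in the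
    code of its game only the number [X = 2 ^ x] depends on [x], in two table entries. So [x] can be
    the tuple of all other fragments of that code, and the program has only to compute [2 ^ x] and
    put the pieces together. *)

Definition lsum {A : Type} (l : list A) (F : A -> R) : R := sumR (map F l).

Lemma lsum_nil {A} (F : A -> R) : lsum [] F = 0.
Proof. reflexivity. Qed.

Lemma lsum_cons {A} (a : A) l F : lsum (a :: l) F = F a + lsum l F.
Proof. reflexivity. Qed.

Lemma lsum_app {A} (l l' : list A) F : lsum (l ++ l') F = lsum l F + lsum l' F.
Proof.
  induction l as [|a l IH]; cbn [app]; rewrite ?lsum_nil, ?lsum_cons, ?IH; lra.
Qed.

Lemma lsum_map {A B} (f : A -> B) l F : lsum (map f l) F = lsum l (fun a => F (f a)).
Proof. unfold lsum. now rewrite map_map. Qed.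

Lemma lsum_ext {A} (l : list A) F F' :
  (forall a, In a l -> F a = F' a) -> lsum l F = lsum l F'.
Proof.
  intros H. unfold lsum. f_equal. now apply map_ext_in.
Qed.

Lemma lsum_plus {A} (l : list A) F F' :
  lsum l (fun a => F a + F' a) = lsum l F + lsum l F'.
Proof.
  induction l as [|a l IH]; rewrite ?lsum_nil, ?lsum_cons, ?IH; lra.
Qed.

Lemma lsum_scal {A} (l : list A) c F : lsum l (fun a => c * F a) = c * lsum l F.
Proof.
  induction l as [|a l IH]; rewrite ?lsum_nil, ?lsum_cons, ?IH; lra.
Qed.

Lemma lsum_le {A} (l : list A) F F' :
  (forall a, In a l -> F a <= F' a) -> lsum l F <= lsum l F'.
Proof.
  induction l as [|a l IH]; intros H; rewrite ?lsum_nil, ?lsum_cons.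
  - lra.
  - apply Rplus_le_compat; [apply H; now left | apply IH; intros; apply H; now right].
Qed.

Lemma lsum_lt {A} (l : list A) F F' a :
  (forall a, In a l -> F a <= F' a) -> In a l -> F a < F' a -> lsum l F < lsum l F'.
Proof.
  induction l as [|a' l IH]; intros H Ha Hlt; [easy|]; rewrite !lsum_cons.
  destruct Ha as [<-|Ha].
  - apply Rplus_lt_le_compat; [easy|]. apply lsum_le; intros; apply H; now right.
  - apply Rplus_le_lt_compat; [apply H; now left|].
    apply IH; auto. intros; apply H; now right.
Qed.

Lemma lsum_zero {A} (l : list A) F : (forall a, In a l -> F a = 0) -> lsum l F = 0.
Proof.
  induction l as [|a l IH]; intros H; rewrite ?lsum_nil, ?lsum_cons; [easy|].
  rewrite IH by (intros; apply H; now right). rewrite H by now left. lra.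
Qed.

Lemma lsum_nonneg {A} (l : list A) F : (forall a, In a l -> 0 <= F a) -> 0 <= lsum l F.
Proof.
  intros H. rewrite <- (lsum_zero l (fun _ => 0)) by easy. now apply lsum_le.
Qed.

Lemma lsum_const {A} (l : list A) c : lsum l (fun _ => c) = INR (length l) * c.
Proof.
  induction l as [|a l IH]; [rewrite lsum_nil; simpl; lra|].
  rewrite lsum_cons, IH. cbn [length]. rewrite S_INR. lra.
Qed.

Lemma lsum_filter {A} (f : A -> bool) l F :
  lsum (filter f l) F = lsum l (fun a => if f a then F a else 0).
Proof.
  induction l as [|a l IH]; [easy|]. cbn [filter]. rewrite lsum_cons.
  destruct (f a); rewrite ?lsum_cons, IH; lra.
Qed.

Lemma lsum_flat_map {A B} (f : A -> list B) l F :
  lsum (flat_map f l) F = lsum l (fun a => lsum (f a) F).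
Proof.
  induction l as [|a l IH]; [easy|]. cbn [flat_map].
  now rewrite lsum_app, lsum_cons, IH.
Qed.

Lemma lsum_swap {A B} (l : list A) (l' : list B) F :
  lsum l (fun a => lsum l' (F a)) = lsum l' (fun b => lsum l (fun a => F a b)).
Proof.
  induction l as [|a l IH].
  - symmetry. now apply lsum_zero.
  - rewrite lsum_cons, IH, <- lsum_plus. now apply lsum_ext.
Qed.

Lemma lsum_single (l : list nat) a F :
  NoDup l -> In a l -> (forall x, In x l -> x <> a -> F x = 0) -> lsum l F = F a.
Proof.
  induction l as [|a' l IH]; intros Hd Ha H; [easy|]; rewrite lsum_cons.
  inversion_clear Hd as [|? ? Hn Hd'].
  destruct (Nat.eq_dec a' a) as [->|Hne].
  - rewrite lsum_zero; [lra|]. intros x Hx. apply H; [now right|]. now intros ->.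
  - rewrite H, IH; auto.
    + lra.
    + now destruct Ha.
    + intros; apply H; auto. now right.
    + now left.
Qed.

Lemma lsum_single2 (l : list nat) a b F :
  NoDup l -> In a l -> In b l -> a <> b ->
  (forall x, In x l -> x <> a -> x <> b -> F x = 0) -> lsum l F = F a + F b.
Proof.
  intros Hd Ha Hb Hab H.
  rewrite (lsum_ext l F (fun x => (if Nat.eqb x a then F x else 0) +
                                  (if Nat.eqb x b then F x else 0))).
  - rewrite lsum_plus, (lsum_single l a), (lsum_single l b); auto.
    + now rewrite !Nat.eqb_refl.
    + intros x _ Hx. now apply Nat.eqb_neq in Hx as ->.
    + intros x _ Hx. now apply Nat.eqb_neq in Hx as ->.
  - intros x Hx. destruct (Nat.eqb_spec x a), (Nat.eqb_spec x b); subst; try easy; try lra.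
    rewrite H; auto. lra.
Qed.

Lemma lsum_indicator n w : (w < n)%nat ->
  lsum (seq 0 n) (fun w' => if Nat.eqb w' w then 1 else 0) = 1.
Proof.
  intros Hw. rewrite (lsum_single _ w).
  - now rewrite Nat.eqb_refl.
  - apply seq_NoDup.
  - apply in_seq; lia.
  - intros x _ Hx. now apply Nat.eqb_neq in Hx as ->.
Qed.

Lemma is_lim_seq_lsum {A} (l : list A) (F : nat -> A -> R) (L : A -> R) :
  (forall a, In a l -> is_lim_seq (fun n => F n a) (L a)) ->
  is_lim_seq (fun n => lsum l (F n)) (lsum l L).
Proof.
  induction l as [|a l IH]; intros H.
  - apply is_lim_seq_const.
  - rewrite lsum_cons.
    apply is_lim_seq_ext with (fun n => F n a + lsum l (F n)); [easy|].
    apply is_lim_seq_plus'; [apply H; now left|]. apply IH. intros; apply H; now right.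
Qed.

(* The probability, given the history [h], that the target of [i] contains the last vertex of [h]
   or is reached within [n] more steps. *)
Fixpoint val (G : game) (p : profile) (i n : nat) (h : list nat) : R :=
  if target_b G i (last h 0%nat) then 1
  else match n with
       | O => 0
       | S m => lsum (seq 0 (g_nV G)) (fun w => step G p h w * val G p i m (h ++ [w]))
       end.

Lemma val_target G p i n h : target_b G i (last h 0%nat) = true -> val G p i n h = 1.
Proof. intros H. destruct n; simpl; now rewrite H. Qed.

Lemma val_0 G p i h : target_b G i (last h 0%nat) = false -> val G p i 0 h = 0.
Proof. intros H. simpl. now rewrite H. Qed.

Lemma val_S G p i n h : target_b G i (last h 0%nat) = false ->
  val G p i (S n) h = lsum (seq 0 (g_nV G)) (fun w => step G p h w * val G p i n (h ++ [w])).
Proof. intros H. cbn [val]. now rewrite H. Qed.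

Definition strat_profile (G : game) (p : profile) : Prop :=
  forall i, (i <= g_k G)%nat -> is_strategy G i (p i).

Lemma strat_profile_update G p i t :
  strat_profile G p -> is_strategy G i t -> strat_profile G (update p i t).
Proof.
  intros Hp Ht j Hj. unfold update. destruct (Nat.eqb_spec j i) as [->|]; auto.
Qed.

Lemma valid_snoc G g v :
  valid_hist G (g ++ [v]) <-> valid_hist G g /\ (v < g_nV G)%nat.
Proof.
  unfold valid_hist. rewrite Forall_app. split; intros [H1 H2]; split; auto.
  now inversion H2.
Qed.

(** A change at a single history keeps a strategy in each of the four classes, and the local
    condition obtained from it is all that the simulation argument needs of an equilibrium. *)
Definition redirect (s : strategy) (hs : list nat) (w : nat) : strategy :=
  fun h w' => if list_eq_dec Nat.eq_dec h hs then (if Nat.eqb w' w then 1 else 0) else s h w'.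

(* The memory of the redirected strategy pairs the old memory with the length of the
   matched prefix of [hs], the value [S (length hs)] meaning a mismatch. *)
Definition track (hs : list nat) (j v : nat) : nat :=
  if (Nat.ltb j (length hs) && Nat.eqb (nth j hs 0%nat) v)%bool then S j else S (length hs).

Lemma track_le hs j v : (track hs j v <= S (length hs))%nat.
Proof.
  unfold track. destruct (Nat.ltb_spec j (length hs)); simpl; try lia.
  destruct (Nat.eqb _ _); lia.
Qed.

(** A mismatch, or any vertex read after a complete match, leads to the dead value [S (length hs)],
    which is never left; so [length hs] is reached only on exactly the rest of [hs]. *)
Lemma track_fold hs : forall h j, (j <= length hs)%nat ->
  (fold_left (track hs) h j = length hs <-> h = skipn j hs).
Proof.
  assert (Hdead : forall h, fold_left (track hs) h (S (length hs)) = S (length hs)).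
  { induction h as [|v h IH]; auto. simpl. unfold track at 2.
    destruct (Nat.ltb_spec (S (length hs)) (length hs)); [lia|]. apply IH. }
  induction h as [|v h IH]; intros j Hj.
  - simpl. split.
    + intros ->. now rewrite skipn_all.
    + intros H. apply (f_equal (@length nat)) in H. rewrite length_skipn in H. simpl in H. lia.
  - simpl. unfold track at 2. destruct (Nat.ltb_spec j (length hs)) as [Hlt|Hge].
    + simpl.
      assert (Hsk : skipn j hs = nth j hs 0%nat :: skipn (S j) hs).
      { clear -Hlt. revert j Hlt. induction hs as [|a l IHl]; intros j Hlt; simpl in *; [lia|].
        destruct j; simpl; auto. apply IHl. lia. }
      rewrite Hsk. destruct (Nat.eqb_spec (nth j hs 0%nat) v) as [<-|Hne].
      * rewrite IH by lia. split; [now intros ->|now injection 1].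
      * rewrite Hdead. split; [lia|]. intros Heq. injection Heq. congruence.
    + simpl. rewrite Hdead. replace j with (length hs) by lia. rewrite skipn_all.
      split; [lia|easy].
Qed.

Section Generic.
Variable G : game.
Hypothesis Hwf : wf_game G.

Let nV := g_nV G.

(** Rows end at [g_nV], and the default of [nth] is the fraction 0/1: numbers outside the game carry
    no probability. *)
Lemma qentry_out v w : (v < nV)%nat -> owner G v = None -> (nV <= w)%nat ->
  qentry G v w = (0%nat, 1%nat).
Proof.
  destruct Hwf as (_ & _ & _ & _ & _ & H & _). intros Hv Ho Hw.
  specialize (H v Hv). rewrite Ho in H. destruct H as (Hl & _).
  apply nth_overflow. fold nV in Hl. lia.
Qed.

Lemma next_lt v w : (v < nV)%nat -> next G v w -> (w < nV)%nat.
Proof.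
  intros Hv Hn. destruct Hwf as (_ & _ & _ & _ & _ & H & _). specialize (H v Hv).
  unfold next in Hn. destruct (owner G v) eqn:Ho.
  - apply H, Hn.
  - destruct (le_lt_dec nV w); auto. rewrite qentry_out in Hn; auto. simpl in Hn; lia.
Qed.

(** * Values under one fixed profile *)

Section OneProfile.
Variable p : profile.
Hypothesis Hp : strat_profile G p.

Lemma step_dist g v : valid_hist G (g ++ [v]) ->
  (forall w, 0 <= step G p (g ++ [v]) w) /\
  (forall w, step G p (g ++ [v]) w <> 0 -> next G v w /\ (w < nV)%nat) /\
  lsum (seq 0 nV) (step G p (g ++ [v])) = 1.
Proof.
  intros Hv. pose proof Hv as Hv'. apply valid_snoc in Hv' as [_ Hlt].
  pose proof Hwf as (_ & _ & _ & _ & _ & H & _). specialize (H v Hlt).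
  unfold step. rewrite last_last. destruct (owner G v) as [i|] eqn:Ho.
  - destruct H as (Hi & _ & Hs). destruct (Hp i Hi g v Hv Ho) as (H1 & H2 & H3).
    repeat split; auto. eapply next_lt; eauto.
  - destruct H as (Hl & Hd & Hs). repeat split; auto.
    + intros w. unfold natp. destruct (le_lt_dec nV w) as [Hw|Hw].
      * rewrite qentry_out; auto. simpl. lra.
      * apply Rmult_le_pos; [apply pos_INR|].
        left. apply Rinv_0_lt_compat, lt_0_INR, Hd, Hw.
    + unfold next. rewrite Ho. unfold natp in H.
      destruct (fst (qentry G v w)); [|lia]. simpl in H. lra.
    + destruct (le_lt_dec nV w); auto. unfold natp in H.
      rewrite qentry_out in H; auto. simpl in H. lra.
Qed.

Definition expect (h : list nat) (F : nat -> R) : R :=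
  lsum (seq 0 nV) (fun w => step G p h w * F w).

(** Only successors of positive probability have to be compared, so invariants that hold merely
    along possible plays can be used. *)
Lemma expect_le g v F F' : valid_hist G (g ++ [v]) ->
  (forall w, (w < nV)%nat -> 0 < step G p (g ++ [v]) w -> F w <= F' w) ->
  expect (g ++ [v]) F <= expect (g ++ [v]) F'.
Proof.
  intros Hv H. destruct (step_dist g v Hv) as (H0 & _ & _). apply lsum_le.
  intros w Hw. apply in_seq in Hw.
  destruct (Rle_lt_or_eq_dec 0 _ (H0 w)) as [Hs|Hs].
  - apply Rmult_le_compat_l; auto. apply H; auto. lia.
  - rewrite <- Hs. lra.
Qed.

Lemma expect_ext g v F F' : valid_hist G (g ++ [v]) ->
  (forall w, (w < nV)%nat -> 0 < step G p (g ++ [v]) w -> F w = F' w) ->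
  expect (g ++ [v]) F = expect (g ++ [v]) F'.
Proof.
  intros Hv H. apply Rle_antisym; apply expect_le; auto; intros w Hw Hs;
  rewrite (H w Hw Hs); lra.
Qed.

Lemma expect_const g v c : valid_hist G (g ++ [v]) -> expect (g ++ [v]) (fun _ => c) = c.
Proof.
  intros Hv. destruct (step_dist g v Hv) as (_ & _ & H1). unfold expect.
  rewrite (lsum_ext _ _ (fun w => c * step G p (g ++ [v]) w)) by (intros; lra).
  rewrite lsum_scal, H1. lra.
Qed.

Lemma expect_plus h F F' : expect h (fun w => F w + F' w) = expect h F + expect h F'.
Proof.
  unfold expect. rewrite <- lsum_plus. apply lsum_ext. intros; lra.
Qed.

Lemma val_step i n h : target_b G i (last h 0%nat) = false ->
  val G p i (S n) h = expect h (fun w => val G p i n (h ++ [w])).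
Proof. apply val_S. Qed.

Lemma valid_next g v w : valid_hist G (g ++ [v]) -> (w < nV)%nat ->
  valid_hist G ((g ++ [v]) ++ [w]).
Proof. intros. apply valid_snoc; auto. Qed.

Lemma val_bounds i n : forall g v, valid_hist G (g ++ [v]) ->
  0 <= val G p i n (g ++ [v]) <= 1.
Proof.
  induction n as [|n IH]; intros g v Hv;
    destruct (target_b G i (last (g ++ [v]) 0%nat)) eqn:Ht;
    try (rewrite val_target by easy; lra).
  - rewrite val_0 by easy; lra.
  - rewrite val_step by easy. split.
    + rewrite <- (expect_const g v 0 Hv). apply expect_le; auto.
      intros w Hw _. apply IH. now apply valid_next.
    + rewrite <- (expect_const g v 1 Hv). apply expect_le; auto.
      intros w Hw _. apply IH. now apply valid_next.
Qed.

Lemma val_incr i n : forall g v, valid_hist G (g ++ [v]) ->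
  val G p i n (g ++ [v]) <= val G p i (S n) (g ++ [v]).
Proof.
  induction n as [|n IH]; intros g v Hv;
    destruct (target_b G i (last (g ++ [v]) 0%nat)) eqn:Ht;
    try (rewrite !val_target by easy; lra).
  - rewrite val_0 by easy. now apply val_bounds.
  - rewrite (val_step i n), (val_step i (S n)) by easy. apply expect_le; auto.
    intros w Hw _. apply IH. now apply valid_next.
Qed.

Lemma pprob_total n : forall g v, valid_hist G (g ++ [v]) ->
  lsum (all_lists nV n) (pprob G p (g ++ [v])) = 1.
Proof.
  induction n as [|n IH]; intros g v Hv.
  - unfold lsum; simpl; lra.
  - cbn [all_lists]. rewrite lsum_flat_map. rewrite <- (expect_const g v 1 Hv).
    apply lsum_ext. intros w Hw. apply in_seq in Hw. rewrite lsum_map.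
    cbn [pprob]. rewrite lsum_scal, IH; auto. apply valid_next; auto; lia.
Qed.

(** Once the target is met, the continuations have total probability 1, which is why [val] may stop
    there with value 1. *)
Lemma val_pprob i n : forall g v, valid_hist G (g ++ [v]) ->
  lsum (all_lists nV n)
    (fun r => if existsb (target_b G i) (v :: r) then pprob G p (g ++ [v]) r else 0)
  = val G p i n (g ++ [v]).
Proof.
  induction n as [|n IH]; intros g v Hv; destruct (target_b G i v) eqn:Ht.
  - rewrite val_target by now rewrite last_last.
    unfold lsum. simpl. rewrite Ht. simpl. lra.
  - rewrite val_0 by now rewrite last_last.
    unfold lsum. simpl. rewrite Ht. simpl. lra.
  - rewrite val_target by now rewrite last_last.
    rewrite <- (pprob_total (S n) g v Hv). apply lsum_ext.
    intros r _. cbn [existsb]. now rewrite Ht.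
  - rewrite val_step by now rewrite last_last.
    cbn [all_lists]. rewrite lsum_flat_map. apply lsum_ext.
    intros w Hw. apply in_seq in Hw. rewrite lsum_map, <- IH by (apply valid_next; auto; lia).
    rewrite <- lsum_scal. apply lsum_ext. intros r _. cbn [existsb pprob]. rewrite Ht.
    cbn [orb]. destruct (_ || _)%bool; lra.
Qed.

Lemma v0_valid : valid_hist G ([] ++ [g_v0 G]).
Proof. apply valid_snoc. split; [constructor|apply Hwf]. Qed.

Lemma reach_prob_val i n : reach_prob G p i n = val G p i n [g_v0 G].
Proof.
  unfold reach_prob. fold nV.
  change (lsum (filter (fun h => existsb (target_b G i) h) (all_lists nV (S n))) (hprob G p)
          = val G p i n ([] ++ [g_v0 G])).
  rewrite lsum_filter, <- val_pprob by apply v0_valid.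
  cbn [all_lists]. rewrite lsum_flat_map.
  rewrite (lsum_single _ (g_v0 G)).
  - rewrite lsum_map. apply lsum_ext. intros r _. cbn [hprob app]. now rewrite Nat.eqb_refl.
  - apply seq_NoDup.
  - apply in_seq. destruct Hwf as [H _]. unfold nV. lia.
  - intros v _ Hv. rewrite lsum_map. apply lsum_zero. intros r _. cbn [hprob].
    apply Nat.eqb_neq in Hv as ->. now destruct (existsb _ _).
Qed.

Definition xval (i : nat) (h : list nat) : R := real (Lim_seq (fun n => val G p i n h)).

Lemma xval_lim i g v : valid_hist G (g ++ [v]) ->
  is_lim_seq (fun n => val G p i n (g ++ [v])) (xval i (g ++ [v])).
Proof.
  intros Hv. apply Lim_seq_correct'.
  apply (ex_finite_lim_seq_incr _ 1).
  - intros n. now apply val_incr.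
  - intros n. now apply val_bounds.
Qed.

Lemma val_le_xval i n g v : valid_hist G (g ++ [v]) ->
  val G p i n (g ++ [v]) <= xval i (g ++ [v]).
Proof.
  intros Hv. apply (is_lim_seq_incr_compare _ _ (xval_lim i g v Hv)).
  intros m. now apply val_incr.
Qed.

Lemma xval_le i g v c : valid_hist G (g ++ [v]) ->
  (forall n, val G p i n (g ++ [v]) <= c) -> xval i (g ++ [v]) <= c.
Proof.
  intros Hv H. pose proof (is_lim_seq_le _ (fun _ => c) _ (Finite c) H
    (xval_lim i g v Hv) (is_lim_seq_const c)) as Hle. exact Hle.
Qed.

Lemma xval_bounds i g v : valid_hist G (g ++ [v]) -> 0 <= xval i (g ++ [v]) <= 1.
Proof.
  intros Hv. split.
  - apply Rle_trans with (val G p i 0 (g ++ [v])); [now apply val_bounds|now apply val_le_xval].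
  - apply xval_le; auto. intros n. now apply val_bounds.
Qed.

(** The supremum in [Pay] is a limit because the horizon values increase; later arguments work with
    [xval]. *)
Lemma Pay_xval i : Pay G p i = Finite (xval i [g_v0 G]).
Proof.
  apply is_sup_seq_unique. change [g_v0 G] with ([] ++ [g_v0 G]).
  intros eps. split.
  - intros n. simpl. rewrite reach_prob_val.
    pose proof (val_le_xval i n [] (g_v0 G) v0_valid) as H. simpl in H.
    destruct eps as [e He]; simpl; lra.
  - pose proof (xval_lim i [] (g_v0 G) v0_valid) as H.
    apply is_lim_seq_spec in H. destruct (H eps) as [N HN]. exists N. simpl.
    rewrite reach_prob_val. specialize (HN N (Nat.le_refl N)). simpl in HN.
    apply Rabs_lt_between in HN. lra.
Qed.

Lemma xval_target i h : target_b G i (last h 0%nat) = true -> xval i h = 1.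
Proof.
  intros Ht. unfold xval. rewrite (Lim_seq_ext _ (fun _ => 1)).
  - now rewrite Lim_seq_const.
  - intros n. now apply val_target.
Qed.

Lemma xval_step i g v : valid_hist G (g ++ [v]) -> target_b G i v = false ->
  xval i (g ++ [v]) = expect (g ++ [v]) (fun w => xval i ((g ++ [v]) ++ [w])).
Proof.
  intros Hv Ht.
  pose proof (xval_lim i g v Hv) as H. apply is_lim_seq_incr_1 in H.
  assert (H' : is_lim_seq (fun n => val G p i (S n) (g ++ [v]))
                 (expect (g ++ [v]) (fun w => xval i ((g ++ [v]) ++ [w])))).
  { apply is_lim_seq_ext with
      (fun n => expect (g ++ [v]) (fun w => val G p i n ((g ++ [v]) ++ [w]))).
    - intros n. symmetry. apply val_step. now rewrite last_last.
    - apply (is_lim_seq_lsum (seq 0 nV)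
        (fun n w => step G p (g ++ [v]) w * val G p i n ((g ++ [v]) ++ [w]))
        (fun w => step G p (g ++ [v]) w * xval i ((g ++ [v]) ++ [w]))).
      intros w Hw. apply in_seq in Hw.
      apply is_lim_seq_mult'; [apply is_lim_seq_const|].
      apply xval_lim. apply valid_next; auto; lia. }
  apply is_lim_seq_unique in H. apply is_lim_seq_unique in H'.
  rewrite H in H'. now injection H'.
Qed.

Inductive reach : list nat -> Prop :=
| reach_init : reach [g_v0 G]
| reach_step h w : reach h -> (w < nV)%nat -> 0 < step G p h w -> reach (h ++ [w]).

Lemma reach_valid h : reach h -> valid_hist G h /\ exists g v, h = g ++ [v].
Proof.
  induction 1 as [|h w _ [IH _] Hw _].
  - split; [apply v0_valid|]. now exists [], (g_v0 G).
  - split; [now apply valid_snoc|]. now exists h, w.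
Qed.

(** [W] has to dominate only one step ahead, on a set [D] that the play does not leave; the
    induction on the horizon starts from [0 <= W], so no termination of the play is required. *)
Lemma supersolution i (D : list nat -> Prop) (W : list nat -> R) :
  (forall g v, D (g ++ [v]) -> valid_hist G (g ++ [v]) -> 0 <= W (g ++ [v]) /\
     if target_b G i v then 1 <= W (g ++ [v])
     else (forall w, (w < nV)%nat -> 0 < step G p (g ++ [v]) w -> D ((g ++ [v]) ++ [w])) /\
          expect (g ++ [v]) (fun w => W ((g ++ [v]) ++ [w])) <= W (g ++ [v])) ->
  forall n g v, D (g ++ [v]) -> valid_hist G (g ++ [v]) ->
  val G p i n (g ++ [v]) <= W (g ++ [v]).
Proof.
  intros H n. induction n as [|n IH]; intros g v HD Hv;
    destruct (H g v HD Hv) as [H0 H1]; destruct (target_b G i v) eqn:Ht;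
    try (rewrite val_target by (now rewrite last_last); lra).
  - rewrite val_0 by (now rewrite last_last); lra.
  - rewrite val_step by now rewrite last_last.
    destruct H1 as [H1 H2]. eapply Rle_trans; [|apply H2].
    apply expect_le; auto. intros w Hw Hs. apply IH; auto. now apply valid_next.
Qed.

Lemma xval_supersolution i (D : list nat -> Prop) (W : list nat -> R) :
  (forall g v, D (g ++ [v]) -> valid_hist G (g ++ [v]) -> 0 <= W (g ++ [v]) /\
     if target_b G i v then 1 <= W (g ++ [v])
     else (forall w, (w < nV)%nat -> 0 < step G p (g ++ [v]) w -> D ((g ++ [v]) ++ [w])) /\
          expect (g ++ [v]) (fun w => W ((g ++ [v]) ++ [w])) <= W (g ++ [v])) ->
  forall g v, D (g ++ [v]) -> valid_hist G (g ++ [v]) ->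
  xval i (g ++ [v]) <= W (g ++ [v]).
Proof.
  intros H g v HD Hv. apply xval_le; auto. intros n. eapply supersolution; eauto.
Qed.

(** Each step to a reached history has positive probability, so a positive value anywhere shows up
    at the start. The use is contrapositive: payoff 0 for the system means value 0 at every reached
    history. *)
Lemma xval_pos_back i h : reach h -> 0 < xval i h -> 0 < xval i [g_v0 G].
Proof.
  induction 1 as [|h w Hr IH Hw Hs]; auto. intros Hx. apply IH.
  destruct (reach_valid h Hr) as [Hv (g & v & ->)].
  destruct (target_b G i v) eqn:Ht.
  - rewrite xval_target by (now rewrite last_last). lra.
  - rewrite xval_step by auto. rewrite <- (expect_const g v 0 Hv).
    destruct (step_dist g v Hv) as (H0 & _ & _).
    apply lsum_lt with w.
    + intros a Ha. apply in_seq in Ha. apply Rmult_le_compat_l; auto.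
      apply xval_bounds. apply valid_next; auto; lia.
    + apply in_seq. lia.
    + now apply Rmult_lt_compat_l.
Qed.

End OneProfile.

(** * One-shot deviations *)

Section OneShot.
Variables p p' : profile.
Hypothesis Hp : strat_profile G p.
Hypothesis Hp' : strat_profile G p'.
Variable hs : list nat.
Hypothesis Hagree : forall h w, h <> hs -> step G p' h w = step G p h w.

Lemma val_off_prefix i n : forall h, (forall t, hs <> h ++ t) ->
  val G p' i n h = val G p i n h.
Proof.
  induction n as [|n IH]; intros h Hh; cbn [val]; destruct (target_b G i _); auto.
  apply lsum_ext. intros w _. rewrite Hagree.
  - rewrite IH; auto. intros t Ht. apply (Hh (w :: t)). now rewrite Ht, <- app_assoc.
  - intros ->. apply (Hh []). now rewrite app_nil_r.
Qed.

Lemma xval_off_prefix i h : (forall t, hs <> h ++ t) -> xval p' i h = xval p i h.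
Proof.
  intros Hh. unfold xval. f_equal. apply Lim_seq_ext. intros n. now apply val_off_prefix.
Qed.

(** The gain is carried back along the history: at each earlier vertex the branch towards [hs]
    improves, and the other branches never see the change. *)
Lemma one_shot_gain i h : reach p h -> (exists t, hs = h ++ t) ->
  xval p i h < xval p' i h -> xval p i [g_v0 G] < xval p' i [g_v0 G].
Proof.
  induction 1 as [|h w Hr IH Hw Hs]; auto. intros [t Ht] Hx.
  destruct (reach_valid p h Hr) as [Hv (g & v & Hgv)].
  apply IH.
  - exists (w :: t). now rewrite Ht, <- app_assoc.
  - subst h. destruct (target_b G i v) eqn:Htg.
    (* A target vertex is terminal, so the next vertex is the same target and both values there are
       1, which leaves nothing to gain. *)
    + exfalso. rewrite Ht in Hagree.
      destruct (step_dist p Hp g v Hv) as (H0 & Hn & Hsum).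
      destruct Hwf as (_ & _ & _ & _ & Hlen & _ & Hterm).
      assert (Hi : (i <= g_k G)%nat).
      { destruct (le_lt_dec i (g_k G)) as [|Hi]; auto. unfold target_b in Htg.
        rewrite nth_overflow in Htg; [easy|]. rewrite Hlen. lia. }
      assert (Htar : target G i v).
      { unfold target_b in Htg. apply existsb_exists in Htg as (v' & Hin & Heq).
        apply Nat.eqb_eq in Heq. now subst. }
      destruct (Hterm i v Hi Htar) as [_ Hter].
      destruct (Hn w ltac:(lra)) as [Hnw _]. apply Hter in Hnw. subst w.
      rewrite !xval_target in Hx by (now rewrite last_last). lra.
    + rewrite !xval_step by auto. unfold expect.
      destruct (step_dist p Hp g v Hv) as (H0 & _ & _).
      apply lsum_lt with w.
      * intros a Ha. rewrite Hagree.
        -- destruct (Nat.eq_dec a w) as [->|Hne].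
           ++ apply Rmult_le_compat_l; auto. lra.
           ++ rewrite xval_off_prefix; [lra|]. intros t' Ht'. rewrite Ht in Ht'.
              rewrite <- !app_assoc in Ht'. apply app_inv_head in Ht'. apply app_inv_head in Ht'.
              simpl in Ht'. congruence.
        -- rewrite Ht. intros Heq. apply (f_equal (@length nat)) in Heq.
           rewrite !length_app in Heq. simpl in Heq. lia.
      * apply in_seq. lia.
      * rewrite Hagree; [now apply Rmult_lt_compat_l|].
        rewrite Ht. intros Heq. apply (f_equal (@length nat)) in Heq.
        rewrite !length_app in Heq. simpl in Heq. lia.
Qed.

End OneShot.

Lemma redirect_class c i s g v w :
  in_class c G i s -> valid_hist G (g ++ [v]) -> owner G v = Some i -> next G v w ->
  in_class c G i (redirect s (g ++ [v]) w).
Proof.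
  intros [Hs Hc] Hv Ho Hn.
  pose proof Hv as Hv'. apply valid_snoc in Hv' as [_ Hlt].
  pose proof (next_lt v w Hlt Hn) as Hw.
  assert (Hpure : pure G i s -> pure G i (redirect s (g ++ [v]) w)).
  { intros H h u Hhu Hou. unfold redirect. destruct (list_eq_dec _ _ _); eauto. }
  assert (Hfin : finite_state G i s -> finite_state G i (redirect s (g ++ [v]) w)).
  { intros (m & m0 & upd & out & Hm & Hupd & Hout).
    (* The new memory codes a pair as [a + m * j], with old memory [a < m] and [j] among the
       [length g + 2] values of [track]. Only [g] is tracked; the last vertex is compared in the
       output function. *)
    set (L := S (S (length g))).
    exists (m * L)%nat, (m0 + m * 0)%nat,
      (fun q u => upd (q mod m) u + m * track g (q / m) u)%nat,
      (fun q u w' => if (Nat.eqb (q / m) (length g) && Nat.eqb u v)%bool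
                     then (if Nat.eqb w' w then 1 else 0) else out (q mod m)%nat u w').
    assert (Hdm : forall a j, (a < m -> (a + m * j) / m = j /\ (a + m * j) mod m = a)%nat).
    { intros a j Ha. split.
      - rewrite (Nat.mul_comm m j), Nat.div_add, Nat.div_small; lia.
      - rewrite (Nat.mul_comm m j), Nat.Div0.mod_add, Nat.mod_small; lia. }
    split; [|split].
    - unfold L. nia.
    - intros q u Hq. pose proof (track_le g (q / m) u).
      pose proof (Hupd (q mod m)%nat u ltac:(apply Nat.mod_upper_bound; lia)). unfold L. nia.
    - intros h u Hhu Hou w'.
      assert (Hfold : forall h a j, (a < m)%nat ->
        fold_left (fun q u => upd (q mod m) u + m * track g (q / m) u)%nat h (a + m * j)%nat
        = (fold_left upd h a + m * fold_left (track g) h j)%nat /\ (fold_left upd h a < m)%nat).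
      { induction h0 as [|x h0 IH]; intros a j Ha; simpl; auto.
        destruct (Hdm a j Ha) as [-> ->]. apply IH. now apply Hupd. }
      destruct (Hfold h m0 0%nat Hm) as [-> Hlt'].
      destruct (Hdm _ (fold_left (track g) h 0%nat) Hlt') as [-> ->].
      pose proof (track_fold g h 0 ltac:(lia)) as Htr. simpl in Htr.
      unfold redirect. destruct (list_eq_dec Nat.eq_dec (h ++ [u]) (g ++ [v])) as [Heq|Hne].
      + apply app_inj_tail in Heq as [-> ->].
        rewrite (proj2 Htr eq_refl), !Nat.eqb_refl. easy.
      + destruct (Nat.eqb_spec (fold_left (track g) h 0%nat) (length g)) as [He|He]; simpl.
        * apply Htr in He. subst h. destruct (Nat.eqb_spec u v); [now subst|].
          apply Hout; auto.
        * apply Hout; auto. }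
  split.
  - intros h u Hhu Hou. unfold redirect.
    destruct (list_eq_dec Nat.eq_dec (h ++ [u]) (g ++ [v])) as [Heq|Hne].
    + apply app_inj_tail in Heq as [-> ->]. repeat split.
      * intros w'. destruct (Nat.eqb _ _); lra.
      * intros w'. destruct (Nat.eqb_spec w' w); [now subst|lra].
      * now apply lsum_indicator.
    + now apply Hs.
  - destruct c; simpl in *; tauto.
Qed.

(** The one consequence of the equilibrium condition that is drawn: were a successor better than the
    current value, redirecting once would be a profitable deviation inside the class. *)
Lemma NE_successor c p i g v w :
  strat_profile G p -> is_NE0 c G p -> (1 <= i <= g_k G)%nat -> in_class c G i (p i) ->
  reach p (g ++ [v]) -> owner G v = Some i -> target_b G i v = false -> next G v w ->
  xval p i ((g ++ [v]) ++ [w]) <= xval p i (g ++ [v]).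
Proof.
  intros Hp HNE Hi Hci Hr Ho Ht Hn.
  destruct (reach_valid p _ Hr) as [Hv _].
  pose proof Hv as Hv'. apply valid_snoc in Hv' as [_ Hlt].
  pose proof (next_lt v w Hlt Hn) as Hw.
  destruct (Rle_lt_dec (xval p i ((g ++ [v]) ++ [w])) (xval p i (g ++ [v]))) as [|Hx]; auto.
  exfalso. set (t := redirect (p i) (g ++ [v]) w).
  assert (Htc : in_class c G i t) by now apply redirect_class.
  assert (Hp' : strat_profile G (update p i t)) by (apply strat_profile_update; [easy|apply Htc]).
  assert (Hag : forall h w0, h <> g ++ [v] -> step G (update p i t) h w0 = step G p h w0).
  { intros h w0 Hh. unfold step. destruct (owner G (last h 0%nat)); auto.
    unfold update. destruct (Nat.eqb_spec n i) as [->|]; auto.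
    unfold t, redirect. now destruct (list_eq_dec _ _ _). }
  specialize (HNE i Hi t Htc). rewrite !Pay_xval in HNE by auto. simpl in HNE.
  pose proof (one_shot_gain p (update p i t) Hp Hp' (g ++ [v]) Hag i (g ++ [v]) Hr) as Hg.
  assert (Hgain : xval p i (g ++ [v]) < xval (update p i t) i (g ++ [v])).
  { rewrite (xval_step (update p i t)) by auto. unfold expect.
    rewrite (lsum_single _ w).
    - unfold step at 1. rewrite last_last, Ho. unfold update at 1. rewrite Nat.eqb_refl.
      unfold t at 1, redirect. destruct (list_eq_dec _ _ _); [|easy]. rewrite Nat.eqb_refl.
      rewrite (xval_off_prefix p (update p i t) (g ++ [v]) Hag); [lra|].
      intros t' Heq. apply (f_equal (@length nat)) in Heq. rewrite !length_app in Heq.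
      simpl in Heq. lia.
    - apply seq_NoDup.
    - apply in_seq. lia.
    - intros w' _ Hne. unfold step. rewrite last_last, Ho. unfold update at 1.
      rewrite Nat.eqb_refl. unfold t at 1, redirect. destruct (list_eq_dec _ _ _); [|easy].
      apply Nat.eqb_neq in Hne as ->. lra. }
  specialize (Hg ltac:(exists []; now rewrite app_nil_r) Hgain). lra.
Qed.

Lemma val_closed_zero p i (Cl : nat -> Prop) : strat_profile G p ->
  (forall v, Cl v -> target_b G i v = false) ->
  (forall v w, Cl v -> (v < nV)%nat -> next G v w -> Cl w) ->
  forall n g v, valid_hist G (g ++ [v]) -> Cl v -> val G p i n (g ++ [v]) = 0.
Proof.
  intros Hp Ht Hc n. induction n as [|n IH]; intros g v Hv HC.
  - apply val_0. rewrite last_last. auto.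
  - rewrite val_step by (rewrite last_last; auto).
    rewrite <- (expect_const p Hp g v 0 Hv). apply expect_ext; auto.
    intros w Hw Hs. apply IH; [now apply valid_next|].
    destruct (step_dist p Hp g v Hv) as (_ & Hn & _).
    apply Hc with v; auto.
    + now apply valid_snoc in Hv.
    + apply Hn. lra.
Qed.

Lemma xval_closed_zero p i (Cl : nat -> Prop) : strat_profile G p ->
  (forall v, Cl v -> target_b G i v = false) ->
  (forall v w, Cl v -> (v < nV)%nat -> next G v w -> Cl w) ->
  forall g v, valid_hist G (g ++ [v]) -> Cl v -> xval p i (g ++ [v]) = 0.
Proof.
  intros Hp Ht Hc g v Hv HC. apply Rle_antisym.
  - apply xval_le; auto. intros n. rewrite (val_closed_zero p i Cl); auto. lra.
  - now apply xval_bounds.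
Qed.

(** Targets are terminal, so a play that meets one never meets the other. The bound is proved at
    each horizon and passes to the limit. *)
Lemma xval_disjoint p i j : strat_profile G p -> (i <= g_k G)%nat -> (j <= g_k G)%nat ->
  (forall v, target_b G i v = true -> target_b G j v = false) ->
  forall g v, valid_hist G (g ++ [v]) ->
  xval p i (g ++ [v]) + xval p j (g ++ [v]) <= 1.
Proof.
  intros Hp Hi Hj Hd.
  assert (Hstuck : forall a b, (a <= g_k G)%nat ->
     (forall v, target_b G a v = true -> target_b G b v = false) ->
     forall n g v, valid_hist G (g ++ [v]) -> target_b G a v = true ->
     val G p b n (g ++ [v]) = 0).
  { intros a b Ha Hab n g v Hv Hav. apply val_closed_zero with (Cl := fun u => u = v); auto.
    - intros u ->. auto.
    - intros u w -> _ Hnx. destruct Hwf as (_ & _ & _ & _ & _ & _ & Hterm).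
      apply (Hterm a v Ha); auto. unfold target_b in Hav.
      apply existsb_exists in Hav as (v' & Hin & Heq). apply Nat.eqb_eq in Heq. now subst. }
  assert (Hn : forall n g v, valid_hist G (g ++ [v]) ->
     val G p i n (g ++ [v]) + val G p j n (g ++ [v]) <= 1).
  { induction n as [|n IH]; intros g v Hv;
    destruct (target_b G i v) eqn:Hti.
    - rewrite (Hstuck i j) by auto. pose proof (val_bounds p Hp i 0 g v Hv). lra.
    - destruct (target_b G j v) eqn:Htj.
      + rewrite (Hstuck j i); auto.
        * pose proof (val_bounds p Hp j 0 g v Hv). lra.
        * intros u Hu. destruct (target_b G i u) eqn:E; auto. apply Hd in E. congruence.
      + rewrite !val_0 by now rewrite last_last. lra.
    - rewrite (Hstuck i j) by auto. pose proof (val_bounds p Hp i (S n) g v Hv). lra.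
    - destruct (target_b G j v) eqn:Htj.
      + rewrite (Hstuck j i); auto.
        * pose proof (val_bounds p Hp j (S n) g v Hv). lra.
        * intros u Hu. destruct (target_b G i u) eqn:E; auto. apply Hd in E. congruence.
      + rewrite !val_step by now rewrite last_last.
        rewrite <- expect_plus, <- (expect_const p Hp g v 1 Hv). apply expect_le; auto.
        intros w Hw _. apply IH. now apply valid_next. }
  intros g v Hv.
  pose proof (is_lim_seq_plus' _ _ _ _ (xval_lim p Hp i g v Hv) (xval_lim p Hp j g v Hv)) as Hl.
  pose proof (is_lim_seq_le _ (fun _ => 1) _ (Finite 1) (fun n => Hn n g v Hv)
    Hl (is_lim_seq_const 1)) as Hle. exact Hle.
Qed.

End Generic.

(** * The game of a register machine *)

Inductive kind : Type := Neu | Inc | Dec | Nul.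

(* In [NOp pc br] the flag [br] tells whether a [DEC] found its register nonzero. *)
Inductive node : Type := NInit | NOp (pc : nat) (br : bool) | NGood.

(* The flag [b] is the parity of the half step, and tells which family of checkers is checked.
   [VL], [VN], [VS] form the gadget of a register: player 1 loops, reaching [VS] with probability
   [2^-c] after [c] loops, and failing into [VT r (negb b)] otherwise.  [VK] is the gadget that
   loads the input.  [VChain] are the checks, all exits leading to [VE]; [VNat] distributes
   over the gadgets and the continuation.  At [VC] player 2 chooses the branch of a [DEC], the
   nonzero one being confirmed at [VD] by player 1.  [VT r b] pays the checker of family [b]
   for register [r] and all opponents but its own, [VZ] all opponents, [VY] moreover player 2,
   [VG] all checkers, [VA] the system and all checkers, [VB] the system and all opponents. *)
Inductive vert : Type :=
| VK
| VS (k : kind) (b : bool) (r : nat)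
| VT (r : nat) (b : bool)
| VL (k : kind) (b : bool) (r : nat)
| VN (k : kind) (b : bool) (r : nat)
| VChain (nd : node) (b : bool) (j : nat)
| VNat (nd : node) (b : bool)
| VC (pc : nat) (b : bool)
| VD (pc : nat) (b : bool)
| VGend (b : bool)
| VE | VZ | VY | VG | VA | VB.

Definition kind_eq_dec (k k' : kind) : {k = k'} + {k <> k'}.
Proof. decide equality. Defined.

Definition node_eq_dec (n n' : node) : {n = n'} + {n <> n'}.
Proof. decide equality; auto using Nat.eq_dec, bool_dec. Defined.

Definition vert_eq_dec (v v' : vert) : {v = v'} + {v <> v'}.
Proof.
  decide equality; auto using Nat.eq_dec, bool_dec, kind_eq_dec, node_eq_dec.
Defined.

Fixpoint index (l : list vert) (v : vert) : nat :=
  match l with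
  | [] => 0
  | a :: l' => if vert_eq_dec a v then 0 else S (index l' v)
  end%nat.

Lemma nth_index l v d : In v l -> nth (index l v) l d = v /\ (index l v < length l)%nat.
Proof.
  induction l as [|a l IH]; [easy|]. intros H. simpl.
  destruct (vert_eq_dec a v) as [->|Hne]; [split; [easy|lia]|].
  destruct H as [H|H]; [easy|]. destruct (IH H). split; [easy|lia].
Qed.

Lemma index_nth l i d : NoDup l -> (i < length l)%nat -> index l (nth i l d) = i.
Proof.
  intros Hd. revert i. induction Hd as [|a l Hn Hd IH]; intros i Hi; simpl in *; [lia|].
  destruct i as [|i].
  - now destruct (vert_eq_dec a a).
  - destruct (vert_eq_dec a (nth i l d)) as [He|].
    + exfalso. apply Hn. rewrite He. apply nth_In. lia.
    + f_equal. apply IH. lia.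
Qed.

Definition kinds := [Neu; Inc; Dec; Nul].
Definition bools := [true; false].

Section GameDef.
Variable Q : program.
Variable nr X : nat.

Definition nodes : list node :=
  NInit :: NGood :: flat_map (fun pc => [NOp pc true; NOp pc false]) (seq 0 (length Q)).

Definition allv : list vert :=
  [VK; VE; VGend true; VGend false; VZ; VY; VG; VA; VB] ++
  flat_map (fun b => flat_map (fun r =>
    VT r b :: flat_map (fun k => [VS k b r; VL k b r; VN k b r]) kinds) (seq 0 nr)) bools ++
  flat_map (fun b => flat_map (fun nd =>
    VNat nd b :: map (VChain nd b) (seq 0 (2 * nr))) nodes) bools ++
  flat_map (fun b => flat_map (fun pc => [VC pc b; VD pc b]) (seq 0 (length Q))) bools.

Definition oknode (nd : node) : Prop :=
  match nd with NOp pc _ => (pc < length Q)%nat | _ => True end.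

Definition okv (v : vert) : Prop :=
  match v with
  | VS _ _ r | VL _ _ r | VN _ _ r | VT r _ => (r < nr)%nat
  | VChain nd _ j => oknode nd /\ (j < 2 * nr)%nat
  | VNat nd _ => oknode nd
  | VC pc _ | VD pc _ => (pc < length Q)%nat
  | _ => True
  end.

Lemma in_nodes nd : In nd nodes <-> oknode nd.
Proof.
  unfold nodes. simpl. rewrite in_flat_map. destruct nd as [|pc br|]; simpl.
  - intuition.
  - split.
    + intros [H|[H|(x & Hx & H)]]; try easy. apply in_seq in Hx.
      simpl in H. destruct H as [H|[H|[]]]; injection H; intros; subst; lia.
    + intros H. right; right. exists pc. split; [apply in_seq; lia|].
      destruct br; simpl; auto.
  - intuition.
Qed.

Lemma in_bools b : In b bools.
Proof. destruct b; simpl; auto. Qed.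

Lemma in_allv v : In v allv <-> okv v.
Proof.
  unfold allv. rewrite !in_app_iff, !in_flat_map. split.
  - intros [H|[(b & _ & H)|[(b & _ & H)|(b & _ & H)]]].
    + simpl in H. repeat destruct H as [<-|H]; simpl; easy.
    + apply in_flat_map in H as (r & Hr & H). apply in_seq in Hr.
      simpl in H. repeat destruct H as [<-|H]; simpl; try lia; easy.
    + apply in_flat_map in H as (nd & Hnd & H). apply in_nodes in Hnd.
      destruct H as [<-|H]; [easy|]. apply in_map_iff in H as (j & <- & Hj).
      apply in_seq in Hj. split; [easy|lia].
    + apply in_flat_map in H as (pc & Hpc & H). apply in_seq in Hpc.
      simpl in H. repeat destruct H as [<-|H]; simpl; try lia; easy.
  - intros H. destruct v; simpl in H; try (left; simpl; tauto);
      try (left; destruct b; simpl; tauto).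
    + right; left. exists b. split; [apply in_bools|]. apply in_flat_map. exists r.
      split; [apply in_seq; lia|]. destruct k; simpl; tauto.
    + right; left. exists b. split; [apply in_bools|]. apply in_flat_map. exists r.
      split; [apply in_seq; lia|]. simpl; tauto.
    + right; left. exists b. split; [apply in_bools|]. apply in_flat_map. exists r.
      split; [apply in_seq; lia|]. destruct k; simpl; tauto.
    + right; left. exists b. split; [apply in_bools|]. apply in_flat_map. exists r.
      split; [apply in_seq; lia|]. destruct k; simpl; tauto.
    + right; right; left. exists b. split; [apply in_bools|]. apply in_flat_map. exists nd.
      split; [now apply in_nodes|]. right. apply in_map, in_seq. lia.
    + right; right; left. exists b. split; [apply in_bools|]. apply in_flat_map. exists nd.
      split; [now apply in_nodes|]. now left.
    + right; right; right. exists b. split; [apply in_bools|]. apply in_flat_map. exists pc.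
      split; [apply in_seq; lia|]. simpl; tauto.
    + right; right; right. exists b. split; [apply in_bools|]. apply in_flat_map. exists pc.
      split; [apply in_seq; lia|]. simpl; tauto.
Qed.

Definition special (v : vert) : bool :=
  match v with
  | VK | VS Neu true O | VT O false => true
  | _ => false
  end.

(* The only row of the probability table that depends on [X] is that of [VK]; it is put first,
   and the two successors of [VK] next, to make the code of the game an explicit
   function of [X]. *)
Definition vs : list vert :=
  VK :: VS Neu true 0 :: VT 0 false ::
  filter (fun v => negb (special v)) (nodup vert_eq_dec allv).

Hypothesis Hnr : (0 < nr)%nat.

Lemma special_cases v : special v = true -> v = VK \/ v = VS Neu true 0 \/ v = VT 0 false.
Proof.
  destruct v; simpl; try easy; auto.
  - destruct k, b, r; easy || auto.
  - destruct r, b; easy || auto.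
Qed.

Lemma in_vs v : In v vs <-> okv v.
Proof.
  unfold vs. rewrite <- in_allv. cbn [In]. rewrite filter_In, nodup_In. split.
  - intros [<-|[<-|[<-|[H _]]]]; try easy; apply in_allv; simpl; auto.
  - intros H. destruct (special v) eqn:E; [|tauto].
    destruct (special_cases v E) as [->|[->| ->]]; auto.
Qed.

Lemma vs_NoDup : NoDup vs.
Proof.
  unfold vs. repeat (constructor; [cbn [In]; rewrite ?filter_In|]).
  - intros [H|[H|[_ H]]]; easy.
  - intros [H|[_ H]]; easy.
  - intros [_ H]; easy.
  - apply NoDup_filter, NoDup_nodup.
Qed.

Opaque vs allv.

Definition ev (v : vert) : nat := index vs v.
(** The default [VZ] is itself a vertex of the game, so decoded vertices are legal without a range
    condition. *)
Definition dv (n : nat) : vert := nth n vs VZ.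

Lemma dv_ev v : okv v -> dv (ev v) = v.
Proof. intros H. apply nth_index, in_vs, H. Qed.

Lemma ev_lt v : okv v -> (ev v < length vs)%nat.
Proof. intros H. apply (nth_index vs v VZ), in_vs, H. Qed.

Lemma ev_dv n : (n < length vs)%nat -> ev (dv n) = n.
Proof. intros H. apply index_nth; auto using vs_NoDup. Qed.

Lemma dv_ok n : okv (dv n).
Proof.
  destruct (le_lt_dec (length vs) n) as [H|H].
  - unfold dv. rewrite nth_overflow by lia. easy.
  - apply in_vs. now apply nth_In.
Qed.

Lemma ev_inj u v : okv u -> okv v -> ev u = ev v -> u = v.
Proof. intros Hu Hv H. rewrite <- (dv_ev u), <- (dv_ev v), H; auto. Qed.

(** Past the last check the chain is the chance node, which gives every [VChain nd b j] the uniform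
    successor [chain nd b (S j)]. *)
Definition chain (nd : node) (b : bool) (j : nat) : vert :=
  if Nat.ltb j (2 * nr) then VChain nd b j else VNat nd b.

(** Outside the code, the location [S (length Q)] ends the simulation without a check, and every
    other one, [length Q] in particular, hands victory to the system. *)
Definition entry (l : nat) (b : bool) : vert :=
  match nth_error Q l with
  | Some (INC _) => chain (NOp l false) b 0
  | Some (DEC _ _) => VC l b
  | None => if Nat.eqb l (S (length Q)) then VNat NGood b else VB
  end.

Definition nxt (nd : node) (b : bool) : vert :=
  match nd with
  | NInit => entry 0 (negb b)
  | NOp pc br =>
      match nth_error Q pc with
      | Some (INC _) => entry (S pc) (negb b)
      | Some (DEC _ j) => entry (if br then S pc else j) (negb b)
      | None => VB
      end
  | NGood => VGend b
  end.

(** In a zero branch the tested register has no loop: its gadget is [VS] itself, so success is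
    certain and the content asserted is 0. *)
Definition gad (nd : node) (b : bool) (r : nat) : vert :=
  match nd with
  | NInit => if Nat.eqb r 0 then VK else VS Neu b r
  | NOp pc br =>
      match nth_error Q pc with
      | Some (INC r0) => VL (if Nat.eqb r r0 then Inc else Neu) b r
      | Some (DEC r0 _) =>
          if Nat.eqb r r0 then (if br then VL Dec b r else VS Neu b r) else VL Neu b r
      | None => VL Neu b r
      end
  | NGood => VL Nul b r
  end.

Definition cterm (nd : node) : vert :=
  match nd with NOp _ true => VY | _ => VZ end.

(** Weights in eighths. Four times the weight is the factor 1, 1/2 or 2 by which the step multiplies
    [2^-c]; it is 0 for [Nul], after which there is no content to compare with. *)
Definition a8 (k : kind) : nat := match k with Neu => 2 | Inc => 1 | Dec => 4 | Nul => 0 end.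

(** Numerators over [den]. At [VGend b] the checkers of family [b] collect 1 + 3 shares, that is
    [4 * kappa], which balances their last check through the factor 1/4 while [Nul] pays nothing;
    the other family collects the single share [kappa] that one more check would have given it. *)
Definition vdist (v : vert) : list (vert * nat) :=
  match v with
  | VK => [(VS Neu true 0, 1%nat); (VT 0 false, (X - 1)%nat)]
  | VS k b r => [(VT r b, a8 k); (VZ, (8 - a8 k)%nat)]
  | VN k b r => [(VL k b r, 1%nat); (VT r (negb b), 1%nat)]
  | VNat nd b => map (fun r => (gad nd b r, 1%nat)) (seq 0 nr) ++
                 [(cterm nd, (5 * nr)%nat); (nxt nd b, (2 * nr)%nat)]
  | VE => [(VA, 1%nat); (VB, (30 * nr - 1)%nat)]
  | VGend b => (VG, 1%nat) :: map (fun r => (VT r b, 3%nat)) (seq 0 nr) ++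
               [(VZ, (30 * nr - (1 + 3 * nr))%nat)]
  | VT _ _ | VZ | VY | VG | VA | VB => [(v, 1%nat)]
  | VL _ _ _ | VChain _ _ _ | VC _ _ | VD _ _ => []
  end.

Definition den (v : vert) : nat :=
  match v with
  | VK => X
  | VS _ _ _ => 8
  | VN _ _ _ => 2
  | VNat _ _ => 8 * nr
  | VE | VGend _ => 30 * nr
  | _ => 1
  end.

(* Players: 0 is the system, 1 (without target) runs the register gadgets, 2 chooses the
   branches of [DEC]; [3 + j] and [3 + 2 nr + j], for [j < 2 nr], are the checkers of the two
   families; the even [j = 2 r] stands for register [r], and [2 r + 1] for its opponent. *)
Definition ownv (v : vert) : option nat :=
  match v with
  | VL _ _ _ | VD _ _ => Some 1%nat
  | VC _ _ => Some 2%nat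
  | VChain _ b j => Some (3 + (if b then 0 else 2 * nr) + j)%nat
  | _ => None
  end.

Definition succv (v : vert) : list vert :=
  match v with
  | VL k b r => [VN k b r; VS k b r]
  | VC pc b => [chain (NOp pc false) b 0; VD pc b]
  | VD pc b => [chain (NOp pc true) b 0; VB]
  | VChain nd b j => [chain nd b (S j); VE]
  | _ => []
  end.

Definition termv (v : vert) : bool :=
  match v with VT _ _ | VZ | VY | VG | VA | VB => true | _ => false end.

Definition uwin (b : bool) (r : nat) (v : vert) : bool :=
  match v with
  | VT r' b' => Nat.eqb r' r && Bool.eqb b' b
  | VG | VA => true
  | _ => false
  end.

(** The two targets are complementary on terminal vertices, so checker and opponent share exactly
    the probability that play ends. *)
Definition pwin (s : bool) (b : bool) (r : nat) (v : vert) : bool :=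
  if s then termv v && negb (uwin b r v) else uwin b r v.

Definition winv (i : nat) (v : vert) : bool :=
  match i with
  | 0 => match v with VA | VB => true | _ => false end
  | 1 => false
  | 2 => match v with VY => true | _ => false end
  | S (S (S j)) =>
      let b := Nat.ltb j (2 * nr) in
      let j' := if b then j else (j - 2 * nr)%nat in
      pwin (Nat.odd j') b (j' / 2) v
  end%nat.

Definition pl (s b : bool) (r : nat) : nat :=
  (3 + (if b then 0 else 2 * nr) + (2 * r + if s then 1 else 0))%nat.

Lemma winv_pl s b r v : (r < nr)%nat -> winv (pl s b r) v = pwin s b r v.
Proof.
  intros Hr. unfold pl.
  change (winv (S (S (S ((if b then 0 else 2 * nr) + (2 * r + if s then 1 else 0)))))%nat v
          = pwin s b r v).
  unfold winv.
  assert (Hj : forall j, (j = 2 * r + if s then 1 else 0)%nat ->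
            Nat.odd j = s /\ (j / 2 = r)%nat).
  { intros j ->. destruct s.
    - split; [apply Nat.odd_spec; exists r; lia|].
      symmetry. apply Nat.div_unique with 1%nat; lia.
    - split; [|symmetry; apply Nat.div_unique with 0%nat; lia].
      rewrite Nat.add_0_r, Nat.odd_mul. easy. }
  destruct b; cbv beta iota.
  - destruct (Nat.ltb_spec (0 + (2 * r + if s then 1 else 0)) (2 * nr)) as [_|Hge].
    + destruct (Hj (0 + (2 * r + if s then 1 else 0))%nat) as [-> ->]; auto.
    + exfalso. destruct s; lia.
  - destruct (Nat.ltb_spec (2 * nr + (2 * r + if s then 1 else 0)) (2 * nr)) as [Hlt|_]; [lia|].
    destruct (Hj (2 * nr + (2 * r + if s then 1 else 0) - 2 * nr)%nat) as [-> ->]; auto. lia.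
Qed.

Lemma winv_termv i v : winv i v = true -> termv v = true.
Proof.
  destruct i as [|[|[|i]]]; simpl; try easy.
  - now destruct v.
  - now destruct v.
  - unfold pwin. destruct (Nat.odd _).
    + intros H. now apply andb_prop in H as [H _].
    + now destruct v.
Qed.

Definition numv (v w : vert) : nat :=
  list_sum (map (fun e => if vert_eq_dec (fst e) w then snd e else 0%nat) (vdist v)).

(** A zero entry is stored as 0/1 and not as 0/[den v], so that in the row of [VK] all but two
    entries are free of [X]. *)
Definition qv (v w : vert) : nat * nat :=
  if Nat.eqb (numv v w) 0 then (0%nat, 1%nat) else (numv v w, den v).

Definition the_game : game := {|
  g_nV := length vs;
  g_k := 2 + 4 * nr;
  g_v0 := ev (chain NInit true 0);
  g_owner := map ownv vs;
  g_succ := map (fun v => map ev (succv v)) vs;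
  g_prob := map (fun v => map (qv v) vs) vs;
  g_target := map (fun i => map ev (filter (winv i) vs)) (seq 0 (S (2 + 4 * nr)))
|}.

Hypothesis HX : (0 < X)%nat.

Lemma owner_dv n : owner the_game n = ownv (dv n).
Proof.
  unfold owner, dv. cbn [g_owner the_game]. change (@None nat) with (ownv VZ). apply map_nth.
Qed.

Lemma owner_ev v : okv v -> owner the_game (ev v) = ownv v.
Proof. intros H. now rewrite owner_dv, dv_ev. Qed.

Lemma succ_ev v : okv v -> nth (ev v) (g_succ the_game) [] = map ev (succv v).
Proof.
  intros H. cbn [g_succ the_game].
  change (@nil nat) with ((fun v => map ev (succv v)) VZ). rewrite map_nth.
  fold (dv (ev v)). now rewrite dv_ev.
Qed.

Lemma target_ev i v : (i <= 2 + 4 * nr)%nat -> okv v ->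
  target_b the_game i (ev v) = winv i v.
Proof.
  intros Hi Hv. unfold target_b. cbn [g_target the_game].
  rewrite (nth_indep _ [] (map ev (filter (winv 0%nat) vs)))
    by (rewrite length_map, length_seq; lia).
  rewrite (map_nth (fun i => map ev (filter (winv i) vs)) (seq 0 (S (2 + 4 * nr))) 0%nat i).
  rewrite seq_nth by lia. rewrite Nat.add_0_l.
  apply Bool.eq_iff_eq_true. rewrite existsb_exists. split.
  - intros (n & Hin & He). apply in_map_iff in Hin as (u & <- & Hu). apply filter_In in Hu as [Hu Hw].
    apply Nat.eqb_eq in He. apply ev_inj in He; auto; [now subst|now apply in_vs].
  - intros Hw. exists (ev v). split; [|apply Nat.eqb_refl]. apply in_map, filter_In.
    split; auto. now apply in_vs.
Qed.

Lemma qentry_ev v n : okv v -> (n < length vs)%nat -> qentry the_game (ev v) n = qv v (dv n).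
Proof.
  intros Hv Hn. unfold qentry. cbn [g_prob the_game].
  rewrite (nth_indep _ [] (map (qv VZ) vs)) by (rewrite length_map; now apply ev_lt).
  rewrite (map_nth (fun v => map (qv v) vs)). fold (dv (ev v)). rewrite dv_ev by auto.
  rewrite (nth_indep _ _ (qv v VZ)) by (now rewrite length_map).
  now rewrite map_nth.
Qed.

Lemma qentry_over v n : okv v -> (length vs <= n)%nat -> qentry the_game (ev v) n = (0, 1)%nat.
Proof.
  intros Hv Hn. unfold qentry. cbn [g_prob the_game].
  rewrite (nth_indep _ [] (map (qv VZ) vs)) by (rewrite length_map; now apply ev_lt).
  rewrite (map_nth (fun v => map (qv v) vs)). fold (dv (ev v)). rewrite dv_ev by auto.
  apply nth_overflow. now rewrite length_map.
Qed.

Lemma den_pos v : (0 < den v)%nat.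
Proof. destruct v; simpl; lia. Qed.

Lemma okv_chain nd b j : oknode nd -> okv (chain nd b j).
Proof.
  intros H. unfold chain. destruct (Nat.ltb_spec j (2 * nr)); simpl; auto.
Qed.

Lemma nth_error_lt {A} (l : list A) n a : nth_error l n = Some a -> (n < length l)%nat.
Proof. intros H. apply nth_error_Some. congruence. Qed.

Lemma okv_entry l b : okv (entry l b).
Proof.
  unfold entry. destruct (nth_error Q l) as [[r|r j]|] eqn:E.
  - apply okv_chain. simpl. eapply nth_error_lt; eauto.
  - simpl. eapply nth_error_lt; eauto.
  - now destruct (Nat.eqb _ _).
Qed.

Lemma okv_nxt nd b : okv (nxt nd b).
Proof.
  destruct nd as [|pc br|]; simpl; auto using okv_entry.
  destruct (nth_error Q pc) as [[r|r j]|]; auto using okv_entry. easy.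
Qed.

Lemma okv_gad nd b r : (r < nr)%nat -> okv (gad nd b r).
Proof.
  intros Hr. destruct nd as [|pc br|]; simpl; auto.
  - now destruct (Nat.eqb r 0).
  - destruct (nth_error Q pc) as [[r0|r0 j]|]; simpl; auto.
    destruct (Nat.eqb r r0), br; auto.
Qed.

Lemma okv_dist v e : okv v -> In e (vdist v) -> okv (fst e).
Proof.
  intros Hv He. destruct v; cbn [vdist] in He;
    try (simpl in He; repeat destruct He as [<-|He]; simpl; try easy; simpl in Hv; auto; fail).
  - apply in_app_iff in He as [He|He].
    { apply in_map_iff in He as (r & <- & Hr). apply in_seq in Hr. apply okv_gad. lia. }
    simpl in He. repeat destruct He as [<-|He]; simpl; try easy.
    + destruct nd as [|pc [|]|]; easy.
    + apply okv_nxt.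
  - destruct He as [<-|He]; [easy|]. apply in_app_iff in He as [He|[<-|[]]]; [|easy].
    apply in_map_iff in He as (r & <- & Hr). apply in_seq in Hr. simpl. lia.
Qed.

Lemma okv_succ v w : okv v -> In w (succv v) -> okv w.
Proof.
  intros Hv Hw. destruct v; simpl in Hw; try easy; simpl in Hv;
    repeat destruct Hw as [<-|Hw]; try easy; now apply okv_chain.
Qed.

Lemma INR_numv v w :
  INR (numv v w) = lsum (vdist v) (fun e => if vert_eq_dec (fst e) w then INR (snd e) else 0).
Proof.
  unfold numv. induction (vdist v) as [|e l IH]; [easy|].
  rewrite lsum_cons, <- IH. cbn [map]. change (list_sum (?a :: ?l)) with (a + list_sum l)%nat.
  rewrite plus_INR. now destruct (vert_eq_dec (fst e) w).
Qed.

Lemma natp_ev v n : okv v -> (n < length vs)%nat ->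
  natp the_game (ev v) n =
  lsum (vdist v) (fun e => if vert_eq_dec (fst e) (dv n) then INR (snd e) / INR (den v) else 0).
Proof.
  intros Hv Hn. unfold natp. rewrite qentry_ev by auto.
  transitivity (INR (numv v (dv n)) / INR (den v)).
  - unfold qv. destruct (Nat.eqb_spec (numv v (dv n)) 0) as [->|]; simpl; [|easy].
    unfold Rdiv. now rewrite !Rmult_0_l.
  - rewrite INR_numv. unfold Rdiv. rewrite Rmult_comm, <- lsum_scal. apply lsum_ext.
    intros e _. destruct (vert_eq_dec _ _); lra.
Qed.

(** Passes from the probability table to the short list [vdist v]. Since [numv] adds up repeated
    successors, this holds even if a vertex is listed twice. *)
Lemma natp_sum v F : okv v ->
  lsum (seq 0 (length vs)) (fun n => natp the_game (ev v) n * F n) =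
  lsum (vdist v) (fun e => INR (snd e) / INR (den v) * F (ev (fst e))).
Proof.
  intros Hv.
  rewrite (lsum_ext _ _ (fun n => lsum (vdist v) (fun e =>
    if vert_eq_dec (fst e) (dv n) then INR (snd e) / INR (den v) * F n else 0))).
  - rewrite lsum_swap. apply lsum_ext. intros e He.
    pose proof (okv_dist v e Hv He) as Hok.
    rewrite (lsum_single _ (ev (fst e))).
    + rewrite dv_ev by auto. now destruct (vert_eq_dec (fst e) (fst e)).
    + apply seq_NoDup.
    + apply in_seq. pose proof (ev_lt _ Hok). lia.
    + intros n Hn Hne. apply in_seq in Hn. destruct (vert_eq_dec (fst e) (dv n)) as [E|]; auto.
      exfalso. apply Hne. rewrite E. symmetry. apply ev_dv. lia.
  - intros n Hn. apply in_seq in Hn. rewrite natp_ev by (auto; lia).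
    rewrite Rmult_comm, <- lsum_scal. apply lsum_ext. intros e _.
    destruct (vert_eq_dec _ _); lra.
Qed.

Lemma dist_total v : ownv v = None -> okv v ->
  lsum (vdist v) (fun e => INR (snd e) / INR (den v)) = 1.
Proof.
  intros Ho Hv.
  assert (Hd : INR (den v) <> 0) by (apply not_0_INR; pose proof (den_pos v); lia).
  enough (H : lsum (vdist v) (fun e => INR (snd e)) = INR (den v)).
  { unfold Rdiv. rewrite (lsum_ext _ _ (fun e => / INR (den v) * INR (snd e)))
      by (intros; lra). rewrite lsum_scal, H. field. auto. }
  assert (HR : 1 <= INR nr) by (apply (le_INR 1); lia).
  destruct v; cbn [vdist den] in *; try easy;
    try (rewrite ?lsum_cons, ?lsum_nil; cbn [fst snd]; simpl; lra).
  - rewrite ?lsum_cons, ?lsum_nil; cbn [fst snd]. rewrite minus_INR by lia. simpl. lra.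
  - rewrite ?lsum_cons, ?lsum_nil; cbn [fst snd]. destruct k; simpl; lra.
  - rewrite lsum_app, lsum_map, ?lsum_cons, ?lsum_nil. cbn [fst snd].
    rewrite lsum_const, length_seq, !mult_INR. simpl. lra.
  - rewrite lsum_cons, lsum_app, lsum_map, lsum_cons, lsum_nil. cbn [fst snd].
    rewrite lsum_const, length_seq, minus_INR, plus_INR, !mult_INR by lia. simpl. lra.
  - rewrite ?lsum_cons, ?lsum_nil; cbn [fst snd].
    rewrite minus_INR, mult_INR by lia. simpl. lra.
Qed.

Lemma next_nature v n : okv v -> ownv v = None -> next the_game (ev v) n ->
  exists e, In e (vdist v) /\ n = ev (fst e) /\ (0 < snd e)%nat.
Proof.
  intros Hv Ho Hn. unfold next in Hn. rewrite owner_ev, Ho in Hn by auto.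
  destruct (le_lt_dec (length vs) n) as [Hge|Hlt].
  - rewrite qentry_over in Hn by auto. simpl in Hn. lia.
  - rewrite qentry_ev in Hn by auto. unfold qv in Hn.
    destruct (Nat.eqb_spec (numv v (dv n)) 0) as [|Hne]; simpl in Hn; [lia|].
    unfold numv in Hne. clear Hn.
    induction (vdist v) as [|e l IH]; [easy|]. cbn [map] in Hne.
    change (list_sum (?a :: ?l)) with (a + list_sum l)%nat in Hne.
    destruct (vert_eq_dec (fst e) (dv n)) as [E|E].
    + destruct (snd e) as [|c] eqn:Ec.
      * destruct IH as (e' & H1 & H2 & H3); [lia|]. exists e'; simpl; auto.
      * exists e. rewrite E, ev_dv by auto. split; [now left|]. split; auto. lia.
    + destruct IH as (e' & H1 & H2 & H3); [lia|]. exists e'; simpl; auto.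
Qed.

Lemma next_player v n i : okv v -> ownv v = Some i ->
  (next the_game (ev v) n <-> exists w, In w (succv v) /\ n = ev w).
Proof.
  intros Hv Ho. unfold next. rewrite owner_ev, Ho, succ_ev by auto.
  rewrite in_map_iff. split; intros (w & H1 & H2); exists w; auto.
Qed.

Lemma terminal_next v n : okv v -> termv v = true -> next the_game (ev v) n -> n = ev v.
Proof.
  intros Hv Ht Hn. apply next_nature in Hn as (e & He & -> & _); auto.
  - destruct v; simpl in *; try easy; now destruct He as [<-|[]].
  - now destruct v.
Qed.

(** * The encoded game is well formed *)

Lemma the_game_wf : wf_game the_game.
Proof.
  split; [|split; [|split; [|split; [|split; [|split]]]]].
  - simpl. apply ev_lt. now apply okv_chain.
  - simpl. apply length_map.
  - simpl. apply length_map.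
  - simpl. apply length_map.
  - cbn [g_target the_game]. rewrite length_map, length_seq. easy.
  - intros n Hn. rewrite <- (ev_dv n) by exact Hn. generalize (dv n) (dv_ok n).
    clear n Hn. intros u Hok. rewrite owner_ev by auto.
    destruct (ownv u) as [i|] eqn:Ho.
    + rewrite succ_ev by auto. split; [|split].
      * cbn [g_k the_game]. destruct u; simpl in Ho; try easy; injection Ho as <-; try lia.
        simpl in Hok. destruct b; lia.
      * destruct u; simpl in Ho; try easy; simpl; eexists; left; reflexivity.
      * intros w Hw. apply in_map_iff in Hw as (u' & <- & Hu). simpl. apply ev_lt.
        eapply okv_succ; eauto.
    + split; [|split].
      * cbn [g_prob the_game]. rewrite (nth_indep _ [] (map (qv VZ) vs))
          by (rewrite length_map; now apply ev_lt).
        rewrite (map_nth (fun v => map (qv v) vs)). apply length_map.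
      * intros w Hw. simpl in Hw. rewrite qentry_ev by auto. unfold qv.
        destruct (Nat.eqb _ _); simpl; [lia|apply den_pos].
      * cbn [g_nV the_game].
        change (lsum (seq 0 (length vs)) (natp the_game (ev u)) = 1).
        rewrite (lsum_ext _ _ (fun w => natp the_game (ev u) w * 1)) by (intros; lra).
        rewrite (natp_sum u (fun _ => 1)) by auto.
        rewrite (lsum_ext _ _ (fun d => INR (snd d) / INR (den u))) by (intros; lra).
        now apply dist_total.
  - intros i n Hi Ht.
    assert (Hex : exists u, n = ev u /\ okv u /\ winv i u = true).
    { unfold target in Ht. cbn [g_target the_game] in Ht. cbn [g_k the_game] in Hi.
      rewrite (nth_indep _ [] (map ev (filter (winv 0%nat) vs))) in Ht
        by (rewrite length_map, length_seq; lia).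
      rewrite (map_nth (fun i => map ev (filter (winv i) vs)) (seq 0 (S (2 + 4 * nr))) 0%nat i) in Ht.
      rewrite seq_nth, Nat.add_0_l in Ht by lia.
      apply in_map_iff in Ht as (u & <- & Hu). apply filter_In in Hu as [Hu Hw].
      exists u. split; auto. split; auto. now apply in_vs. }
    destruct Hex as (u & -> & Hu & Hw). split; [now apply ev_lt|].
    intros w. apply winv_termv in Hw. split; [now apply terminal_next|].
    intros ->. unfold next. rewrite owner_ev by auto.
    replace (ownv u) with (@None nat) by now destruct u.
    rewrite qentry_ev, dv_ev by auto using ev_lt. unfold qv, numv.
    destruct u; simpl in Hw; try easy; cbn [vdist map fst snd];
      match goal with |- context [vert_eq_dec ?a ?a] => destruct (vert_eq_dec a a) end;
      try easy; simpl; lia.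
Qed.

End GameDef.

(** * Values in the game *)

Lemma lsum_ge_term {A} (l : list A) F a :
  (forall x, In x l -> 0 <= F x) -> In a l -> F a <= lsum l F.
Proof.
  induction l as [|x l IH]; intros H Ha; [easy|]. rewrite lsum_cons.
  destruct Ha as [->|Ha].
  - pose proof (lsum_nonneg l F ltac:(intros; apply H; now right)). lra.
  - pose proof (IH ltac:(intros; apply H; now right) Ha).
    pose proof (H x ltac:(now left)). lra.
Qed.

Section Plays.
Variable Q : program.
Variable nr X : nat.
Hypothesis Hnr : (0 < nr)%nat.
Hypothesis HX : (0 < X)%nat.

Notation G := (the_game Q nr X).
Notation e := (ev Q nr).
Notation ok := (okv Q nr).
Notation plr := (pl nr).

Definition rho : R := / (8 * INR nr).
Definition kappa : R := / (30 * INR nr).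
(** Value of a checker that is not checked in the current half step, when its gadget succeeds with
    probability [z]: the failures now, and a quarter of the [kappa] due at the next check. *)
Definition phi (z : R) : R := rho * (1 - z) + kappa / 4.

(** The first equation is [4 * kappa = rho + kappa / 4] in solved form. *)
Lemma rho_kappa : rho = 15 / 4 * kappa /\ 0 < kappa /\ INR nr * rho = 1 / 8.
Proof.
  clear X HX. unfold rho, kappa. assert (0 < INR nr) by (apply lt_0_INR; lia).
  repeat split; try (field; lra). apply Rinv_0_lt_compat. lra.
Qed.

Lemma Gwf : wf_game G.
Proof. now apply the_game_wf. Qed.

Lemma pl_le s b r : (r < nr)%nat -> (1 <= plr s b r <= g_k G)%nat.
Proof. clear. intros Hr. unfold pl. cbn [g_k the_game]. destruct b, s; lia. Qed.

Lemma winv_nonterm i v : termv v = false -> winv nr i v = false.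
Proof.
  intros H. destruct (winv nr i v) eqn:E; auto. apply winv_termv in E. congruence.
Qed.

Lemma ok_dist u d : ok u -> In d (vdist Q nr X u) -> ok (fst d).
Proof. now apply okv_dist. Qed.

Section Strat.
Variable p : profile.
Hypothesis Hp : strat_profile G p.

Notation xv i g u := (xval G p i (g ++ [e u])).
Notation vh g u := (valid_hist G (g ++ [e u])).

Lemma vh_next g u w : vh g u -> ok w -> valid_hist G ((g ++ [e u]) ++ [e w]).
Proof. intros H Hw. apply valid_snoc. split; auto. now apply ev_lt. Qed.

Lemma target_e i u : (i <= g_k G)%nat -> ok u -> target_b G i (e u) = winv nr i u.
Proof. apply target_ev; auto. Qed.

Lemma target_out i n : (i <= g_k G)%nat -> (g_nV G <= n)%nat -> target_b G i n = false.
Proof.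
  intros Hi Hn. destruct (target_b G i n) eqn:E; auto. exfalso.
  apply existsb_exists in E as (v & Hin & Heq). apply Nat.eqb_eq in Heq. subst v.
  destruct Gwf as (_ & _ & _ & _ & _ & _ & H). destruct (H i n Hi Hin). lia.
Qed.

Lemma expect_nat g u F : ok u -> ownv nr u = None ->
  expect G p (g ++ [e u]) F =
  lsum (vdist Q nr X u) (fun d => INR (snd d) / INR (den nr X u) * F (e (fst d))).
Proof.
  intros Hu Ho. unfold expect.
  rewrite <- (natp_sum Q nr X Hnr HX u F Hu). apply lsum_ext. intros n _.
  unfold step. rewrite last_last. rewrite owner_ev, Ho; auto.
Qed.

Lemma step_nat_pos g u d : ok u -> ownv nr u = None -> In d (vdist Q nr X u) ->
  (0 < snd d)%nat -> 0 < step G p (g ++ [e u]) (e (fst d)).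
Proof.
  intros Hu Ho Hd Hs. unfold step. rewrite last_last. 
  rewrite owner_ev, Ho by auto.
  rewrite natp_ev by (auto; apply ev_lt; auto; eapply ok_dist; eassumption).
  assert (Hden : 0 < INR (den nr X u)) by (apply lt_0_INR, den_pos; auto).
  assert (Hterm : forall d' : vert * nat, 0 <= INR (snd d') / INR (den nr X u)).
  { intros d'. apply Rmult_le_pos; [apply pos_INR|]. left. now apply Rinv_0_lt_compat. }
  eapply Rlt_le_trans; [|apply lsum_ge_term with (a := d)]; auto.
  - cbv beta. rewrite dv_ev by (auto; eapply ok_dist; eassumption).
    destruct (vert_eq_dec _ _); [|easy]. apply Rdiv_lt_0_compat; auto. now apply lt_0_INR.
  - intros d' _. destruct (vert_eq_dec _ _); auto. lra.
Qed.

Lemma xv_nat i g u : (i <= g_k G)%nat -> ok u -> ownv nr u = None -> winv nr i u = false ->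
  vh g u ->
  xv i g u = lsum (vdist Q nr X u)
    (fun d => INR (snd d) / INR (den nr X u) * xv i (g ++ [e u]) (fst d)).
Proof.
  intros Hi Hu Ho Hw Hv. rewrite xval_step; auto using Gwf.
  - apply expect_nat; auto.
  - now rewrite target_e.
Qed.

Lemma xv_win i g u : (i <= g_k G)%nat -> ok u -> winv nr i u = true -> xv i g u = 1.
Proof. intros Hi Hu Hw. apply xval_target. now rewrite last_last, target_e. Qed.

Lemma val_lose i n g u : (i <= g_k G)%nat -> ok u -> termv u = true -> winv nr i u = false ->
  vh g u -> val G p i n (g ++ [e u]) = 0.
Proof.
  intros Hi Hu Ht Hw Hv.
  apply (val_closed_zero G Gwf p i (fun v => v = e u)); auto.
  - intros v ->. now rewrite target_e.
  - intros v w -> _ Hn. eapply terminal_next; eauto.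
Qed.

Lemma xv_lose i g u : (i <= g_k G)%nat -> ok u -> termv u = true -> winv nr i u = false ->
  vh g u -> xv i g u = 0.
Proof.
  intros Hi Hu Ht Hw Hv. apply Rle_antisym.
  - apply xval_le; auto using Gwf. intros n. rewrite val_lose; auto. lra.
  - apply xval_bounds; auto using Gwf.
Qed.

Lemma xv_term i g u : (i <= g_k G)%nat -> ok u -> termv u = true -> vh g u ->
  xv i g u = if winv nr i u then 1 else 0.
Proof.
  intros. destruct (winv nr i u) eqn:E; [apply xv_win|apply xv_lose]; auto.
Qed.

Lemma xv_bounds i g u : vh g u -> 0 <= xv i g u <= 1.
Proof. apply xval_bounds; auto using Gwf. Qed.

(** All choices in this game are between two successors, so a mixed strategy enters the computations
    through one number [q] per history. *)
Lemma two_succ g u i s1 s2 : ok u -> ownv nr u = Some i -> succv nr u = [s1; s2] ->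
  s1 <> s2 -> vh g u ->
  exists q, 0 <= q <= 1 /\ step G p (g ++ [e u]) (e s1) = q /\
    step G p (g ++ [e u]) (e s2) = 1 - q /\
    forall F, expect G p (g ++ [e u]) F = q * F (e s1) + (1 - q) * F (e s2).
Proof.
  intros Hu Ho Hs Hne Hv.
  assert (Hs1 : ok s1) by (apply (okv_succ Q nr u); auto; rewrite Hs; simpl; auto).
  assert (Hs2 : ok s2) by (apply (okv_succ Q nr u); auto; rewrite Hs; simpl; auto).
  destruct (step_dist G Gwf p Hp g (e u) Hv) as (Hpos & Hnx & Hsum).
  assert (Hex : forall F, expect G p (g ++ [e u]) F =
    step G p (g ++ [e u]) (e s1) * F (e s1) + step G p (g ++ [e u]) (e s2) * F (e s2)).
  { intros F. unfold expect.
    apply (lsum_single2 (seq 0 (g_nV G)) (e s1) (e s2)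
             (fun w => step G p (g ++ [e u]) w * F w)).
    - apply seq_NoDup.
    - apply in_seq. pose proof (ev_lt Q nr Hnr s1 Hs1). cbn [g_nV the_game]. lia.
    - apply in_seq. pose proof (ev_lt Q nr Hnr s2 Hs2). cbn [g_nV the_game]. lia.
    - intros H. apply Hne. eapply (ev_inj Q nr); eauto.
    - intros w _ Hw1 Hw2.
      destruct (Req_dec (step G p (g ++ [e u]) w) 0) as [->|Hn0]; [lra|].
      exfalso. destruct (Hnx w Hn0) as [Hnw _].
      eapply next_player in Hnw as (w' & Hin & ->); eauto.
      rewrite Hs in Hin. destruct Hin as [<-|[<-|[]]]; easy. }
  exists (step G p (g ++ [e u]) (e s1)).
  assert (Hone : step G p (g ++ [e u]) (e s1) + step G p (g ++ [e u]) (e s2) = 1).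
  { pose proof (expect_const G Gwf p Hp g (e u) 1 Hv) as Hc. rewrite Hex in Hc. lra. }
  pose proof (Hpos (e s1)). pose proof (Hpos (e s2)).
  repeat split; try lra. intros F. rewrite Hex.
  replace (step G p (g ++ [e u]) (e s2)) with (1 - step G p (g ++ [e u]) (e s1)) by lra. easy.
Qed.

Lemma dist_VNat nd b F :
  lsum (vdist Q nr X (VNat nd b)) (fun d => INR (snd d) / INR (den nr X (VNat nd b)) * F (fst d)) =
  rho * lsum (seq 0 nr) (fun r => F (gad Q nd b r)) + 5 / 8 * F (cterm nd) +
  1 / 4 * F (nxt Q nr nd b).
Proof.
  cbn [vdist den]. rewrite lsum_app, lsum_map, !lsum_cons, lsum_nil. cbn [fst snd].
  rewrite <- lsum_scal. rewrite !mult_INR. unfold rho.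
  assert (0 < INR nr) by (apply lt_0_INR; lia).
  rewrite (lsum_ext _ _ (fun r => / (8 * INR nr) * F (gad Q nd b r))).
  - simpl. field. lra.
  - intros r _. simpl. field. lra.
Qed.

Lemma xv_VNat i g nd b : (i <= g_k G)%nat -> oknode Q nd -> vh g (VNat nd b) ->
  xv i g (VNat nd b) =
  rho * lsum (seq 0 nr) (fun r => xv i (g ++ [e (VNat nd b)]) (gad Q nd b r)) +
  5 / 8 * xv i (g ++ [e (VNat nd b)]) (cterm nd) +
  1 / 4 * xv i (g ++ [e (VNat nd b)]) (nxt Q nr nd b).
Proof.
  intros Hi Hnd Hv. rewrite xv_nat; auto.
  - apply (dist_VNat nd b (fun u => xv i (g ++ [e (VNat nd b)]) u)).
  - now apply winv_nonterm.
Qed.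

Lemma xv_VE s b r g : (r < nr)%nat -> vh g VE ->
  xv (plr s b r) g VE = if s then 1 - kappa else kappa.
Proof.
  intros Hr Hv. pose proof (pl_le s b r Hr) as Hi.
  rewrite xv_nat; try easy; [|now apply winv_nonterm].
  cbn [vdist]. rewrite !lsum_cons, lsum_nil. cbn [fst snd den].
  rewrite !xv_term; try easy; try (now apply vh_next).
  rewrite !winv_pl by auto.
  rewrite minus_INR, mult_INR by lia. unfold kappa.
  assert (0 < INR nr) by (apply lt_0_INR; lia).
  destruct s; simpl; field; lra.
Qed.

Lemma xv0_VE g : vh g VE -> xv 0 g VE = 1.
Proof.
  intros Hv. rewrite xv_nat; try easy; [|lia].
  cbn [vdist]. rewrite !lsum_cons, lsum_nil. cbn [fst snd den].
  rewrite !xv_term; try easy; try (now apply vh_next); try lia.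
  rewrite minus_INR, mult_INR by lia.
  assert (0 < INR nr) by (apply lt_0_INR; lia).
  simpl; field; lra.
Qed.

(** A closed set around the gadgets of register [r]; it contains no target of a checker of another
    register. *)
Definition clv (r : nat) (v : vert) : Prop :=
  match v with
  | VK => r = 0%nat
  | VS _ _ r' | VL _ _ r' | VN _ _ r' | VT r' _ => r' = r
  | VZ => True
  | _ => False
  end.

Lemma clv_next r v n : ok v -> clv r v -> next G (e v) n -> clv r (dv Q nr n).
Proof.
  intros Hv Hc Hn. destruct (ownv nr v) as [i|] eqn:Ho.
  - apply (next_player Q nr X Hnr v n i Hv Ho) in Hn as (w & Hw & ->).
    rewrite dv_ev by (auto; eapply okv_succ; eauto).
    destruct v; simpl in *; try easy; destruct Hw as [<-|[<-|[]]]; easy.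
  - apply (next_nature Q nr X Hnr) in Hn as (d & Hd & -> & _); auto.
    rewrite dv_ev by (auto; eapply ok_dist; eassumption).
    destruct v; simpl in *; try easy; repeat destruct Hd as [<-|Hd]; easy.
Qed.

Lemma xv_gad_zero i r g u :
  (i <= g_k G)%nat -> (forall v, clv r v -> winv nr i v = false) -> ok u -> clv r u ->
  vh g u -> xv i g u = 0.
Proof.
  intros Hi Hw Hu Hc Hv.
  apply (xval_closed_zero G Gwf p i (fun n => clv r (dv Q nr n))); auto.
  - intros n Hn. destruct (le_lt_dec (g_nV G) n) as [Hge|Hlt].
    + now apply target_out.
    + rewrite <- (ev_dv Q nr n) by exact Hlt. rewrite target_ev; auto using dv_ok.
  - intros v w Hcv Hlt Hn. apply clv_next with (dv Q nr v); auto using dv_ok.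
    rewrite ev_dv; auto.
  - now rewrite dv_ev.
Qed.


Lemma xv_limit_rel i j l a c d g u : vh g u ->
  (forall n, a * val G p i n (g ++ [e u]) =
             c * val G p j n (g ++ [e u]) + d * val G p l n (g ++ [e u])) ->
  a * xv i g u = c * xv j g u + d * xv l g u.
Proof.
  intros Hv H. pose proof Gwf as Hw.
  pose proof (is_lim_seq_scal_l _ a _ (xval_lim G Hw p Hp i g (e u) Hv)) as H1.
  pose proof (is_lim_seq_plus' _ _ _ _
    (is_lim_seq_scal_l _ c _ (xval_lim G Hw p Hp j g (e u) Hv))
    (is_lim_seq_scal_l _ d _ (xval_lim G Hw p Hp l g (e u) Hv))) as H2.
  simpl in H1, H2. apply (is_lim_seq_ext _ _ _ H) in H1.
  apply is_lim_seq_unique in H1, H2. rewrite H1 in H2. now injection H2.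
Qed.

Lemma val_nat i n g u : (i <= g_k G)%nat -> ok u -> ownv nr u = None -> termv u = false ->
  val G p i (S n) (g ++ [e u]) =
  lsum (vdist Q nr X u)
    (fun d => INR (snd d) / INR (den nr X u) * val G p i n ((g ++ [e u]) ++ [e (fst d)])).
Proof.
  intros Hi Hu Ho Ht. rewrite val_step.
  - now apply expect_nat.
  - rewrite last_last, target_e by auto. now apply winv_nonterm.
Qed.

Lemma val_term i n g u : (i <= g_k G)%nat -> ok u -> termv u = true -> vh g u ->
  val G p i n (g ++ [e u]) = if winv nr i u then 1 else 0.
Proof.
  intros Hi Hu Ht Hv. destruct (winv nr i u) eqn:E.
  - apply val_target. now rewrite last_last, target_e.
  - now apply val_lose.
Qed.

Definition ak (k : kind) : R := INR (a8 k) / 8.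

Lemma ak_bounds k : 0 <= ak k <= 1/2.
Proof. unfold ak. destruct k; simpl; lra. Qed.

Definition ingad (k : kind) (b : bool) (r : nat) (u : vert) : Prop :=
  u = VL k b r \/ u = VN k b r \/ u = VS k b r \/ u = VT r (negb b).

(* A gadget reaches [VS] with some probability [s] and [VT r (negb b)] with some [f]; the checker
   of [b] earns [ak k * s], its opponent [(1 - ak k) * s + f], the checker of [negb b] earns [f]. *)
Lemma gadget_val k b r n : (r < nr)%nat -> forall g u, vh g u -> ingad k b r u ->
  ak k * val G p (plr true b r) n (g ++ [e u]) =
  (1 - ak k) * val G p (plr false b r) n (g ++ [e u]) +
  ak k * val G p (plr false (negb b) r) n (g ++ [e u]).
Proof.
  intros Hr. pose proof (pl_le true b r Hr) as H1. pose proof (pl_le false b r Hr) as H2.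
  pose proof (pl_le false (negb b) r Hr) as H3.
  assert (HT : forall n g, vh g (VT r (negb b)) ->
    ak k * val G p (plr true b r) n (g ++ [e (VT r (negb b))]) =
    (1 - ak k) * val G p (plr false b r) n (g ++ [e (VT r (negb b))]) +
    ak k * val G p (plr false (negb b) r) n (g ++ [e (VT r (negb b))])).
  { intros m g Hv. rewrite !val_term; try easy; try lia.
    rewrite !winv_pl by auto. simpl. rewrite Nat.eqb_refl.
    destruct b; simpl; lra. }
  (* The relation is linear and already holds at each finite horizon, whatever player 1 does, so it
     passes to the limit without a termination argument. *)
  induction n as [|n IH]; intros g u Hv [->|[->|[->| ->]]]; auto.
  - rewrite !val_0; try lra; rewrite last_last, target_e; try easy; try lia; now apply winv_nonterm.
  - rewrite !val_0; try lra; rewrite last_last, target_e; try easy; try lia; now apply winv_nonterm.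
  - rewrite !val_0; try lra; rewrite last_last, target_e; try easy; try lia; now apply winv_nonterm.
  - rewrite !val_step
      by (rewrite last_last, target_e; try easy; try lia; now apply winv_nonterm).
    destruct (two_succ g (VL k b r) 1 (VN k b r) (VS k b r)) as (q & _ & _ & _ & HF); try easy.
    rewrite !HF.
    pose proof (IH (g ++ [e (VL k b r)]) (VN k b r)) as I1.
    pose proof (IH (g ++ [e (VL k b r)]) (VS k b r)) as I2.
    unfold ingad in I1, I2. specialize (I1 ltac:(now apply vh_next) ltac:(auto)).
    specialize (I2 ltac:(now apply vh_next) ltac:(auto)).
    match type of I1 with ak k * ?x = (1 - ak k) * ?y + ak k * ?z =>
      match type of I2 with ak k * ?x' = (1 - ak k) * ?y' + ak k * ?z' =>
        transitivity (q * (ak k * x) + (1 - q) * (ak k * x')); [ring|];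
        rewrite I1, I2; ring end end.
  - rewrite !val_nat by (try easy; lia). cbn [vdist den]. rewrite !lsum_cons, !lsum_nil.
    cbn [fst snd].
    pose proof (IH (g ++ [e (VN k b r)]) (VL k b r)) as I1.
    pose proof (IH (g ++ [e (VN k b r)]) (VT r (negb b))) as I2.
    unfold ingad in I1, I2. specialize (I1 ltac:(now apply vh_next) ltac:(auto)).
    specialize (I2 ltac:(now apply vh_next) ltac:(auto)).
    simpl INR. lra.
  - rewrite !val_nat by (try easy; lia). cbn [vdist den]. rewrite !lsum_cons, !lsum_nil.
    cbn [fst snd].
    rewrite !val_term; try easy; try lia; try (now apply vh_next).
    rewrite !winv_pl by auto. simpl. rewrite Nat.eqb_refl. unfold ak.
    destruct k, b; simpl; lra.
Qed.

Definition gkind (nd : node) (r : nat) : kind :=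
  match nd with
  | NOp pc br =>
      match nth_error Q pc with
      | Some (INC r0) => if Nat.eqb r r0 then Inc else Neu
      | Some (DEC r0 _) => if (Nat.eqb r r0 && br)%bool then Dec else Neu
      | None => Neu
      end
  | NInit => Neu
  | NGood => Nul
  end.

(** [VK] lies outside [ingad], but it is a mixture of two vertices inside, and a linear relation
    survives mixing. Its successors are tied to parity [true], hence the condition on [NInit]. *)
Lemma gadget_xv nd b r g : (r < nr)%nat -> (nd = NInit -> b = true) -> vh g (gad Q nd b r) ->
  ak (gkind nd r) * xv (plr true b r) g (gad Q nd b r) =
  (1 - ak (gkind nd r)) * xv (plr false b r) g (gad Q nd b r) +
  ak (gkind nd r) * xv (plr false (negb b) r) g (gad Q nd b r).
Proof.
  intros Hr Hb Hv.
  assert (Hgad : ingad (gkind nd r) b r (gad Q nd b r) \/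
                 nd = NInit /\ r = 0%nat).
  { unfold ingad. destruct nd as [|pc br|]; simpl.
    - destruct (Nat.eqb_spec r 0); tauto.
    - destruct (nth_error Q pc) as [[r0|r0 j]|]; [tauto| |tauto].
      destruct (Nat.eqb_spec r r0); [destruct br|]; simpl; tauto.
    - tauto. }
  destruct Hgad as [Hin|[-> ->]].
  - apply xv_limit_rel; auto. intros n. now apply gadget_val.
  - rewrite (Hb eq_refl) in *. simpl in *.
    pose proof (pl_le true true 0 Hr) as H1. pose proof (pl_le false true 0 Hr) as H2.
    pose proof (pl_le false false 0 Hr) as H3.
    assert (Hrel : forall u, ingad Neu true 0 u -> ok u ->
      ak Neu * xv (plr true true 0) (g ++ [e VK]) u =
      (1 - ak Neu) * xv (plr false true 0) (g ++ [e VK]) u +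
      ak Neu * xv (plr false false 0) (g ++ [e VK]) u).
    { intros u Hu Hok. apply xv_limit_rel; [now apply vh_next|]. intros n.
      apply (gadget_val Neu true 0 n); auto. now apply vh_next. }
    rewrite !(xv_nat _ g VK) by (try easy; try lia; now apply winv_nonterm).
    cbn [vdist den]. rewrite !lsum_cons, !lsum_nil. cbn [fst snd].
    pose proof (Hrel (VS Neu true 0) ltac:(unfold ingad; auto) Hr) as I1.
    pose proof (Hrel (VT 0 false) ltac:(unfold ingad; auto) Hr) as I2.
    match type of I1 with ak ?k * ?x = (1 - ak ?k) * ?y + ak ?k * ?z =>
      match type of I2 with ak ?k * ?x' = (1 - ak ?k) * ?y' + ak ?k * ?z' =>
        transitivity (INR 1 / INR X * (ak k * x) + INR (X - 1) / INR X * (ak k * x')); [ring|];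
        rewrite I1, I2; ring end end.
Qed.

Lemma clv_gad nd b r : clv r (gad Q nd b r).
Proof.
  destruct nd as [|pc br|]; simpl; auto.
  - now destruct (Nat.eqb_spec r 0).
  - destruct (nth_error Q pc) as [[r0|r0 j]|]; simpl; auto.
    destruct (Nat.eqb r r0), br; simpl; auto.
Qed.

Lemma xv_gad_other b' nd b r r' g : (r < nr)%nat -> (r' < nr)%nat -> r <> r' ->
  vh g (gad Q nd b r') -> xv (plr false b' r) g (gad Q nd b r') = 0.
Proof.
  intros Hr Hr' Hne Hv. apply (xv_gad_zero _ r'); auto using clv_gad, okv_gad.
  - now apply pl_le.
  - intros v Hc. rewrite winv_pl by auto. destruct v; simpl in *; try easy.
    destruct (Nat.eqb_spec r0 r); [congruence|easy].
Qed.

Lemma cterm_ok nd : ok (cterm nd) /\ termv (cterm nd) = true /\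
  forall b r, uwin b r (cterm nd) = false.
Proof. destruct nd as [|pc [|]|]; simpl; auto. Qed.

(** Neither the gadgets of other registers nor [cterm] contain a target of this checker, so two of
    the many summands remain. *)
Lemma xv_VNat_unbarred b' g nd b r : (r < nr)%nat -> oknode Q nd -> vh g (VNat nd b) ->
  xv (plr false b' r) g (VNat nd b) =
  rho * xv (plr false b' r) (g ++ [e (VNat nd b)]) (gad Q nd b r) +
  1 / 4 * xv (plr false b' r) (g ++ [e (VNat nd b)]) (nxt Q nr nd b).
Proof.
  intros Hr Hnd Hv. pose proof (pl_le false b' r Hr) as Hi.
  destruct (cterm_ok nd) as (C1 & C2 & C3).
  rewrite xv_VNat by (auto; lia).
  rewrite (lsum_single _ r).
  - rewrite (xv_lose _ _ (cterm nd)); auto; try lia.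
    + lra.
    + rewrite winv_pl by auto. apply C3.
    + now apply vh_next.
  - apply seq_NoDup.
  - apply in_seq; lia.
  - intros r' Hr' Hne. apply in_seq in Hr'. apply xv_gad_other; auto; [lia|].
    apply vh_next; auto. apply okv_gad; auto; lia.
Qed.

Lemma xv_disjoint b r g u : (r < nr)%nat -> vh g u ->
  xv (plr false b r) g u + xv (plr true b r) g u <= 1.
Proof.
  intros Hr Hv. apply (xval_disjoint G Gwf); auto.
  - now apply pl_le.
  - now apply pl_le.
  - intros n Hn. destruct (le_lt_dec (g_nV G) n) as [Hge|Hlt].
    + apply target_out; auto. now apply pl_le.
    + assert (Ht : forall s, target_b G (plr s b r) n = pwin s b r (dv Q nr n)).
      { intros s. rewrite <- (ev_dv Q nr n) at 1 by exact Hlt.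
        pose proof (pl_le s b r Hr). rewrite target_e by (auto using dv_ok; lia).
        now apply winv_pl. }
      rewrite Ht in Hn |- *. unfold pwin in *. rewrite Hn. apply andb_false_r.
Qed.

(** Values summing to 1 eliminate the opponent from the gadget relation, and what the checked family
    earns in the gadget becomes a function of [f], the failure probability seen by the other
    family. *)
Lemma half_step nd b r g : (r < nr)%nat -> oknode Q nd -> (nd = NInit -> b = true) ->
  vh g (VNat nd b) ->
  xv (plr false b r) g (VNat nd b) = kappa ->
  xv (plr true b r) g (VNat nd b) = 1 - kappa ->
  kappa = rho * (ak (gkind nd r) *
             (1 - xv (plr false (negb b) r) (g ++ [e (VNat nd b)]) (gad Q nd b r))) +
          1 / 4 * xv (plr false b r) (g ++ [e (VNat nd b)]) (nxt Q nr nd b).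
Proof.
  intros Hr Hnd Hb Hv Hu Hbar.
  pose proof (pl_le false b r Hr) as H1. pose proof (pl_le true b r Hr) as H2.
  destruct rho_kappa as (_ & Hk & Hnrho).
  assert (Hrho : 0 < rho) by (destruct rho_kappa as [-> _]; lra).
  destruct (cterm_ok nd) as (C1 & C2 & C3).
  assert (Hvn : forall w, ok w -> vh (g ++ [e (VNat nd b)]) w) by (intros; now apply vh_next).
  assert (Hsum : xv (plr false b r) (g ++ [e (VNat nd b)]) (gad Q nd b r) +
                 xv (plr true b r) (g ++ [e (VNat nd b)]) (gad Q nd b r) = 1).
  (* The two values sum to 1 at the chance node and to at most 1 at each successor; as every gadget
     has positive weight, the sum inside this gadget is 1 too. *)
  { apply Rle_antisym; [apply xv_disjoint; auto; now apply Hvn, okv_gad|].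
    rewrite xv_VNat in Hu, Hbar by (auto; lia).
    pose proof (xv_disjoint b r _ (cterm nd) Hr (Hvn _ C1)) as D1.
    pose proof (xv_disjoint b r _ (nxt Q nr nd b) Hr (Hvn _ (okv_nxt Q nr nd b))) as D2.
    set (S1 := lsum (seq 0 nr) (fun r0 => xv (plr false b r) (g ++ [e (VNat nd b)]) (gad Q nd b r0))) in *.
    set (S2 := lsum (seq 0 nr) (fun r0 => xv (plr true b r) (g ++ [e (VNat nd b)]) (gad Q nd b r0))) in *.
    assert (D3 : 1 - (xv (plr false b r) (g ++ [e (VNat nd b)]) (gad Q nd b r) +
                 xv (plr true b r) (g ++ [e (VNat nd b)]) (gad Q nd b r)) <= INR nr - (S1 + S2)).
    { replace (INR nr - (S1 + S2)) with
        (lsum (seq 0 nr) (fun r0 => 1 - (xv (plr false b r) (g ++ [e (VNat nd b)]) (gad Q nd b r0) +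
                 xv (plr true b r) (g ++ [e (VNat nd b)]) (gad Q nd b r0)))).
      - apply (lsum_ge_term (seq 0 nr) (fun r0 => 1 - (xv (plr false b r) (g ++ [e (VNat nd b)]) (gad Q nd b r0) +
                 xv (plr true b r) (g ++ [e (VNat nd b)]) (gad Q nd b r0)))).
        + intros x Hx. apply in_seq in Hx.
          pose proof (xv_disjoint b r _ (gad Q nd b x) Hr
            (Hvn _ (okv_gad Q nr nd b x ltac:(lia)))). lra.
        + apply in_seq. lia.
      - rewrite (lsum_ext _ _ (fun r0 => 1 + -1 * (xv (plr false b r) (g ++ [e (VNat nd b)]) (gad Q nd b r0) +
                 xv (plr true b r) (g ++ [e (VNat nd b)]) (gad Q nd b r0)))) by (intros; lra).
        rewrite lsum_plus, lsum_const, lsum_scal, lsum_plus, length_seq.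
        fold S1 S2. lra. }
    assert (D4 : rho * (INR nr - (S1 + S2)) <= 0) by lra.
    assert (INR nr - (S1 + S2) <= 0).
    { destruct (Rle_lt_dec (INR nr - (S1 + S2)) 0) as [|Hlt]; auto.
      pose proof (Rmult_lt_0_compat _ _ Hrho Hlt). lra. }
    lra. }
  pose proof (gadget_xv nd b r (g ++ [e (VNat nd b)]) Hr Hb
    (Hvn _ (okv_gad Q nr nd b r Hr))) as Hrel.
  rewrite <- Hu at 1. rewrite xv_VNat_unbarred by auto.
  apply Rplus_eq_compat_r, Rmult_eq_compat_l.
  (* With [y = 1 - u], where [u] is the checker's value, the relation becomes [u = ak * (1 - f)]. *)
  set (y := xv (plr true b r) (g ++ [e (VNat nd b)]) (gad Q nd b r)) in *.
  replace y with (1 - xv (plr false b r) (g ++ [e (VNat nd b)]) (gad Q nd b r)) in Hrel by lra.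
  lra.
Qed.

End Strat.
End Plays.

(** * Equilibria simulate the machine *)

Lemma mrun_snoc P n s : mrun P (S n) s = mstep P (mrun P n s).
Proof.
  revert s. induction n as [|n IH]; intros s; [easy|].
  change (mrun P (S n) (mstep P s) = mstep P (mrun P n (mstep P s))). apply IH.
Qed.

Lemma mrun_stuck P s m d : (length P <= fst (mrun P m s))%nat ->
  mrun P (d + m) s = mrun P m s.
Proof.
  intros Hm. induction d as [|d IH]; auto. cbn [Nat.add]. rewrite mrun_snoc, IH.
  destruct (mrun P m s) as [pc regs]. simpl in *. apply nth_error_None in Hm. now rewrite Hm.
Qed.

Definition instr_reg (i : instr) : nat := match i with INC r | DEC r _ => r end.

Lemma pow2_pos n : (0 < 2 ^ n)%nat.
Proof. apply Nat.neq_0_lt_0, Nat.pow_nonzero. lia. Qed.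

Section Soundness.
Variable Q : program.
Variable nr x : nat.
Hypothesis Hnr : (0 < nr)%nat.
Hypothesis Hregs : forall i, In i Q -> (instr_reg i < nr)%nat.

Notation X := (2 ^ x)%nat.
Notation G := (the_game Q nr X).
Notation e := (ev Q nr).
Notation ok := (okv Q nr).
Notation plr := (pl nr).
Notation kap := (kappa nr).
Notation ph := (phi nr).

Let HX : (0 < X)%nat := pow2_pos x.
Local Hint Resolve HX : core.

Variable c : sclass.
Variable p : profile.
Hypothesis Hp : strat_profile G p.
Hypothesis Hclass : forall i, (1 <= i <= g_k G)%nat -> in_class c G i (p i).
Hypothesis HNE : is_NE0 c G p.
Hypothesis Hzero : xval G p 0 [g_v0 G] = 0.

Notation xv i g u := (xval G p i (g ++ [e u])).
Notation vh g u := (valid_hist G (g ++ [e u])).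
Notation rch g u := (reach G p (g ++ [e u])).

Let Hwf : wf_game G := Gwf Q nr X Hnr HX.

Lemma rch_valid g u : rch g u -> vh g u.
Proof. intros H. now apply (reach_valid G Hwf p _ H). Qed.

Lemma rch_zero g u : rch g u -> xv 0 g u = 0.
Proof.
  intros H. pose proof (rch_valid g u H) as Hv.
  pose proof (xv_bounds Q nr X Hnr HX p Hp 0 g u Hv).
  destruct (Rle_lt_dec (xv 0 g u) 0) as [|Hlt]; [lra|].
  pose proof (xval_pos_back G Hwf p Hp 0 _ H Hlt). lra.
Qed.

Lemma rch_not_VE g : ~ rch g VE.
Proof.
  intros H. pose proof (rch_zero g VE H) as H0. rewrite xv0_VE in H0; auto; [lra|].
  now apply rch_valid.
Qed.

Lemma rch_not_VB g : ~ rch g VB.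
Proof.
  intros H. pose proof (rch_zero g VB H) as H0.
  rewrite xv_win in H0; auto; [lra|lia|easy].
Qed.

Lemma rch_nat g u d : ok u -> ownv nr u = None -> In d (vdist Q nr X u) -> (0 < snd d)%nat ->
  rch g u -> rch (g ++ [e u]) (fst d).
Proof.
  intros Hu Ho Hd Hs Hr. apply reach_step; auto.
  - apply ev_lt; auto. now apply (ok_dist Q nr X Hnr HX u d).
  - now apply step_nat_pos.
Qed.

(** The lists in [succv] put the tempting alternative second: the exit [VE], the nonzero branch
    [VD]. Hence only [s2] gets the equilibrium inequality. *)
Lemma rch_player g u i s1 s2 : ok u -> ownv nr u = Some i -> succv nr u = [s1; s2] ->
  s1 <> s2 -> rch g u ->
  exists q, 0 <= q <= 1 /\ (0 < q -> rch (g ++ [e u]) s1) /\ (q < 1 -> rch (g ++ [e u]) s2) /\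
    (forall j, (j <= g_k G)%nat ->
       xv j g u = q * xv j (g ++ [e u]) s1 + (1 - q) * xv j (g ++ [e u]) s2) /\
    ((1 <= i <= g_k G)%nat -> xv i (g ++ [e u]) s2 <= xv i g u).
Proof.
  intros Hu Ho Hs Hne Hr. pose proof (rch_valid g u Hr) as Hv.
  assert (Hs1 : ok s1) by (apply (okv_succ Q nr u); auto; rewrite Hs; simpl; auto).
  assert (Hs2 : ok s2) by (apply (okv_succ Q nr u); auto; rewrite Hs; simpl; auto).
  assert (Htv : termv u = false) by (destruct u; simpl in *; easy).
  destruct (two_succ Q nr X Hnr HX p Hp g u i s1 s2) as (q & Hq & E1 & E2 & HF); auto.
  exists q. split; auto. split; [|split; [|split]].
  - intros Hpos. apply reach_step; auto; [now apply ev_lt|lra].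
  - intros Hpos. apply reach_step; auto; [now apply ev_lt|lra].
  - intros j Hj. rewrite xval_step; auto.
    rewrite target_e by auto. now apply winv_nonterm.
  - intros Hi. apply (NE_successor G Hwf c p i g (e u) (e s2)); auto.
    + rewrite owner_ev; auto.
    + rewrite target_e by (auto; lia). now apply winv_nonterm.
    + apply (next_player Q nr X Hnr u (e s2) i); auto. exists s2. split; auto.
      rewrite Hs. simpl; auto.
Qed.

Lemma chain_neq nd b j :
  chain nr nd b j <> VE /\ chain nr nd b j <> VB /\ forall pc b', chain nr nd b j <> VD pc b'.
Proof. unfold chain. case (Nat.ltb j (2 * nr)); repeat split; congruence. Qed.

(** [VE] is worth 1 to the system, so no exit is taken and values are constant along the chain;
    still, the option to exit secures for each owner what [VE] pays. *)
Lemma chain_walk nd b : oknode Q nd -> forall d j g, (2 * nr - j = d)%nat -> (j <= 2 * nr)%nat ->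
  rch g (chain nr nd b j) ->
  exists g', rch g' (VNat nd b) /\
    (forall i, (i <= g_k G)%nat -> xv i g' (VNat nd b) = xv i g (chain nr nd b j)) /\
    (forall r (s : bool), (r < nr)%nat -> (j <= 2 * r + if s then 1 else 0)%nat ->
       (if s then 1 - kap else kap) <= xv (plr s b r) g (chain nr nd b j)).
Proof.
  intros Hnd d. induction d as [|d IH]; intros j g Hd Hj Hr.
  - assert (j = 2 * nr)%nat as -> by lia. unfold chain in *.
    rewrite Nat.ltb_irrefl in *. exists g. repeat split; auto.
    intros r s Hrn Hle. destruct s; lia.
  - assert (Hlt : (j < 2 * nr)%nat) by lia. unfold chain in Hr.
    apply Nat.ltb_lt in Hlt as Hb. rewrite Hb in Hr.
    assert (Hok : ok (VChain nd b j)) by (split; auto).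
    destruct (rch_player g (VChain nd b j) (3 + (if b then 0 else 2 * nr) + j)
      (chain nr nd b (S j)) VE) as (q & Hq & R1 & R2 & Hx & Hopt); auto.
    { apply chain_neq. }
    assert (Hq1 : q = 1).
    { destruct (Rle_lt_dec 1 q); [lra|]. exfalso. eapply rch_not_VE, R2; auto. }
    subst q. specialize (R1 ltac:(lra)).
    destruct (IH (S j) (g ++ [e (VChain nd b j)]) ltac:(lia) ltac:(lia) R1)
      as (g' & Hg' & Heq & Hge).
    replace (chain nr nd b j) with (VChain nd b j) by (unfold chain; now rewrite Hb).
    exists g'. split; auto. split.
    + intros i Hi. rewrite Heq, Hx by auto. lra.
    + intros r s Hrn Hle. pose proof (pl_le Q nr X s b r Hrn) as Hpl.
      destruct (Nat.eq_dec j (2 * r + if s then 1 else 0)) as [Hj'|Hne].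
      * rewrite <- (xv_VE Q nr X Hnr HX p Hp s b r (g ++ [e (VChain nd b j)])); auto.
        -- unfold pl in *. rewrite <- Hj' in *. apply Hopt. lia.
        -- apply vh_next; auto; [now apply rch_valid|easy].
      * rewrite (Hx (plr s b r)) by lia.
        specialize (Hge r s Hrn ltac:(lia)). lra.
Qed.

(** The secured shares [kap] and [1 - kap] already exhaust the total 1 that checker and opponent can
    have, so both are attained exactly. *)
Lemma chain_checked nd b g : oknode Q nd -> rch g (chain nr nd b 0) ->
  exists g', rch g' (VNat nd b) /\
    (forall i, (i <= g_k G)%nat -> xv i g' (VNat nd b) = xv i g (chain nr nd b 0)) /\
    (forall r, (r < nr)%nat -> xv (plr false b r) g (chain nr nd b 0) = kap /\
                               xv (plr true b r) g (chain nr nd b 0) = 1 - kap).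
Proof.
  intros Hnd Hr.
  destruct (chain_walk nd b Hnd (2 * nr) 0 g ltac:(lia) ltac:(lia) Hr) as (g' & H1 & H2 & H3).
  exists g'. split; auto. split; auto. intros r Hrn.
  pose proof (H3 r false Hrn (Nat.le_0_l _)). pose proof (H3 r true Hrn (Nat.le_0_l _)).
  pose proof (xv_disjoint Q nr X Hnr HX p Hp b r g (chain nr nd b 0) Hrn (rch_valid _ _ Hr)).
  simpl in *. lra.
Qed.

(** Player 1 has no payoff to protect; the confirmation is forced because a refusal would reach
    [VB]. *)
Lemma VD_walk pc b g : (pc < length Q)%nat -> rch g (VD pc b) ->
  rch (g ++ [e (VD pc b)]) (chain nr (NOp pc true) b 0) /\
  (forall i, (i <= g_k G)%nat ->
     xv i (g ++ [e (VD pc b)]) (chain nr (NOp pc true) b 0) = xv i g (VD pc b)).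
Proof.
  intros Hpc Hr.
  destruct (rch_player g (VD pc b) 1 (chain nr (NOp pc true) b 0) VB)
    as (q & Hq & R1 & R2 & Hx & _); auto.
  { apply chain_neq. }
  assert (Hq1 : q = 1).
  { destruct (Rle_lt_dec 1 q); [lra|]. exfalso. eapply rch_not_VB, R2; auto. }
  subst q. split; [apply R1; lra|]. intros i Hi. rewrite Hx by auto. lra.
Qed.

Lemma branch_pure pc b g : (pc < length Q)%nat -> rch g (VC pc b) ->
  (rch (g ++ [e (VC pc b)]) (chain nr (NOp pc false) b 0) /\
   forall i, (i <= g_k G)%nat ->
     xv i (g ++ [e (VC pc b)]) (chain nr (NOp pc false) b 0) = xv i g (VC pc b)) \/
  exists g', rch g' (chain nr (NOp pc true) b 0) /\
   forall i, (i <= g_k G)%nat -> xv i g' (chain nr (NOp pc true) b 0) = xv i g (VC pc b).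
Proof.
  intros Hpc Hr.
  destruct (rch_player g (VC pc b) 2 (chain nr (NOp pc false) b 0) (VD pc b))
    as (q & Hq & R1 & R2 & Hx & Hopt); auto.
  { apply chain_neq. }
  assert (Hk2 : (1 <= 2 <= g_k G)%nat) by (cbn [g_k the_game]; lia).
  destruct (Req_dec q 1) as [->|Hq1].
  { left. split; [apply R1; lra|]. intros i Hi. rewrite Hx by auto. lra. }
  right. specialize (R2 ltac:(lra)). destruct (VD_walk pc b _ Hpc R2) as [R3 Hx3].
  eexists. split; [exact R3|]. intros i Hi. rewrite Hx3 by auto. rewrite (Hx i Hi).
  destruct (Req_dec q 0) as [->|Hq0]; [lra|]. exfalso.
  specialize (R1 ltac:(lra)).
  destruct (chain_checked (NOp pc false) b _ Hpc R1) as (g1 & N1 & E1 & _).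
  destruct (chain_checked (NOp pc true) b _ Hpc R3) as (g2 & N2 & E2 & _).
  destruct (rho_kappa nr Hnr) as (_ & _ & Hnrho).
  assert (Hrho : 0 < rho nr) by (destruct (rho_kappa nr Hnr) as (-> & ? & _); lra).
  (* In a proper mixture both branches are reached. Optimality bounds the value of the nonzero
     branch by the average of the two, but the zero branch is worth strictly less. *)
  specialize (Hopt Hk2). rewrite (Hx 2%nat) in Hopt by lia.
  rewrite <- (Hx3 2%nat), <- (E2 2%nat), <- (E1 2%nat) in Hopt by lia.
  rewrite (xv_VNat Q nr X Hnr HX p Hp 2 g1), (xv_VNat Q nr X Hnr HX p Hp 2 g2) in Hopt
    by (auto using rch_valid; lia).
  assert (B : forall g br, rch g (VNat (NOp pc br) b) ->
    0 <= lsum (seq 0 nr) (fun r => xv 2 (g ++ [e (VNat (NOp pc br) b)]) (gad Q (NOp pc br) b r))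
      <= INR nr /\
    0 <= xv 2 (g ++ [e (VNat (NOp pc br) b)]) (nxt Q nr (NOp pc br) b) <= 1).
  { intros g0 br Hg0. pose proof (rch_valid _ _ Hg0) as Hv.
    assert (Hb : forall w, ok w -> 0 <= xv 2 (g0 ++ [e (VNat (NOp pc br) b)]) w <= 1).
    { intros w Hw. apply xv_bounds; auto. now apply vh_next. }
    split; [split|].
    - apply lsum_nonneg. intros r Hrr. apply in_seq in Hrr. apply Hb, okv_gad. lia.
    - apply Rle_trans with (lsum (seq 0 nr) (fun _ => 1)).
      + apply lsum_le. intros r Hrr. apply in_seq in Hrr. apply Hb, okv_gad. lia.
      + rewrite lsum_const, length_seq. lra.
    - apply Hb, okv_nxt. }
  destruct (B g1 false N1) as [B1 B2]. destruct (B g2 true N2) as [B3 B4].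
  cbn [cterm] in Hopt.
  rewrite (xv_lose Q nr X Hnr HX p Hp 2 _ VZ) in Hopt
    by (try easy; try lia; apply vh_next; auto using rch_valid; easy).
  rewrite (xv_win Q nr X Hnr HX p 2 _ VY) in Hopt by (try easy; lia).
  match type of B1 with 0 <= ?s <= _ => set (S1 := s) in * end.
  match type of B3 with 0 <= ?s <= _ => set (S2 := s) in * end.
  match type of B2 with 0 <= ?y <= _ => set (y1 := y) in * end.
  match type of B4 with 0 <= ?y <= _ => set (y2 := y) in * end.
  assert (rho nr * S1 <= 1 / 8).
  { rewrite <- Hnrho, Rmult_comm. apply Rmult_le_compat_r; lra. }
  assert (0 <= rho nr * S2) by (apply Rmult_le_pos; lra).
  set (x1 := rho nr * S1 + 5 / 8 * 0 + 1 / 4 * y1) in Hopt.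
  set (x2 := rho nr * S2 + 5 / 8 * 1 + 1 / 4 * y2) in Hopt.
  assert (x1 <= 3/8) by (unfold x1; lra).
  assert (5/8 <= x2) by (unfold x2; lra).
  assert (0 < q * (x2 - x1)) by (apply Rmult_lt_0_compat; lra).
  lra.
Qed.

Lemma rch_nxt nd b g : oknode Q nd -> rch g (VNat nd b) ->
  rch (g ++ [e (VNat nd b)]) (nxt Q nr nd b).
Proof.
  intros Hnd Hr. apply (rch_nat g (VNat nd b) (nxt Q nr nd b, (2 * nr)%nat)); auto.
  - cbn [vdist]. apply in_or_app. right. right. now left.
  - simpl. lia.
Qed.

(** The excluded location is the only reachable entry without a chain, so nothing pins the value to
    [kap] there. *)
Lemma entry_checked l b g r : (r < nr)%nat -> l <> S (length Q) -> rch g (entry Q nr l b) ->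
  xv (plr false b r) g (entry Q nr l b) = kap.
Proof.
  intros Hr Hl Hg. pose proof (pl_le Q nr X false b r Hr) as Hpl.
  unfold entry in *. destruct (nth_error Q l) as [[r0|r0 j]|] eqn:E.
  - assert (Hpc : (l < length Q)%nat) by (eapply nth_error_lt; eauto).
    destruct (chain_checked (NOp l false) b g Hpc Hg) as (_ & _ & _ & H). now apply H.
  - assert (Hpc : (l < length Q)%nat) by (eapply nth_error_lt; eauto).
    destruct (branch_pure l b g Hpc Hg) as [[H1 H2]|(g' & H1 & H2)].
    + destruct (chain_checked (NOp l false) b _ Hpc H1) as (_ & _ & _ & H).
      rewrite <- H2 by lia. now apply H.
    + destruct (chain_checked (NOp l true) b _ Hpc H1) as (_ & _ & _ & H).
      rewrite <- H2 by lia. now apply H.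
  - apply Nat.eqb_neq in Hl. rewrite Hl in Hg. exfalso. eapply rch_not_VB; eauto.
Qed.

Lemma xv_VGend b r g : (r < nr)%nat -> vh g (VGend b) ->
  xv (plr false b r) g (VGend b) = 4 * kap.
Proof.
  intros Hr Hv. pose proof (pl_le Q nr X false b r Hr) as Hi.
  rewrite xv_nat; auto; try easy; [|now apply winv_nonterm].
  cbn [vdist]. rewrite lsum_cons, lsum_app, lsum_map, lsum_cons, lsum_nil. cbn [fst snd den].
  rewrite (lsum_single _ r); [|apply seq_NoDup|apply in_seq; lia|].
  - rewrite !xv_term; auto; try easy; try (now apply vh_next).
    rewrite !winv_pl by auto. simpl uwin. unfold pwin, uwin.
    rewrite Nat.eqb_refl, eqb_reflx, !mult_INR. unfold kappa.
    assert (0 < INR nr) by (apply lt_0_INR; lia). simpl. field. lra.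
  - intros r' Hr' Hne. apply in_seq in Hr'.
    assert (Hok : ok (VT r' b)) by (simpl; lia).
    rewrite (xv_lose Q nr X Hnr HX p Hp _ _ (VT r' b)); auto; [lra|lia| |now apply vh_next].
    rewrite winv_pl by auto. simpl. apply Nat.eqb_neq in Hne. now rewrite Hne.
Qed.

(** Covers a wrong zero branch that jumps to [S (length Q)]: there the gadget pays at most 1 with
    weight [rho], and the end pays a quarter of [4 * kap]. *)
Lemma entry_bound l b g r : (r < nr)%nat -> rch g (entry Q nr l b) ->
  xv (plr false b r) g (entry Q nr l b) <= rho nr + kap.
Proof.
  intros Hr Hg. destruct (rho_kappa nr Hnr) as (Hrk & Hk & _).
  destruct (Nat.eq_dec l (S (length Q))) as [Hl|Hl].
  - unfold entry in *. destruct (nth_error Q l) eqn:E.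
    { apply nth_error_lt in E. lia. }
    apply Nat.eqb_eq in Hl. rewrite Hl in *. pose proof (rch_valid _ _ Hg) as Hv.
    rewrite xv_VNat_unbarred; auto; [|easy]. cbn [nxt gad].
    rewrite xv_VGend; auto; [|now apply vh_next].
    pose proof (xv_bounds Q nr X Hnr HX p Hp (plr false b r) (g ++ [e (VNat NGood b)])
      (VL Nul b r) ltac:(now apply vh_next)) as Hb.
    assert (rho nr * xv (plr false b r) (g ++ [e (VNat NGood b)]) (VL Nul b r) <= rho nr * 1)
      by (apply Rmult_le_compat_l; lra).
    lra.
  - rewrite entry_checked by auto. lra.
Qed.

Lemma xv_VS_zero k b r g : (r < nr)%nat -> vh g (VS k b r) ->
  xv (plr false (negb b) r) g (VS k b r) = 0.
Proof.
  intros Hr Hv. pose proof (pl_le Q nr X false (negb b) r Hr) as Hi.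
  rewrite xv_nat; auto; try easy; [|now apply winv_nonterm].
  cbn [vdist]. rewrite !lsum_cons, lsum_nil. cbn [fst snd den].
  rewrite !xv_term; auto; try easy; try (now apply vh_next).
  rewrite !winv_pl by auto. simpl. rewrite Nat.eqb_refl. destruct b; simpl; lra.
Qed.

(** Two equations share the unknown [f]: the one of family [negb b] reads off the current content,
    the one of family [b] transmits it to the next entry. *)
Lemma node_step nd b l g : oknode Q nd -> (nd = NInit -> b = true) ->
  nxt Q nr nd b = entry Q nr l (negb b) -> rch g (chain nr nd b 0) ->
  exists g0 g', rch g0 (VNat nd b) /\ rch g' (entry Q nr l (negb b)) /\
    forall r, (r < nr)%nat ->
    let f := xv (plr false (negb b) r) (g0 ++ [e (VNat nd b)]) (gad Q nd b r) in
    0 <= f <= 1 /\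
    xv (plr false (negb b) r) g (chain nr nd b 0) =
      rho nr * f + 1 / 4 * xv (plr false (negb b) r) g' (entry Q nr l (negb b)) /\
    kap = rho nr * (ak (gkind Q nd r) * (1 - f)) +
          1 / 4 * xv (plr false b r) g' (entry Q nr l (negb b)).
Proof.
  intros Hnd Hb Hn Hr.
  destruct (chain_checked nd b g Hnd Hr) as (g0 & H1 & H2 & H3).
  exists g0, (g0 ++ [e (VNat nd b)]). split; auto.
  rewrite <- Hn. split; [now apply rch_nxt|].
  intros r Hrn. pose proof (rch_valid _ _ H1) as Hv.
  pose proof (pl_le Q nr X false (negb b) r Hrn).
  pose proof (pl_le Q nr X false b r Hrn).
  pose proof (pl_le Q nr X true b r Hrn).
  destruct (H3 r Hrn). split; [|split].
  - apply xv_bounds; auto. apply vh_next; auto. now apply okv_gad.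
  - rewrite <- H2 by lia. apply xv_VNat_unbarred; auto.
  - apply half_step; auto; rewrite H2; auto; lia.
Qed.

(** Register contents are stored in the values of the family checked in the preceding half step. One
    reached history suffices, however unlikely it is. *)
Definition inv (pc : nat) (regs : nat -> nat) : Prop :=
  exists g b, rch g (entry Q nr pc b) /\
    forall r, (r < nr)%nat ->
    xv (plr false (negb b) r) g (entry Q nr pc b) = ph ((/ 2) ^ regs r).

(* The identity [4 kappa = rho + kappa / 4] makes the constants consistent. *)
Lemma node_step_value b r g l k f z : (r < nr)%nat -> l <> S (length Q) ->
  rch g (entry Q nr l (negb b)) ->
  ph z = rho nr * f + 1 / 4 * xv (plr false (negb b) r) g (entry Q nr l (negb b)) ->
  kap = rho nr * (ak k * (1 - f)) + 1 / 4 * xv (plr false b r) g (entry Q nr l (negb b)) ->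
  f = 1 - z /\ xv (plr false b r) g (entry Q nr l (negb b)) = ph (4 * ak k * z).
Proof.
  intros Hr Hl Hg H1 H2. rewrite entry_checked in H1 by auto.
  destruct (rho_kappa nr Hnr) as (Hrk & Hk & _).
  assert (f = 1 - z).
  { unfold phi in H1. apply Rmult_eq_reg_l with (rho nr); [lra|]. rewrite Hrk. lra. }
  split; auto. subst f. unfold phi in *. rewrite Hrk in *. lra.
Qed.

Lemma inv_init : (0 <> S (length Q))%nat -> inv 0 (snd (init_state x)).
Proof.
  intros Hl.
  assert (Hr : rch [] (chain nr NInit true 0)) by apply reach_init.
  destruct (node_step NInit true 0 [] I (fun _ => eq_refl) eq_refl Hr)
    as (g0 & g' & N & R & H).
  exists g', false. split; auto. intros r Hrn. destruct (H r Hrn) as (Hf & _ & Hk).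
  (* [VK] succeeds with probability [/ X], which is [2^-x]; the gadgets of the other registers
     always succeed, which stands for content 0. *)
  assert (Hfr : 1 - xv (plr false (negb true) r) (g0 ++ [e (VNat NInit true)]) (gad Q NInit true r)
                = (/ 2) ^ snd (init_state x) r).
  { pose proof (rch_valid _ _ N) as Hv. simpl gad. simpl snd.
    destruct (Nat.eqb_spec r 0) as [->|Hne].
    - pose proof (pl_le Q nr X false (negb true) 0 Hrn).
      rewrite xv_nat; auto; try easy; try lia;
        [|now apply winv_nonterm|apply vh_next; auto; easy].
      cbn [vdist]. rewrite !lsum_cons, lsum_nil. cbn [fst snd den].
      rewrite (xv_VS_zero Neu true 0); auto; [|repeat apply vh_next; auto; easy].
      rewrite (xv_win Q nr X Hnr HX); auto; try lia; [|now rewrite winv_pl].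
      rewrite minus_INR by (pose proof HX; lia). rewrite pow_INR, pow_inv.
      assert (INR 2 ^ x <> 0) by (apply pow_nonzero; simpl; lra).
      change (INR 1) with 1. replace (INR 2) with 2 in * by (simpl; lra). field. auto.
    - rewrite xv_VS_zero; auto; [simpl; lra|]. now apply vh_next. }
  rewrite Hfr in Hk. simpl negb in *. simpl gkind in Hk.
  destruct (rho_kappa nr Hnr) as (Hrk & Hkp & _).
  unfold phi, ak in *. simpl INR in Hk. rewrite Hrk in *. lra.
Qed.

Lemma ak_values : 4 * ak Neu = 1 /\ 4 * ak Inc = / 2 /\ 4 * ak Dec = 2.
Proof. unfold ak. simpl. lra. Qed.

Lemma inv_step pc regs : (pc < length Q)%nat -> inv pc regs ->
  fst (mstep Q (pc, regs)) <> S (length Q) ->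
  inv (fst (mstep Q (pc, regs))) (snd (mstep Q (pc, regs))).
Proof.
  intros Hpc (g & b & Hg & Hval) Hnext. unfold mstep in *.
  destruct ak_values as (AN & AI & AD).
  destruct (rho_kappa nr Hnr) as (Hrk & Hkp & _).
  destruct (nth_error Q pc) as [[r0|r0 j]|] eqn:E.
  - unfold entry in Hg, Hval. rewrite E in Hg, Hval. simpl in *.
    destruct (node_step (NOp pc false) b (S pc) g) as (g0 & g' & N & R & H); auto;
      [easy|simpl; now rewrite E|].
    exists g', (negb b). split; auto. intros r Hr. rewrite negb_involutive.
    destruct (H r Hr) as (Hf & H1 & H2). rewrite Hval in H1 by auto.
    destruct (node_step_value b r g' (S pc) _ _ _ Hr Hnext R H1 H2) as [_ ->].
    simpl gkind. rewrite E. unfold set_reg. destruct (Nat.eqb_spec r r0) as [->|Hne].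
    + rewrite AI. simpl. f_equal.
    + rewrite AN. f_equal. lra.
  - unfold entry in Hg, Hval. rewrite E in Hg, Hval.
    assert (Hr0 : (r0 < nr)%nat) by (apply nth_error_In in E; apply (Hregs _ E)).
    destruct (branch_pure pc b g Hpc Hg) as [[Hc Hx]|(gc & Hc & Hx)].
    + destruct (node_step (NOp pc false) b j _ Hpc ltac:(easy) ltac:(simpl; now rewrite E) Hc)
        as (g0 & g' & N & R & H).
      (* The gadget of a zero branch never fails, so [f] is 0. A nonzero content has [z <= 1/2], and
         [phi z >= rho / 2 + kap / 4] exceeds a quarter of the bound [rho + kap]. *)
      assert (Hz0 : regs r0 = 0%nat).
      { destruct (H r0 Hr0) as (Hf & H1 & H2). simpl gad in H1. rewrite E, Nat.eqb_refl in H1.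
        rewrite xv_VS_zero in H1; auto;
          [|apply vh_next; auto using rch_valid; easy].
        rewrite Hx, Hval in H1 by (auto; apply (pl_le Q nr X); auto).
        pose proof (entry_bound j (negb b) g' r0 Hr0 R) as Hb.
        destruct (regs r0) as [|n]; auto. exfalso. simpl in H1.
        assert (Hp1 : (/ 2) ^ n <= 1).
        { rewrite pow_inv. rewrite <- Rinv_1. apply Rinv_le_contravar; [lra|].
          apply pow_R1_Rle. lra. }
        unfold phi in H1. rewrite Hrk in *. nra. }
      rewrite Hz0 in *. simpl in *.
      exists g', (negb b). split; auto. intros r Hr. rewrite negb_involutive.
      destruct (H r Hr) as (Hf & H1 & H2).
      rewrite Hx, Hval in H1 by (auto; apply (pl_le Q nr X); auto).
      destruct (node_step_value b r g' j _ _ _ Hr Hnext R H1 H2) as [_ ->].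
      simpl gkind. rewrite E, andb_false_r, AN. f_equal. lra.
    + destruct (node_step (NOp pc true) b (S pc) _ Hpc ltac:(easy) ltac:(simpl; now rewrite E) Hc)
        as (g0 & g' & N & R & H).
      (* For content 0, [phi 1 = kap / 4] leaves at most 1/15 for [f]; then the gadget of weight 1/2
         alone pays at least [7/4 * kap], too much for a checked family. *)
      assert (Hz0 : exists n, regs r0 = S n).
      { destruct (H r0 Hr0) as (Hf & H1 & H2). simpl gkind in H2.
        rewrite E, Nat.eqb_refl in H2. simpl andb in H2.
        rewrite Hx, Hval in H1 by (auto; apply (pl_le Q nr X); auto).
        pose proof (xv_bounds Q nr X Hnr HX p Hp (plr false b r0) _ _ (rch_valid _ _ R)) as B1.
        pose proof (xv_bounds Q nr X Hnr HX p Hp (plr false (negb b) r0) _ _ (rch_valid _ _ R)) as B2.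
        destruct (regs r0) as [|n]; [|eauto]. exfalso.
        unfold phi in H1. rewrite pow_O in H1.
        rewrite Hrk in *.
        match type of H1 with _ = 15 / 4 * kap * ?y + _ => set (f := y) in * end.
        assert (0 <= kap * f) by (apply Rmult_le_pos; lra).
        replace (ak Dec) with (1 / 2) in H2 by lra. lra. }
      destruct Hz0 as [n Hz0]. rewrite Hz0 in *. simpl in *.
      exists g', (negb b). split; auto. intros r Hr. rewrite negb_involutive.
      destruct (H r Hr) as (Hf & H1 & H2).
      rewrite Hx, Hval in H1 by (auto; apply (pl_le Q nr X); auto).
      destruct (node_step_value b r g' (S pc) _ _ _ Hr Hnext R H1 H2) as [_ ->].
      simpl gkind. rewrite E, andb_true_r. unfold set_reg.
      destruct (Nat.eqb_spec r r0) as [->|Hne].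
      * rewrite AD, Hz0. simpl. f_equal. lra.
      * rewrite AN. f_equal. lra.
  - apply nth_error_None in E. lia.
Qed.

Lemma bad_run_absurd n :
  fst (mrun Q n (init_state x)) = length Q -> (0 < length Q)%nat -> False.
Proof.
  intros Hn Hlen.
  (* A machine outside its code stays put, so one that stops at [length Q] is never at
     [S (length Q)]. *)
  assert (Hgood : forall m, fst (mrun Q m (init_state x)) <> S (length Q)).
  { intros m Hm. destruct (le_lt_dec m n) as [Hle|Hlt].
    - pose proof (mrun_stuck Q (init_state x) m (n - m) ltac:(lia)) as H.
      replace (n - m + m)%nat with n in H by lia. rewrite H in Hn. lia.
    - pose proof (mrun_stuck Q (init_state x) n (m - n) ltac:(lia)) as H.
      replace (m - n + n)%nat with m in H by lia. rewrite H in Hm. lia. }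
  assert (Hinv : forall m, inv (fst (mrun Q m (init_state x))) (snd (mrun Q m (init_state x)))).
  { induction m as [|m IH].
    - apply inv_init. lia.
    - pose proof (Hgood (S m)) as HS. rewrite mrun_snoc in HS |- *.
      destruct (mrun Q m (init_state x)) as [pc regs] eqn:E.
      destruct (le_lt_dec (length Q) pc) as [Hge|Hlt].
      + simpl. apply nth_error_None in Hge. rewrite Hge. exact IH.
      + now apply inv_step. }
  destruct (Hinv n) as (g & b & Hg & _). rewrite Hn in Hg. unfold entry in Hg.
  destruct (nth_error Q (length Q)) eqn:E; [apply nth_error_lt in E; lia|].
  destruct (Nat.eqb_spec (length Q) (S (length Q))); [lia|].
  eapply rch_not_VB; eauto.
Qed.

End Soundness.

(** * A terminating simulation is an equilibrium *)

(* Memory of the equilibrium strategies: the number of half steps simulated so far, or, inside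
   a gadget, the number of loops still to be done. *)
Inductive mem : Type := Main (t : nat) | Gad (c : nat).

Definition encm (m : mem) : nat := match m with Main t => 2 * t | Gad c => 2 * c + 1 end.
Definition decm (n : nat) : mem := if Nat.even n then Main (n / 2) else Gad (n / 2).

Lemma decm_encm m : decm (encm m) = m.
Proof.
  unfold decm. destruct m as [t|c]; unfold encm.
  - replace (Nat.even (2 * t)) with true by (symmetry; apply Nat.even_spec; now exists t).
    f_equal. symmetry. apply Nat.div_unique with 0%nat; lia.
  - replace (Nat.even (2 * c + 1)) with false.
    + f_equal. symmetry. apply Nat.div_unique with 1%nat; lia.
    + symmetry. rewrite <- Nat.negb_odd. apply negb_false_iff, Nat.odd_spec. now exists c.
Qed.

Lemma pow_half_bounds n : 0 <= (/ 2) ^ n <= 1.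
Proof.
  split; [apply pow_le; lra|]. rewrite pow_inv, <- Rinv_1.
  apply Rinv_le_contravar; [lra|]. apply pow_R1_Rle. lra.
Qed.

Section Completeness.
Variable Q : program.
Variable nr x N B : nat.
Hypothesis Hnr : (0 < nr)%nat.

Definition cfg (n : nat) : mstate := mrun Q n (init_state x).

Hypothesis Hrun : forall n, (n < N)%nat -> (fst (cfg n) < length Q)%nat.
Hypothesis Hend : fst (cfg N) = S (length Q).
Hypothesis HB : forall n r, (n <= N)%nat -> (r < nr)%nat -> (snd (cfg n) r <= B)%nat.

Notation X := (2 ^ x)%nat.
Notation G := (the_game Q nr X).
Notation e := (ev Q nr).
Notation ok := (okv Q nr).
Notation plr := (pl nr).
Notation kap := (kappa nr).
Notation ph := (phi nr).

Let HX : (0 < X)%nat := pow2_pos x.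
Let Hwf : wf_game G := Gwf Q nr X Hnr HX.

Definition par (t : nat) : bool := Nat.even t.

Lemma par_S t : par (S t) = negb (par t).
Proof. unfold par. now rewrite Nat.even_succ, <- Nat.negb_even. Qed.

Definition brn (n : nat) : bool :=
  match nth_error Q (fst (cfg n)) with
  | Some (DEC r0 _) => negb (Nat.eqb (snd (cfg n) r0) 0)
  | _ => false
  end.

(* Half step 0 loads the input; half step [S n] performs the [n]-th step of the machine. *)
Definition nodeT (t : nat) : node :=
  match t with
  | O => NInit
  | S n => if Nat.ltb n N then NOp (fst (cfg n)) (brn n) else NGood
  end.

Definition rT (t : nat) : nat -> nat := snd (cfg (pred t)).
Definition zT (t r : nat) : R := (/ 2) ^ rT t r.

(** The half step [t] has become [S t] when its gadgets are entered, hence [pred]. The bound [B]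
    never bites on the run; it keeps the memory finite on all histories. *)
Definition remn (m : mem) (r : nat) : nat :=
  match m with Main t => Nat.min B (rT (pred t) r) | Gad c => c end.

Definition upd (m : mem) (u : vert) : mem :=
  match u with
  | VNat _ _ => match m with Main t => Main (Nat.min (S t) (N + 2)) | Gad _ => m end
  | VL _ _ r => Gad (remn m r - 1)
  | _ => m
  end.

(** Whether the run takes the nonzero branch here. Off the run the answer is no, so player 1 answers
    an unjustified [VD] with [VB], where player 2 gets nothing. *)
Definition go (m : mem) (pc : nat) (b : bool) : bool :=
  match m with
  | Main t => (if node_eq_dec (nodeT t) (NOp pc true) then true else false) && Bool.eqb b (par t)
  | Gad _ => false
  end.

Definition choice (m : mem) (u : vert) : vert :=
  match u with
  | VChain nd b j => chain nr nd b (S j)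
  | VC pc b => if go m pc b then VD pc b else chain nr (NOp pc false) b 0
  | VD pc b => if go m pc b then chain nr (NOp pc true) b 0 else VB
  | VL k b r => if Nat.eqb (remn m r) 0 then VS k b r else VN k b r
  | _ => VZ
  end.

Definition mem_of (h : list nat) : mem :=
  fold_left (fun m n => upd m (dv Q nr n)) h (Main 0).

(** One function serves all players, since each history has a single owner. *)
Definition str : strategy := fun h w =>
  if Nat.eqb w (e (choice (mem_of (removelast h)) (dv Q nr (last h 0%nat)))) then 1 else 0.

Lemma mem_of_snoc g u : ok u -> mem_of (g ++ [e u]) = upd (mem_of g) u.
Proof. intros Hu. unfold mem_of. rewrite fold_left_app. simpl. now rewrite dv_ev. Qed.

Lemma choice_succ m u j : ok u -> ownv nr u = Some j -> In (choice m u) (succv nr u).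
Proof.
  intros Hu Ho. destruct u; simpl in *; try easy; auto.
  - case (Nat.eqb (remn m r) 0); auto.
  - case (go m pc b); auto.
  - case (go m pc b); auto.
Qed.

Lemma choice_ok m u j : ok u -> ownv nr u = Some j -> ok (choice m u).
Proof. intros Hu Ho. apply (okv_succ Q nr u); auto. eapply choice_succ; eauto. Qed.

Lemma str_strategy i : is_strategy G i str.
Proof.
  intros h v Hv Ho. apply valid_snoc in Hv as [_ Hlt].
  pose proof (dv_ok Q nr Hnr v) as Hok.
  rewrite owner_dv in Ho by auto.
  unfold str. rewrite removelast_last, last_last. split; [|split].
  - intros w. destruct (Nat.eqb _ _); lra.
  - intros w. destruct (Nat.eqb_spec w (e (choice (mem_of h) (dv Q nr v)))) as [->|]; [|easy].
    intros _. rewrite <- (ev_dv Q nr v) at 1 by exact Hlt.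
    apply (next_player Q nr X Hnr (dv Q nr v) _ i); auto.
    eexists. split; [|reflexivity]. eapply choice_succ; eauto.
  - apply lsum_indicator. cbn [g_nV the_game]. apply ev_lt; auto. eapply choice_ok; eauto.
Qed.

Lemma str_pure i : pure G i str.
Proof. intros h v _ _. eexists. intros w'. reflexivity. Qed.

Lemma str_finite_state i : finite_state G i str.
Proof.
  (* Every state below [M] must stay below [M]: [Main] is capped at [N + 2], and a gadget counter
     starts from at most [B] and only decreases. *)
  set (M := (2 * (N + B + 4))%nat).
  exists M, 0%nat, (fun q v => encm (upd (decm q) (dv Q nr v))),
    (fun q v w => if Nat.eqb w (e (choice (decm q) (dv Q nr v))) then 1 else 0).
  split; [|split].
  - unfold M. lia.
  - intros q v Hq.
    assert (Hd : encm (decm q) = q).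
    { unfold decm. pose proof (Nat.div_mod_eq q 2) as Hdm.
      pose proof (Nat.mod_upper_bound q 2 ltac:(lia)) as Hm.
      destruct (Nat.even q) eqn:Ev; unfold encm.
      - apply Nat.even_spec in Ev as [k ->].
        rewrite (Nat.mul_comm 2 k), Nat.div_mul by lia. lia.
      - assert (Nat.odd q = true) as Od by (rewrite <- Nat.negb_even, Ev; easy).
        apply Nat.odd_spec in Od as [k ->].
        replace ((2 * k + 1) / 2)%nat with k; [lia|].
        apply Nat.div_unique with 1%nat; lia. }
    destruct (decm q) as [t|c] eqn:Ed; unfold encm in Hd; destruct (dv Q nr v);
      cbn [upd remn encm]; unfold M in *; lia.
  - intros h v _ _ w. unfold str. rewrite removelast_last, last_last.
    replace (decm (fold_left _ h 0%nat)) with (mem_of h); auto.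
    unfold mem_of. change (Main 0) with (decm 0%nat). generalize 0%nat as q.
    induction h as [|a h IH]; intros q; auto. simpl. rewrite <- IH, decm_encm. easy.
Qed.

Lemma str_in_class c i : in_class c G i str.
Proof.
  split; [apply str_strategy|]. destruct c; auto using str_pure, str_finite_state.
Qed.

(** * States visited by the prescribed strategies *)

Definition noex (u : vert) : bool := match u with VE | VA | VB => false | _ => true end.

(* The states that occur when only exits are deviated to. *)
Definition onr (m : mem) (u : vert) : Prop :=
  match u with
  | VChain nd b j =>
      exists t, m = Main t /\ (t <= N)%nat /\ nd = nodeT t /\ b = par t /\ (j < 2 * nr)%nat
  | VNat nd b => exists t, m = Main t /\ (t <= S N)%nat /\ nd = nodeT t /\ b = par t
  | VC pc b =>
      exists t, m = Main (S t) /\ (t < N)%nat /\ pc = fst (cfg t) /\ b = par (S t)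
  | VD pc b =>
      exists t, m = Main (S t) /\ (t < N)%nat /\ nodeT (S t) = NOp pc true /\ b = par (S t)
  | VN _ _ r => (r < nr)%nat /\ exists c, m = Gad c
  | VL _ _ r | VS _ _ r | VT r _ => (r < nr)%nat
  | _ => True
  end.

Lemma nodeT_S t : (t < N)%nat -> nodeT (S t) = NOp (fst (cfg t)) (brn t).
Proof. intros H. simpl. apply Nat.ltb_lt in H. now rewrite H. Qed.

Lemma oknode_nodeT t : oknode Q (nodeT t).
Proof.
  destruct t as [|n]; simpl; auto. destruct (Nat.ltb_spec n N); simpl; auto.
Qed.

Lemma onr_ok m u : onr m u -> ok u.
Proof.
  destruct u; cbn [onr okv]; auto; try tauto.
  - intros (t & _ & Ht & -> & _ & Hj). auto using oknode_nodeT.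
  - intros (t & _ & Ht & -> & _). apply oknode_nodeT.
  - intros (t & _ & Ht & -> & _). auto.
  - intros (t & _ & Ht & Hn & _). rewrite nodeT_S in Hn by auto. injection Hn as <- _. auto.
Qed.

Lemma cfg_S t : cfg (S t) = mstep Q (cfg t).
Proof. apply mrun_snoc. Qed.

Lemma nxt_run t : (t <= N)%nat -> nxt Q nr (nodeT t) (par t) = entry Q nr (fst (cfg t)) (par (S t)).
Proof.
  intros Ht. rewrite par_S. destruct t as [|n]; [easy|].
  rewrite nodeT_S by lia. cbn [nxt]. rewrite cfg_S. unfold mstep, brn.
  pose proof (Hrun n ltac:(lia)) as Hlt.
  destruct (cfg n) as [pc regs]. cbn [fst snd] in *.
  destruct (nth_error Q pc) as [[r0|r0 j]|] eqn:E; auto.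
  - destruct (regs r0); auto.
  - apply nth_error_None in E. lia.
Qed.

Lemma entry_run t : (t <= N)%nat ->
  let u := entry Q nr (fst (cfg t)) (par (S t)) in onr (Main (S t)) u /\ noex u = true /\
  match u with VChain nd b _ | VNat nd b => nd = nodeT (S t) /\ b = par (S t) | VC _ _ => True | _ => False end.
Proof.
  intros Ht. unfold entry. destruct (Nat.eq_dec t N) as [->|Hne].
  - rewrite Hend, Nat.eqb_refl. replace (nth_error Q (S (length Q))) with (@None instr).
    + assert (nodeT (S N) = NGood) as HG by (simpl; now rewrite Nat.ltb_irrefl).
      simpl onr. split; [|split]; auto. exists (S N). auto.
    + symmetry. apply nth_error_None. lia.
  - assert (Hlt : (t < N)%nat) by lia. pose proof (Hrun t Hlt) as Hpc.
    pose proof (nodeT_S t Hlt) as Hn. unfold brn in Hn.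
    destruct (nth_error Q (fst (cfg t))) as [[r0|r0 j]|] eqn:E.
    + unfold chain. destruct (Nat.ltb_spec 0 (2 * nr)); [|lia].
      split; [|split]; auto. exists (S t). repeat split; auto; lia.
    + split; [|split]; auto. exists t. auto.
    + apply nth_error_None in E. lia.
Qed.

Lemma upd_VNat t nd b : (t <= S N)%nat -> upd (Main t) (VNat nd b) = Main (S t).
Proof. intros H. cbn [upd]. f_equal. lia. Qed.

Lemma go_run t pc b : (t < N)%nat -> b = par (S t) -> pc = fst (cfg t) ->
  go (Main (S t)) pc b = brn t.
Proof.
  intros Ht -> ->. unfold go. rewrite eqb_reflx, andb_true_r, nodeT_S by auto.
  destruct (node_eq_dec _ _) as [E|E]; destruct (brn t); try easy; congruence.
Qed.

Lemma onr_chain t j : (t <= N)%nat -> onr (Main t) (chain nr (nodeT t) (par t) j).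
Proof.
  intros Ht. unfold chain. destruct (Nat.ltb_spec j (2 * nr)).
  - exists t. auto.
  - exists t. auto.
Qed.

Lemma noex_chain nd b j : noex (chain nr nd b j) = true.
Proof. unfold chain. now destruct (Nat.ltb j (2 * nr)). Qed.

Lemma onr_gad m nd b r : (r < nr)%nat -> onr m (gad Q nd b r) /\ noex (gad Q nd b r) = true.
Proof.
  intros Hr. destruct nd as [|pc br|]; simpl; auto.
  - destruct (Nat.eqb r 0); simpl; auto.
  - destruct (nth_error Q pc) as [[r0|r0 j]|]; simpl; auto.
    destruct (Nat.eqb r r0), br; simpl; auto.
Qed.

Lemma run_closed m u : onr m u -> termv u = false -> noex u = true ->
  match ownv nr u with
  | None => forall d, In d (vdist Q nr X u) -> onr (upd m u) (fst d) /\ noex (fst d) = true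
  | Some _ => onr (upd m u) (choice m u) /\ noex (choice m u) = true
  end.
Proof.
  intros Hon Ht Hx. destruct u; try easy; cbn [ownv vdist].
  - intros d [<-|[<-|[]]]; simpl; auto.
  - simpl in Hon. intros d [<-|[<-|[]]]; simpl; auto.
  - simpl in Hon. cbn [choice]. destruct (Nat.eqb (remn m r) 0); simpl; auto.
    split; eauto.
  - destruct Hon as [Hr [c ->]]. intros d [<-|[<-|[]]]; simpl; auto.
  - destruct Hon as (t & -> & Ht' & -> & -> & Hj). cbn [choice upd].
    split; [now apply onr_chain|apply noex_chain].
  - destruct Hon as (t & -> & Ht' & -> & ->). rewrite upd_VNat by auto.
    intros d Hd. apply in_app_iff in Hd as [Hd|[<-|[<-|[]]]].
    + apply in_map_iff in Hd as (r & <- & Hr). apply in_seq in Hr. apply onr_gad. lia.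
    + destruct (nodeT t) as [|pc [|]|]; simpl; auto.
    + cbn [fst]. destruct (Nat.eq_dec t (S N)) as [->|Hne].
      * simpl. rewrite Nat.ltb_irrefl. simpl. auto.
      * rewrite nxt_run by lia. destruct (entry_run t ltac:(lia)) as (H1 & H2 & _). auto.
  - destruct Hon as (t & -> & Ht' & -> & ->). cbn [choice upd]. rewrite go_run by auto.
    pose proof (nodeT_S t Ht') as Hn. destruct (brn t).
    + split; auto. exists t. auto.
    + rewrite <- Hn. split; [apply onr_chain; lia|apply noex_chain].
  - destruct Hon as (t & -> & Ht' & Hn & ->). cbn [choice upd].
    pose proof Hn as Hn'. rewrite nodeT_S in Hn' by auto. injection Hn' as Hpc Hb.
    rewrite go_run by auto. rewrite Hb, <- Hn. split; [apply onr_chain; lia|apply noex_chain].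
  - intros d [<-|Hd]; simpl; auto. apply in_app_iff in Hd as [Hd|[<-|[]]]; simpl; auto.
    apply in_map_iff in Hd as (r & <- & Hr). apply in_seq in Hr. simpl. split; auto. lia.
Qed.

Lemma onr_closed m u : onr m u -> termv u = false ->
  match ownv nr u with
  | None => forall d, In d (vdist Q nr X u) -> onr (upd m u) (fst d)
  | Some _ => onr (upd m u) (choice m u)
  end.
Proof.
  intros Hon Ht. destruct (noex u) eqn:Hx.
  - pose proof (run_closed m u Hon Ht Hx) as H. destruct (ownv nr u); [easy|].
    intros d Hd. now apply H.
  - destruct u; try easy. intros d [<-|[<-|[]]]; simpl; auto.
Qed.

(** A well-founded certificate that play under [str] ends whatever nature does. Exact values follow
    by induction on it; the one-step equations alone need not determine them. *)
Inductive Fin : mem -> vert -> Prop :=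
| Fin_term m u : termv u = true -> Fin m u
| Fin_nature m u : ownv nr u = None -> termv u = false ->
    (forall d, In d (vdist Q nr X u) -> Fin (upd m u) (fst d)) -> Fin m u
| Fin_player m u j : ownv nr u = Some j -> Fin (upd m u) (choice m u) -> Fin m u.

Lemma Fin_VS m k b r : Fin m (VS k b r).
Proof.
  apply Fin_nature; auto. intros d [<-|[<-|[]]]; now apply Fin_term.
Qed.

Lemma Fin_VL c : forall m k b r, remn m r = c -> Fin m (VL k b r).
Proof.
  induction c as [|c IH]; intros m k b r Hc; apply Fin_player with 1%nat; auto;
    cbn [upd choice]; rewrite Hc; simpl.
  - apply Fin_VS.
  - apply Fin_nature; auto. intros d [<-|[<-|[]]]; simpl.
    + apply IH. simpl. lia.
    + now apply Fin_term.
Qed.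

Lemma Fin_gad m nd b r : Fin m (gad Q nd b r).
Proof.
  destruct nd as [|pc br|]; simpl; eauto using Fin_VL.
  - destruct (Nat.eqb r 0); auto using Fin_VS.
    apply Fin_nature; auto. intros d [<-|[<-|[]]]; [apply Fin_VS|now apply Fin_term].
  - destruct (nth_error Q pc) as [[r0|r0 j]|]; eauto using Fin_VL.
    destruct (Nat.eqb r r0), br; eauto using Fin_VL, Fin_VS.
Qed.

Lemma Fin_main k : forall t, (S N - t = k)%nat -> (t <= S N)%nat ->
  Fin (Main t) (VNat (nodeT t) (par t)).
Proof.
  induction k as [|k IH]; intros t Hk Ht; apply Fin_nature; auto; rewrite upd_VNat by auto;
    intros d Hd; cbn [vdist] in Hd; apply in_app_iff in Hd as [Hd|[<-|[<-|[]]]].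
  - apply in_map_iff in Hd as (r & <- & _). apply Fin_gad.
  - apply Fin_term. apply (cterm_ok Q nr).
  - assert (t = S N) as -> by lia. simpl. rewrite Nat.ltb_irrefl. cbn [nxt].
    apply Fin_nature; auto. intros d [<-|Hd]; [now apply Fin_term|].
    apply in_app_iff in Hd as [Hd|[<-|[]]]; [|now apply Fin_term].
    apply in_map_iff in Hd as (r & <- & _). now apply Fin_term.
  - apply in_map_iff in Hd as (r & <- & _). apply Fin_gad.
  - apply Fin_term. apply (cterm_ok Q nr).
  - cbn [fst]. rewrite nxt_run by lia.
    destruct (entry_run t ltac:(lia)) as (H1 & _ & H3).
    specialize (IH (S t) ltac:(lia) ltac:(lia)).
    assert (Hch : forall j, Fin (Main (S t)) (chain nr (nodeT (S t)) (par (S t)) j)).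
    { intros j. remember (2 * nr - j)%nat as d eqn:Hd. revert j Hd.
      induction d as [|d IHd]; intros j Hd; unfold chain;
        destruct (Nat.ltb_spec j (2 * nr)); auto; try lia.
      eapply Fin_player; [reflexivity|]. cbn [upd choice]. apply IHd. lia. }
    unfold entry in *. destruct (nth_error Q (fst (cfg t))) as [[r0|r0 j]|] eqn:E.
    + unfold chain in H3 at 1. destruct (Nat.ltb_spec 0 (2 * nr)); [|lia].
      destruct H3 as [-> _]. apply Hch.
    + destruct H1 as (t' & Ht' & Hlt & _ & _). injection Ht' as <-.
      pose proof (nodeT_S t Hlt) as Hn.
      apply Fin_player with 2%nat; auto. cbn [upd choice]. rewrite go_run by auto.
      destruct (brn t) eqn:Eb.
      * apply Fin_player with 1%nat; auto. cbn [upd choice]. rewrite go_run, Eb by auto.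
        rewrite <- Hn. apply Hch.
      * rewrite <- Hn. apply Hch.
    + destruct (Nat.eqb _ _); [|easy]. destruct H3 as [-> _]. exact IH.
Qed.

Lemma Fin_init : Fin (Main 0) (chain nr NInit true 0).
Proof.
  assert (Hch : forall d j, (2 * nr - j = d)%nat -> Fin (Main 0) (chain nr NInit true j)).
  { induction d as [|d IHd]; intros j Hd; unfold chain;
      destruct (Nat.ltb_spec j (2 * nr)); try lia.
    - apply (Fin_main (S N) 0); lia.
    - eapply Fin_player; [reflexivity|]. cbn [upd choice]. apply IHd. lia. }
  apply (Hch (2 * nr)%nat). lia.
Qed.

(** * Values with and without a deviating player *)

Section Deviation.
Variable P : profile.
Hypothesis HP : strat_profile G P.
Variable i : nat.
Hypothesis Hi : (i <= g_k G)%nat.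

Lemma expect_str g u j F : ok u -> ownv nr u = Some j -> P j = str -> valid_hist G (g ++ [e u]) ->
  expect G P (g ++ [e u]) F = F (e (choice (mem_of g) u)).
Proof.
  intros Hu Ho Hs Hv.
  assert (Hst : forall w, step G P (g ++ [e u]) w =
            if Nat.eqb w (e (choice (mem_of g) u)) then 1 else 0).
  { intros w. unfold step. rewrite last_last, owner_ev, Ho, Hs by auto.
    unfold str. now rewrite removelast_last, last_last, dv_ev. }
  unfold expect. rewrite (lsum_single _ (e (choice (mem_of g) u))).
  - rewrite Hst, Nat.eqb_refl. lra.
  - apply seq_NoDup.
  - apply in_seq. split; [lia|]. apply ev_lt; auto. eapply choice_ok; eauto.
  - intros w _ Hw. rewrite Hst. apply Nat.eqb_neq in Hw as ->. lra.
Qed.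

Lemma state_exact (On : mem -> vert -> Prop) (W : mem -> vert -> R) :
  (forall j, (1 <= j)%nat -> P j = str) ->
  (forall m u, On m u -> ok u) ->
  (forall m u, On m u -> termv u = true -> W m u = if winv nr i u then 1 else 0) ->
  (forall m u, On m u -> termv u = false ->
     match ownv nr u with
     | None => (forall d, In d (vdist Q nr X u) -> On (upd m u) (fst d)) /\
         lsum (vdist Q nr X u) (fun d => INR (snd d) / INR (den nr X u) * W (upd m u) (fst d)) = W m u
     | Some _ => On (upd m u) (choice m u) /\ W (upd m u) (choice m u) = W m u
     end) ->
  forall m u, Fin m u -> On m u -> forall g, mem_of g = m -> valid_hist G (g ++ [e u]) ->
  xval G P i (g ++ [e u]) = W m u.
Proof.
  intros Hs Hok Hterm Hstep m u HF. induction HF as [m u Ht|m u Ho Ht _ IH|m u j Ho _ IH];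
    intros Hon g Hg Hv; pose proof (Hok m u Hon) as Hu.
  - rewrite xv_term, Hterm; auto.
  - specialize (Hstep m u Hon Ht). rewrite Ho in Hstep. destruct Hstep as [H1 H2].
    rewrite (xv_nat Q nr X Hnr HX P HP); auto using winv_nonterm.
    rewrite <- H2. apply lsum_ext. intros d Hd. f_equal. apply IH; auto.
    + rewrite mem_of_snoc by auto. now rewrite Hg.
    + apply vh_next; auto. now apply (ok_dist Q nr X Hnr HX u).
  - assert (Ht : termv u = false) by (destruct u; simpl in *; easy).
    specialize (Hstep m u Hon Ht). rewrite Ho in Hstep. destruct Hstep as [H1 H2].
    rewrite xval_step; auto.
    + rewrite (expect_str g u j); auto.
      * rewrite Hg, <- H2. apply IH; auto.
        -- rewrite mem_of_snoc by auto. now rewrite Hg.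
        -- apply vh_next; auto. eapply choice_ok; eauto.
      * apply Hs. destruct u; simpl in Ho; try easy; injection Ho; lia.
    + rewrite target_e by auto. now apply winv_nonterm.
Qed.

(** The memory is a function of the history, so [W] stays meaningful after a deviation of [i]. It
    has to dominate every move of [i], but only the prescribed moves of the others. *)
Lemma state_super (On : mem -> vert -> Prop) (W : mem -> vert -> R) :
  (forall j, (1 <= j)%nat -> j <> i -> P j = str) ->
  (forall m u, On m u -> ok u) ->
  (forall m u, On m u -> 0 <= W m u) ->
  (forall m u, On m u -> winv nr i u = true -> 1 <= W m u) ->
  (forall m u, On m u -> winv nr i u = false ->
     match ownv nr u with
     | None => (forall d, In d (vdist Q nr X u) -> On (upd m u) (fst d)) /\
         lsum (vdist Q nr X u) (fun d => INR (snd d) / INR (den nr X u) * W (upd m u) (fst d)) <= W m u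
     | Some j => On (upd m u) (choice m u) /\ W (upd m u) (choice m u) <= W m u /\
         (j = i -> forall s, In s (succv nr u) -> On (upd m u) s /\ W (upd m u) s <= W m u)
     end) ->
  forall g u, On (mem_of g) u -> valid_hist G (g ++ [e u]) ->
  xval G P i (g ++ [e u]) <= W (mem_of g) u.
Proof.
  intros Hs Hok Hpos Hwin Hstep g u Hon Hv.
  pose (D := fun h => On (mem_of (removelast h)) (dv Q nr (last h 0%nat))).
  pose (WW := fun h => W (mem_of (removelast h)) (dv Q nr (last h 0%nat))).
  assert (HD : forall h w, ok w -> D (h ++ [e w]) = On (mem_of h) w).
  { intros h w Hw. unfold D. now rewrite removelast_last, last_last, dv_ev. }
  assert (HWW : forall h w, ok w -> WW (h ++ [e w]) = W (mem_of h) w).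
  { intros h w Hw. unfold WW. now rewrite removelast_last, last_last, dv_ev. }
  pose proof (Hok _ _ Hon) as Hu. rewrite <- HWW by auto.
  apply (xval_supersolution G Hwf P HP i D WW); auto; [|now rewrite HD].
  clear g u Hon Hv Hu. intros g v Hd Hv.
  assert (Hex : exists u, ok u /\ v = e u).
  { exists (dv Q nr v). split; [now apply dv_ok|]. symmetry. apply ev_dv.
    now apply valid_snoc in Hv. }
  destruct Hex as (u & Hu & ->). rewrite HD in Hd by auto. rewrite HWW by auto.
  split; [now apply Hpos|]. rewrite target_e by auto.
  destruct (winv nr i u) eqn:Hw; [now apply Hwin|].
  specialize (Hstep _ _ Hd Hw). pose proof (mem_of_snoc g u Hu) as Hm.
  destruct (step_dist G Hwf P HP g (e u) Hv) as (_ & Hnx & _).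
  destruct (ownv nr u) as [j|] eqn:Ho.
  - destruct Hstep as (H1 & H2 & H3). pose proof (choice_ok (mem_of g) u j Hu Ho) as Hc.
    destruct (Nat.eq_dec j i) as [->|Hne].
    + assert (Hsucc : forall w, (w < g_nV G)%nat -> 0 < step G P (g ++ [e u]) w ->
        exists s, ok s /\ w = e s /\ On (upd (mem_of g) u) s /\ W (upd (mem_of g) u) s <= W (mem_of g) u).
      { intros w _ Hpw. destruct (Hnx w ltac:(lra)) as [Hn _].
        apply (next_player Q nr X Hnr u w i Hu Ho) in Hn as (s & Hin & ->).
        exists s. destruct (H3 eq_refl s Hin). pose proof (okv_succ Q nr u s Hu Hin). auto. }
      split.
      * intros w Hlt Hpw. destruct (Hsucc w Hlt Hpw) as (s & Hsok & -> & Hos & _).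
        rewrite HD by auto. now rewrite Hm.
      * rewrite <- (expect_const G Hwf P HP g (e u) (W (mem_of g) u) Hv).
        apply expect_le; auto. intros w Hlt Hpw.
        destruct (Hsucc w Hlt Hpw) as (s & Hsok & -> & _ & Hle).
        rewrite HWW by auto. now rewrite Hm.
    + assert (Hj : P j = str).
      { apply Hs; auto. destruct u; simpl in Ho; try easy; injection Ho; lia. }
      split.
      * intros w Hlt Hpw. unfold step in Hpw. rewrite last_last, owner_ev, Ho, Hj in Hpw by auto.
        unfold str in Hpw. rewrite removelast_last, last_last, dv_ev in Hpw by auto.
        destruct (Nat.eqb_spec w (e (choice (mem_of g) u))) as [->|]; [|lra].
        rewrite HD by auto. now rewrite Hm.
      * rewrite (expect_str g u j) by auto. rewrite HWW by auto. now rewrite Hm.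
  - destruct Hstep as [H1 H2]. split.
    + intros w Hlt Hpw. destruct (Hnx w ltac:(lra)) as [Hn _].
      apply (next_nature Q nr X Hnr HX u w Hu Ho) in Hn as (d & Hd' & -> & _).
      rewrite HD by now apply (ok_dist Q nr X Hnr HX u). rewrite Hm. auto.
    + rewrite (expect_nat Q nr X Hnr HX P) by auto. eapply Rle_trans; [|exact H2].
      right. apply lsum_ext. intros d Hd'.
      rewrite HWW by now apply (ok_dist Q nr X Hnr HX u). now rewrite Hm.
Qed.

End Deviation.

(** * Values of the checkers and their opponents *)

Definition mval (b0 : bool) (r0 t : nat) : R :=
  if Bool.eqb b0 (par t) then kap else ph (zT t r0).

Definition gval (b0 : bool) (r0 : nat) (k : kind) (b : bool) (r : nat) (z : R) : R :=
  if Nat.eqb r r0 then (if Bool.eqb b b0 then ak k * z else 1 - z) else 0.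

(** At [VN] the counter has already been lowered, while one more coin toss is due: hence [S c]. *)
Definition uval (b0 : bool) (r0 : nat) (m : mem) (u : vert) : R :=
  match u with
  | VChain _ _ _ | VNat _ _ | VC _ _ | VD _ _ =>
      match m with Main t => mval b0 r0 t | Gad _ => 0 end
  | VL k b r => gval b0 r0 k b r ((/ 2) ^ remn m r)
  | VN k b r => match m with Gad c => gval b0 r0 k b r ((/ 2) ^ S c) | Main _ => 0 end
  | VS k b r => gval b0 r0 k b r 1
  | VK => gval b0 r0 Neu true 0 (/ INR X)
  | VE => kap
  | VGend b => if Bool.eqb b b0 then 4 * kap else kap
  | _ => if uwin b0 r0 u then 1 else 0
  end.

Lemma kap_bounds : 0 < kap <= 1 / 30.
Proof.
  destruct (rho_kappa nr Hnr) as (H1 & H2 & H3). split; auto.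
  assert (1 <= INR nr) by (apply (le_INR 1); lia).
  assert (1 * rho nr <= INR nr * rho nr) by (apply Rmult_le_compat_r; lra). lra.
Qed.

Lemma phi_bounds z : 0 <= z <= 1 -> 0 <= ph z <= 1.
Proof.
  intros Hz. destruct (rho_kappa nr Hnr) as (H1 & _ & _). pose proof kap_bounds.
  unfold phi. rewrite H1. split; nra.
Qed.

Lemma gval_bounds b0 r0 k b r z : 0 <= z <= 1 -> 0 <= gval b0 r0 k b r z <= 1.
Proof.
  intros Hz. unfold gval. pose proof (ak_bounds k).
  destruct (Nat.eqb r r0), (Bool.eqb b b0); try lra. split; nra.
Qed.

Lemma uval_bounds b0 r0 m u : 0 <= uval b0 r0 m u <= 1.
Proof.
  pose proof kap_bounds.
  assert (Hm : forall t, 0 <= mval b0 r0 t <= 1).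
  { intros t. unfold mval. destruct (Bool.eqb _ _); [lra|]. apply phi_bounds, pow_half_bounds. }
  destruct u; cbn [uval]; try (destruct m; auto; lra);
    try (destruct (uwin _ _ _); lra); auto using gval_bounds, pow_half_bounds.
  - apply gval_bounds. assert (1 <= INR X) by (apply (le_INR 1), HX).
    split; [left; apply Rinv_0_lt_compat; lra|]. rewrite <- Rinv_1.
    apply Rinv_le_contravar; lra.
  - apply gval_bounds. lra.
  - destruct m; [lra|]. apply gval_bounds, pow_half_bounds.
  - destruct (Bool.eqb _ _); lra.
Qed.

Lemma remn_run t r : (t <= S N)%nat -> (r < nr)%nat -> remn (Main (S t)) r = rT t r.
Proof.
  intros Ht Hr. cbn [remn pred]. apply Nat.min_r. unfold rT. apply HB; auto. lia.
Qed.

Lemma gad_value b0 r0 t r : (t <= S N)%nat -> (r < nr)%nat ->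
  uval b0 r0 (Main (S t)) (gad Q (nodeT t) (par t) r) =
  gval b0 r0 (gkind Q (nodeT t) r) (par t) r (zT t r).
Proof.
  intros Ht Hr. pose proof (remn_run t r Ht Hr) as Hrem.
  destruct t as [|n].
  - cbn [nodeT gad gkind]. unfold zT, rT, par. cbn [pred Nat.even].
    unfold cfg. cbn [mrun init_state snd].
    destruct (Nat.eqb_spec r 0) as [->|Hne]; cbn [uval]; [f_equal|easy].
    rewrite pow_INR, pow_inv. now replace (INR 2) with 2 by (simpl; lra).
  - cbn [nodeT]. destruct (Nat.ltb_spec n N) as [Hlt|Hge].
    + cbn [gad gkind]. unfold zT, brn.
      destruct (nth_error Q (fst (cfg n))) as [[r1|r1 j]|] eqn:E.
      * cbn [uval]. now rewrite Hrem.
      * destruct (Nat.eqb_spec r r1) as [->|Hne].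
        -- destruct (snd (cfg n) r1) as [|c] eqn:Ec; cbn [negb Nat.eqb andb uval].
           ++ unfold rT. cbn [pred]. now rewrite Ec.
           ++ now rewrite Hrem.
        -- cbn [andb uval]. now rewrite Hrem.
      * cbn [uval]. now rewrite Hrem.
    + cbn [gad gkind uval]. now rewrite Hrem.
Qed.

Lemma zT_step t r : (t <= N)%nat -> zT (S t) r = 4 * ak (gkind Q (nodeT t) r) * zT t r.
Proof.
  destruct ak_values as (AN & AI & AD).
  intros Ht. unfold zT, rT. cbn [pred]. destruct t as [|n].
  - cbn [nodeT gkind pred]. rewrite AN. lra.
  - rewrite nodeT_S by lia. cbn [gkind pred]. rewrite cfg_S.
    pose proof (Hrun n ltac:(lia)) as Hlt. unfold mstep, brn.
    destruct (cfg n) as [pc regs]. cbn [fst snd] in *.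
    destruct (nth_error Q pc) as [[r1|r1 j]|] eqn:E.
    + cbn [snd]. unfold set_reg. destruct (Nat.eqb_spec r r1) as [->|Hne].
      * rewrite AI. simpl. lra.
      * rewrite AN. lra.
    + destruct (regs r1) as [|c] eqn:Ec; cbn [snd negb Nat.eqb].
      * rewrite andb_false_r, AN. lra.
      * rewrite andb_true_r. unfold set_reg. destruct (Nat.eqb_spec r r1) as [->|Hne].
        -- rewrite AD, Ec. simpl. lra.
        -- rewrite AN. lra.
    + apply nth_error_None in E. lia.
Qed.

Lemma uval_main b0 r0 t u : onr (Main t) u ->
  match u with VChain _ _ _ | VNat _ _ | VC _ _ | VD _ _ => True | _ => False end ->
  uval b0 r0 (Main t) u = mval b0 r0 t.
Proof. destruct u; easy. Qed.

Lemma uval_chain b0 r0 m nd b j : uval b0 r0 m (chain nr nd b j) = uval b0 r0 m (VNat nd b).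
Proof. unfold chain. now destruct (Nat.ltb j (2 * nr)). Qed.

(** If family [b0] is checked now, this is [rho * ak * z + phi (4 * ak * z) / 4 = kap]; otherwise it
    is the definition of [phi]. At the last half step [VGend] supplies [4 * kap] and [kap]. *)
Lemma mval_step b0 r0 t : (t <= S N)%nat -> (r0 < nr)%nat ->
  rho nr * gval b0 r0 (gkind Q (nodeT t) r0) (par t) r0 (zT t r0) +
  1 / 4 * uval b0 r0 (Main (S t)) (nxt Q nr (nodeT t) (par t)) = mval b0 r0 t.
Proof.
  intros Ht Hr. destruct (rho_kappa nr Hnr) as (Hrk & _ & _).
  unfold gval, mval. rewrite Nat.eqb_refl.
  destruct (Nat.eq_dec t (S N)) as [->|Hne].
  - cbn [nodeT]. rewrite Nat.ltb_irrefl. cbn [nxt gkind uval]. unfold ak. simpl INR.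
    destruct b0, (par (S N)); cbn [Bool.eqb]; unfold phi; lra.
  - rewrite nxt_run by lia. destruct (entry_run t ltac:(lia)) as (H1 & H2 & H3).
    rewrite uval_main; auto.
    + unfold mval. rewrite par_S, zT_step by lia.
      destruct b0, (par t); cbn [Bool.eqb negb]; unfold phi; rewrite Hrk; lra.
    + revert H3. now destruct (entry Q nr (fst (cfg t)) (par (S t))).
Qed.

Lemma uval_exact b0 r0 m u : (r0 < nr)%nat -> onr m u -> termv u = false ->
  match ownv nr u with
  | None => lsum (vdist Q nr X u)
      (fun d => INR (snd d) / INR (den nr X u) * uval b0 r0 (upd m u) (fst d)) = uval b0 r0 m u
  | Some _ => uval b0 r0 (upd m u) (choice m u) = uval b0 r0 m u
  end.
Proof.
  intros Hr Hon Ht.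
  assert (Hn : 0 < INR nr) by (apply lt_0_INR; lia).
  destruct u; try easy; cbn [ownv].
  - cbn [vdist upd den]. rewrite !lsum_cons, lsum_nil. cbn [fst snd uval uwin].
    unfold gval. assert (0 < INR X) by (apply lt_0_INR, HX).
    rewrite minus_INR by (apply HX).
    destruct (Nat.eqb 0 r0), b0; cbn [Bool.eqb andb]; simpl (INR 1); field; lra.
  - cbn [vdist upd den]. rewrite !lsum_cons, lsum_nil. cbn [fst snd uval uwin].
    unfold gval, ak. destruct (Nat.eqb r r0), b, b0, k; simpl; lra.
  - cbn [choice upd]. destruct (Nat.eqb_spec (remn m r) 0) as [E|E]; cbn [uval].
    + now rewrite E.
    + do 2 f_equal. lia.
  - destruct Hon as [_ [c ->]]. cbn [vdist upd den].
    rewrite !lsum_cons, lsum_nil. cbn [fst snd uval uwin remn].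
    unfold gval. destruct (Nat.eqb r r0), b, b0; simpl; lra.
  - cbn [choice upd]. now rewrite uval_chain.
  - destruct Hon as (t & -> & Ht' & -> & ->). rewrite upd_VNat by auto.
    rewrite (dist_VNat Q nr X Hnr HX (nodeT t) (par t) (uval b0 r0 (Main (S t)))).
    cbn [uval]. rewrite <- mval_step by auto.
    rewrite (lsum_single _ r0).
    + rewrite gad_value by auto. destruct (cterm_ok Q nr (nodeT t)) as (_ & _ & Hc).
      replace (uval b0 r0 (Main (S t)) (cterm (nodeT t))) with 0; [lra|].
      now destruct (nodeT t) as [|pc [|]|].
    + apply seq_NoDup.
    + apply in_seq. lia.
    + intros r Hr' Hne. apply in_seq in Hr'. rewrite gad_value by (auto; lia).
      unfold gval. apply Nat.eqb_neq in Hne. now rewrite Hne.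
  - cbn [choice upd]. destruct (go m pc b); rewrite ?uval_chain; easy.
  - cbn [choice upd]. destruct Hon as (t & -> & Ht' & Hn' & ->).
    pose proof Hn' as Hn2. rewrite nodeT_S in Hn2 by auto. injection Hn2 as Hpc Hb.
    rewrite go_run by auto. rewrite Hb. now rewrite uval_chain.
  - cbn [vdist upd den]. rewrite lsum_cons, lsum_app, lsum_map, lsum_cons, lsum_nil.
    cbn [fst snd uval uwin]. rewrite (lsum_single _ r0).
    + rewrite Nat.eqb_refl. unfold kappa. rewrite mult_INR.
      destruct b, b0; cbn [Bool.eqb andb]; simpl; field; lra.
    + apply seq_NoDup.
    + apply in_seq. lia.
    + intros r _ Hne. apply Nat.eqb_neq in Hne. rewrite Hne. simpl. lra.
  - cbn [vdist upd den]. rewrite !lsum_cons, lsum_nil. cbn [fst snd uval uwin].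
    unfold kappa. rewrite mult_INR. simpl. field. lra.
Qed.

(** Under [str] play ends surely and the targets are complementary, so the opponent's value is the
    rest to 1. *)
Definition cval (s b0 : bool) (r0 : nat) (m : mem) (u : vert) : R :=
  if s then 1 - uval b0 r0 m u else uval b0 r0 m u.

Lemma cval_term s b0 r0 m u : (r0 < nr)%nat -> termv u = true ->
  cval s b0 r0 m u = if winv nr (plr s b0 r0) u then 1 else 0.
Proof.
  intros Hr Ht. rewrite winv_pl by auto. unfold cval, pwin. rewrite Ht.
  replace (uval b0 r0 m u) with (if uwin b0 r0 u then 1 else 0) by now destruct u.
  destruct s, (uwin b0 r0 u); simpl; lra.
Qed.

Lemma cval_exact s b0 r0 m u : (r0 < nr)%nat -> onr m u -> termv u = false ->
  match ownv nr u with
  | None => lsum (vdist Q nr X u)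
      (fun d => INR (snd d) / INR (den nr X u) * cval s b0 r0 (upd m u) (fst d)) = cval s b0 r0 m u
  | Some _ => cval s b0 r0 (upd m u) (choice m u) = cval s b0 r0 m u
  end.
Proof.
  intros Hr Hon Ht. pose proof (uval_exact b0 r0 m u Hr Hon Ht) as H. unfold cval.
  destruct (ownv nr u) eqn:Ho; destruct s; auto.
  - now rewrite H.
  - rewrite <- H. rewrite <- (dist_total Q nr X Hnr HX u Ho (onr_ok m u Hon)) at 1.
    rewrite (lsum_ext _ _ (fun d => INR (snd d) / INR (den nr X u) +
      -1 * (INR (snd d) / INR (den nr X u) * uval b0 r0 (upd m u) (fst d)))) by (intros; lra).
    rewrite lsum_plus, lsum_scal. lra.
Qed.

(** * Values of player 2 *)

Fixpoint vcf (k t : nat) : R :=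
  match k with
  | O => 0
  | S k' => match nodeT t with NOp _ true => 5 / 8 | _ => 0 end + 1 / 4 * vcf k' (S t)
  end.

(** What the rest of the run is worth to player 2: each nonzero branch pays 5/8 through [VY], each
    further half step is discounted by 1/4, and the end pays nothing. *)
Definition vC (t : nat) : R := vcf (S N - t) t.

Lemma vC_bounds t : 0 <= vC t <= 1.
Proof.
  unfold vC. generalize (S N - t)%nat as k. intros k. revert t.
  induction k as [|k IH]; intros t; simpl vcf; [lra|].
  specialize (IH (S t)). destruct (nodeT t) as [|pc [|]|]; lra.
Qed.

Lemma vC_step t : (t <= N)%nat ->
  vC t = match nodeT t with NOp _ true => 5 / 8 | _ => 0 end + 1 / 4 * vC (S t).
Proof.
  intros Ht. unfold vC. replace (S N - t)%nat with (S (S N - S t)) by lia. reflexivity.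
Qed.

Lemma vC_end : vC (S N) = 0.
Proof. unfold vC. now rewrite Nat.sub_diag. Qed.

Definition mainC (m : mem) (nd : node) (b : bool) : R :=
  let off := match nd with NOp _ false => 3 / 8 | _ => 1 end in
  match m with
  | Main t =>
      if ((if node_eq_dec nd (nodeT t) then true else false) && Bool.eqb b (par t) &&
          Nat.leb t (S N))%bool then vC t else off
  | Gad _ => off
  end.

(* Off the simulated run, the trivial bound 1 is enough, except that entering a zero branch
   is worth at most [3 / 8] to player 2, and nothing if player 1 punishes. *)
Definition Cval (m : mem) (u : vert) : R :=
  match u with
  | VChain nd b _ | VNat nd b => mainC m nd b
  | VC pc b =>
      match m with
      | Main t => match nodeT t with
                  | NOp pc' _ => if (Nat.eqb pc' pc && Bool.eqb b (par t))%bool then vC t else 1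
                  | _ => 1
                  end
      | Gad _ => 1
      end
  | VD pc b => if go m pc b then match m with Main t => vC t | Gad _ => 0 end else 0
  | VY => 1
  | _ => 0
  end.

Lemma mainC_run t : (t <= S N)%nat -> mainC (Main t) (nodeT t) (par t) = vC t.
Proof.
  intros Ht. unfold mainC. destruct (node_eq_dec _ _); [|easy].
  rewrite eqb_reflx. apply Nat.leb_le in Ht. now rewrite Ht.
Qed.

Lemma Cval_chain m nd b j : Cval m (chain nr nd b j) = mainC m nd b.
Proof. unfold chain. now destruct (Nat.ltb j (2 * nr)). Qed.

Lemma Cval_bounds m u : 0 <= Cval m u <= 1.
Proof.
  assert (Hm : forall nd b, 0 <= mainC m nd b <= 1).
  { intros nd b. unfold mainC. destruct m as [t|c].
    - pose proof (vC_bounds t). destruct (_ && _)%bool; [lra|].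
      destruct nd as [|pc [|]|]; lra.
    - destruct nd as [|pc [|]|]; lra. }
  destruct u; cbn [Cval]; auto; try lra.
  - destruct m as [t|c]; [|lra]. pose proof (vC_bounds t).
    destruct (nodeT t); try lra. destruct (_ && _)%bool; lra.
  - destruct (go m pc b), m as [t|c]; try lra. apply vC_bounds.
Qed.

Lemma Cval_gad m nd b r : Cval m (gad Q nd b r) = 0.
Proof.
  destruct nd as [|pc br|]; simpl; auto.
  - now destruct (Nat.eqb r 0).
  - destruct (nth_error Q pc) as [[r0|r0 j]|]; simpl; auto.
    now destruct (Nat.eqb r r0), br.
Qed.

Lemma nodeT_NOp_lt t pc br : nodeT t = NOp pc br -> exists n, t = S n /\ (n < N)%nat.
Proof.
  destruct t as [|n]; [easy|]. simpl. destruct (Nat.ltb_spec n N); [|easy]. eauto.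
Qed.

Lemma Cval_VNat m nd b :
  lsum (vdist Q nr X (VNat nd b)) (fun d => INR (snd d) / INR (den nr X (VNat nd b)) *
      Cval (upd m (VNat nd b)) (fst d)) =
  5 / 8 * Cval (upd m (VNat nd b)) (cterm nd) + 1 / 4 * Cval (upd m (VNat nd b)) (nxt Q nr nd b).
Proof.
  rewrite (dist_VNat Q nr X Hnr HX nd b (Cval (upd m (VNat nd b)))).
  rewrite (lsum_zero _ (fun r => Cval (upd m (VNat nd b)) (gad Q nd b r)))
    by (intros; apply Cval_gad). lra.
Qed.

Lemma Cval_entry t : (t <= N)%nat ->
  Cval (Main (S t)) (entry Q nr (fst (cfg t)) (par (S t))) = vC (S t).
Proof.
  intros Ht. destruct (entry_run t Ht) as (H1 & _ & H3).
  destruct (entry Q nr (fst (cfg t)) (par (S t))); try easy.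
  - destruct H3 as [-> ->]. apply mainC_run. lia.
  - destruct H3 as [-> ->]. apply mainC_run. lia.
  - destruct H1 as (t' & Ht' & Hlt & -> & ->). injection Ht' as <-.
    cbn [Cval]. rewrite nodeT_S, Nat.eqb_refl, eqb_reflx by auto. easy.
Qed.

Lemma Cval_VNat_run t : (t <= S N)%nat ->
  5 / 8 * Cval (Main (S t)) (cterm (nodeT t)) +
  1 / 4 * Cval (Main (S t)) (nxt Q nr (nodeT t) (par t)) = vC t.
Proof.
  intros Ht. destruct (Nat.eq_dec t (S N)) as [->|Hne].
  - rewrite vC_end. cbn [nodeT]. rewrite Nat.ltb_irrefl. simpl. lra.
  - rewrite nxt_run, Cval_entry, (vC_step t) by lia.
    destruct (nodeT t) as [|pc [|]|]; simpl; lra.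
Qed.

Lemma go_inv m pc b : go m pc b = true ->
  exists n, m = Main (S n) /\ (n < N)%nat /\ nodeT (S n) = NOp pc true /\ b = par (S n).
Proof.
  unfold go. destruct m as [t|c]; [|easy].
  destruct (node_eq_dec (nodeT t) (NOp pc true)) as [E|]; [|easy].
  destruct (nodeT_NOp_lt t pc true E) as (n & -> & Hn).
  intros Hb. apply eqb_prop in Hb. exists n. auto.
Qed.

Lemma Cval_exact m u : onr m u -> termv u = false ->
  match ownv nr u with
  | None => lsum (vdist Q nr X u)
      (fun d => INR (snd d) / INR (den nr X u) * Cval (upd m u) (fst d)) = Cval m u
  | Some _ => Cval (upd m u) (choice m u) = Cval m u
  end.
Proof.
  intros Hon Ht. destruct u; try easy; cbn [ownv];
    try (cbn [vdist]; rewrite !lsum_cons, lsum_nil; cbn [fst snd Cval]; lra).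
  - cbn [choice]. now destruct (Nat.eqb (remn m r) 0).
  - cbn [choice upd]. now rewrite Cval_chain.
  - rewrite Cval_VNat. destruct Hon as (t & -> & Ht' & -> & ->). rewrite upd_VNat by auto.
    cbn [Cval]. rewrite mainC_run by auto. now apply Cval_VNat_run.
  - destruct Hon as (t & -> & Ht' & -> & ->). cbn [choice upd Cval].
    rewrite nodeT_S, Nat.eqb_refl, eqb_reflx, go_run by auto. cbn [andb].
    pose proof (nodeT_S t Ht') as Hn. destruct (brn t) eqn:Eb.
    + cbn [Cval]. now rewrite go_run, Eb.
    + rewrite Cval_chain, <- Hn. apply mainC_run. lia.
  - destruct Hon as (t & -> & Ht' & Hn & ->). cbn [choice upd Cval].
    pose proof Hn as Hn'. rewrite nodeT_S in Hn' by auto. injection Hn' as Hpc Hb.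
    rewrite go_run, Hb by auto. rewrite Cval_chain, <- Hn. apply mainC_run. lia.
  - cbn [vdist]. rewrite lsum_cons, lsum_app, lsum_map, lsum_cons, lsum_nil.
    cbn [fst snd Cval]. rewrite lsum_zero; [lra|]. intros; lra.
Qed.

Lemma Cval_super m u : ok u -> winv nr 2 u = false ->
  match ownv nr u with
  | None => lsum (vdist Q nr X u)
      (fun d => INR (snd d) / INR (den nr X u) * Cval (upd m u) (fst d)) <= Cval m u
  | Some j => Cval (upd m u) (choice m u) <= Cval m u /\
      (j = 2%nat -> forall s, In s (succv nr u) -> Cval (upd m u) s <= Cval m u)
  end.
Proof.
  intros Hu Hw.
  destruct u; try easy; cbn [ownv];
    try (cbn [vdist]; rewrite !lsum_cons, lsum_nil; cbn [fst snd Cval]; lra).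
  - split; [|easy]. cbn [choice]. destruct (Nat.eqb (remn m r) 0); simpl; lra.
  - split; [cbn [choice upd]; rewrite Cval_chain; cbn [Cval]; lra|].
    intros Hj. destruct b; lia.
  - rewrite Cval_VNat. cbn [Cval]. unfold mainC at 1.
    set (nx := Cval _ (nxt Q nr nd b)).
    assert (Hnx : 0 <= nx <= 1) by apply Cval_bounds.
    set (ct := Cval _ (cterm nd)).
    assert (Hct : 0 <= ct <= 1) by apply Cval_bounds.
    assert (Hct0 : match nd with NOp _ false => ct = 0 | _ => True end)
      by (subst ct; destruct nd as [|pc [|]|]; easy).
    assert (Hoff : 5 / 8 * ct + 1 / 4 * nx <= match nd with NOp _ false => 3 / 8 | _ => 1 end)
      by (destruct nd as [|pc [|]|]; lra).
    destruct m as [t|c]; auto.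
    destruct (node_eq_dec nd (nodeT t)) as [->|]; auto.
    destruct (Bool.eqb_spec b (par t)) as [->|]; auto.
    destruct (Nat.leb_spec t (S N)) as [Ht|]; auto. cbn [andb].
    subst ct nx. rewrite upd_VNat by auto. rewrite Cval_VNat_run by auto. lra.
  - assert (Hs : forall s, In s (succv nr (VC pc b)) -> Cval (upd m (VC pc b)) s <= Cval m (VC pc b)).
    { intros s Hs. cbn [upd].
      assert (H1 : Cval m s <= 1) by apply Cval_bounds.
      destruct m as [t|c]; [|exact H1]. cbn [Cval].
      destruct (nodeT t) as [|pc' br|] eqn:En; try exact H1.
      destruct (Nat.eqb_spec pc' pc) as [->|]; [|exact H1].
      destruct (Bool.eqb_spec b (par t)) as [->|]; [|exact H1]. cbn [andb].
      destruct (nodeT_NOp_lt t pc br En) as (n & -> & Hn).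
      pose proof (vC_bounds (S n)) as Hb.
      destruct Hs as [<-|[<-|[]]].
      - rewrite Cval_chain. destruct br.
        (* The run goes to the nonzero branch, worth at least 5/8; the deviation to the zero branch
           is worth at most 3/8. *)
        + unfold mainC. destruct (node_eq_dec _ _) as [E|]; [congruence|]. cbn [andb].
          rewrite vC_step, En by lia. pose proof (vC_bounds (S (S n))). lra.
        + rewrite <- En, mainC_run by lia. lra.
      (* A wrong nonzero branch is refused by player 1 and worth 0. *)
      - cbn [Cval]. destruct (go (Main (S n)) pc (par (S n))); lra. }
    split; [|auto]. apply Hs. now apply (choice_succ m (VC pc b) 2).
  - split; [|easy]. cbn [choice upd Cval]. destruct (go m pc b) eqn:E; [|simpl; lra].
    destruct (go_inv m pc b E) as (n & -> & Hn & Hnode & ->).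
    rewrite Cval_chain, <- Hnode, mainC_run by lia. lra.
  - cbn [vdist]. rewrite lsum_cons, lsum_app, lsum_map, lsum_cons, lsum_nil.
    cbn [fst snd Cval]. rewrite lsum_zero; [lra|]. intros; lra.
Qed.

Lemma player_cases i : (1 <= i <= g_k G)%nat ->
  i = 1%nat \/ i = 2%nat \/ exists s b r, (r < nr)%nat /\ i = plr s b r.
Proof.
  cbn [g_k the_game]. intros Hi. destruct i as [|[|[|j]]]; auto; [lia|]. right; right.
  assert (Hj : forall j, exists s : bool, (j = 2 * (j / 2) + if s then 1 else 0)%nat).
  { intros k. pose proof (Nat.div_mod_eq k 2). pose proof (Nat.mod_upper_bound k 2 ltac:(lia)).
    destruct (Nat.eq_dec (k mod 2) 0); [exists false|exists true]; lia. }
  destruct (le_lt_dec (2 * nr) j) as [Hge|Hlt].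
  - destruct (Hj (j - 2 * nr)%nat) as [s Hs]. exists s, false, ((j - 2 * nr) / 2)%nat.
    split; [apply Nat.Div0.div_lt_upper_bound; lia|]. unfold pl. rewrite <- Hs. lia.
  - destruct (Hj j) as [s Hs]. exists s, true, (j / 2)%nat.
    split; [apply Nat.Div0.div_lt_upper_bound; lia|]. unfold pl. rewrite <- Hs. lia.
Qed.

Lemma onr_init : onr (Main 0) (chain nr NInit true 0).
Proof. apply (onr_chain 0). lia. Qed.

(** The system never moves, so [s0] is arbitrary and the same environment refutes every
    candidate. *)
Lemma good_run_NE c s0 : in_class c G 0 s0 ->
  is_NE0 c G (update (fun _ => str) 0 s0) /\ Pay G (update (fun _ => str) 0 s0) 0 = Finite 0.
Proof.
  intros Hs0. set (P := update (fun _ => str) 0 s0).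
  assert (HP : strat_profile G P).
  { intros j Hj. unfold P, update. destruct (Nat.eqb_spec j 0) as [->|]; [apply Hs0|].
    apply str_strategy. }
  assert (HPj : forall j, (1 <= j)%nat -> P j = str).
  { intros j Hj. unfold P, update. destruct (Nat.eqb_spec j 0); [lia|easy]. }
  pose proof onr_init as Hinit. pose proof Fin_init as Hfin.
  assert (Hv0 : valid_hist G ([] ++ [e (chain nr NInit true 0)])) by apply (v0_valid G Hwf).
  split.
  - intros i Hi t Ht. set (P' := update P i t).
    assert (HP' : strat_profile G P') by (apply strat_profile_update; [easy|apply Ht]).
    assert (HPj' : forall j, (1 <= j)%nat -> j <> i -> P' j = str).
    { intros j Hj Hne. unfold P', update. destruct (Nat.eqb_spec j i); [easy|]. now apply HPj. }
    rewrite !Pay_xval by auto.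
    change (xval G P' i ([] ++ [e (chain nr NInit true 0)]) <=
            xval G P i ([] ++ [e (chain nr NInit true 0)])).
    destruct (player_cases i Hi) as [->|[->|(s & b & r & Hr & ->)]].
    + apply Rle_trans with 0; [|apply (xval_bounds G Hwf P HP 1 [] _ Hv0)].
      apply (state_super P' HP' 1 ltac:(lia) (fun _ u => ok u) (fun _ _ => 0)); auto; try easy.
      * intros m u Hu _. destruct (ownv nr u) as [j|] eqn:Ho.
        -- split; [eapply choice_ok; eauto|]. split; [lra|]. intros _ w Hw.
           split; [eapply okv_succ; eauto|lra].
        -- split; [intros d Hd; now apply (ok_dist Q nr X Hnr HX u)|].
           rewrite lsum_zero; [lra|]. intros; lra.
      * now apply okv_chain.
    + rewrite (state_exact P HP 2 ltac:(lia) onr Cval) with (m := Main 0); auto.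
      (* Player 2 can leave the simulated run, so its bound has to hold at all legal vertices and
         for all memories. *)
      * apply (state_super P' HP' 2 ltac:(lia) (fun _ u => ok u) Cval); auto.
        -- intros; apply Cval_bounds.
        -- intros m u _ Hw. destruct u; simpl in Hw; try easy.
        -- intros m u Hu Hw. pose proof (Cval_super m u Hu Hw) as H.
           destruct (ownv nr u) as [j|] eqn:Ho.
           ++ split; [eapply choice_ok; eauto|]. split; [easy|]. intros Hj w Hw'.
              split; [eapply okv_succ; eauto|now apply H].
           ++ split; [intros d Hd; now apply (ok_dist Q nr X Hnr HX u)|easy].
        -- now apply okv_chain.
      * apply onr_ok.
      * intros m u _ Ht'. destruct u; easy.
      * intros m u Hon Ht'. pose proof (Cval_exact m u Hon Ht') as H.
        pose proof (onr_closed m u Hon Ht') as H'. destruct (ownv nr u); auto.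
    + pose proof (cval_exact s b r) as Hex.
      rewrite (state_exact P HP (plr s b r) ltac:(lia) onr (cval s b r)) with (m := Main 0); auto.
      (* A checker or opponent can deviate only by exiting, which stays inside [onr]; the exact
         values therefore serve as the upper bound. *)
      * apply (state_super P' HP' (plr s b r) ltac:(lia) onr (cval s b r)); auto.
        -- apply onr_ok.
        -- intros m u _. pose proof (uval_bounds b r m u). unfold cval. destruct s; lra.
        -- intros m u Hon Hw. rewrite cval_term; auto; [rewrite Hw; lra|].
           eapply winv_termv; eauto.
        -- intros m u Hon Hw. destruct (termv u) eqn:Htm.
           { replace (ownv nr u) with (@None nat) by now destruct u.
             assert (Hd : vdist Q nr X u = [(u, 1%nat)]) by now destruct u.
             rewrite Hd. split.
             - intros d [<-|[]]. cbn [fst]. destruct u; easy.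
             - rewrite lsum_cons, lsum_nil. cbn [fst snd]. rewrite !cval_term, Hw by auto. lra. }
           pose proof (Hex m u Hr Hon Htm) as H1. pose proof (onr_closed m u Hon Htm) as H2.
           destruct (ownv nr u) as [j|] eqn:Ho; [|split; [easy|lra]].
           split; auto. split; [lra|]. intros -> w Hw'.
           assert (Hu : exists nd b' j', u = VChain nd b' j').
           { destruct u; simpl in Ho; try easy; try (injection Ho; unfold pl; lia). eauto. }
           destruct Hu as (nd & b' & j' & ->).
           destruct Hw' as [<-|[<-|[]]]; [cbn [choice] in *; split; [easy|lra]|].
           split; [easy|]. destruct Hon as (t' & -> & Ht' & -> & -> & Hj').
           cbn [upd]. unfold cval. cbn [uval]. unfold mval.
           (* Whoever owns a vertex of the chain is of the family checked now, so its value already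
              equals what the exit pays. *)
           assert (Hb : b = par t').
           { cbn [ownv] in Ho. injection Ho as Ho. unfold pl in Ho.
             destruct b, (par t'), s; auto; exfalso; lia. }
           rewrite Hb, eqb_reflx. destruct s; lra.
      * apply onr_ok.
      * intros m u _ Ht'. now apply cval_term.
      * intros m u Hon Ht'. pose proof (Hex m u Hr Hon Ht') as H.
        pose proof (onr_closed m u Hon Ht') as H'. destruct (ownv nr u); auto.
  - rewrite Pay_xval by auto. f_equal. apply Rle_antisym;
      [|apply (xval_bounds G Hwf P HP 0 [] _ Hv0)].
    change (xval G P 0 ([] ++ [e (chain nr NInit true 0)]) <= 0).
    (* Without deviations no exit is taken, so the domain avoids all vertices where the system wins
       and the bound 0 is admissible. *)
    apply (state_super P HP 0 ltac:(lia) (fun m u => onr m u /\ noex u = true) (fun _ _ => 0)); auto.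
    + intros m u [H _]. eapply onr_ok; eauto.
    + intros; lra.
    + intros m u [_ H] Hw. destruct u; easy.
    + intros m u [Hon Hx] Hw. destruct (termv u) eqn:Htm.
      { replace (ownv nr u) with (@None nat) by now destruct u.
        assert (Hd : vdist Q nr X u = [(u, 1%nat)]) by now destruct u.
        rewrite Hd. split.
        - intros d [<-|[]]. cbn [fst]. destruct u; easy.
        - rewrite lsum_cons, lsum_nil. lra. }
      pose proof (run_closed m u Hon Htm Hx) as H. destruct (ownv nr u) as [j|] eqn:Ho.
      * split; auto. split; [lra|]. intros ->.
        destruct u; simpl in Ho; try easy; injection Ho; lia.
      * split; auto. rewrite lsum_zero; [lra|]. intros; lra.
    + split; [exact Hinit|apply noex_chain].
Qed.

End Completeness.

(** * Register machine programs *)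

Close Scope R_scope.

(** A structured language with a big-step semantics, so that the preprocessing of the diagonal
    machine can be verified piece by piece. *)
Inductive cmd : Type :=
| CInc (r : nat)
| CDec (r : nat)
| CSeq (c1 c2 : cmd)
| CWhile (r : nat) (c : cmd)
| CIf (r : nat) (c1 c2 : cmd).

Inductive exec : cmd -> (nat -> nat) -> (nat -> nat) -> Prop :=
| exec_inc r s : exec (CInc r) s (set_reg s r (S (s r)))
| exec_dec r s : exec (CDec r) s (set_reg s r (pred (s r)))
| exec_seq c1 c2 s s1 s2 : exec c1 s s1 -> exec c2 s1 s2 -> exec (CSeq c1 c2) s s2
| exec_while_stop r c s : s r = 0 -> exec (CWhile r c) s s
| exec_while_loop r c s s1 s2 : s r <> 0 -> exec c s s1 -> exec (CWhile r c) s1 s2 ->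
    exec (CWhile r c) s s2
| exec_if_nonzero r c1 c2 s s1 : s r <> 0 -> exec c1 s s1 -> exec (CIf r c1 c2) s s1
| exec_if_zero r c1 c2 s s1 : s r = 0 -> exec c2 s s1 -> exec (CIf r c1 c2) s s1.

(** The three extra instructions are the test, the increment that undoes its decrement, and an
    unconditional jump. *)
Fixpoint clen (c : cmd) : nat :=
  match c with
  | CInc _ | CDec _ => 1
  | CSeq c1 c2 => clen c1 + clen c2
  | CWhile _ c => clen c + 3
  | CIf _ c1 c2 => clen c1 + clen c2 + 3
  end.

(* Register [z] must be zero: [DEC z j] is then an unconditional jump to [j]. *)
Fixpoint comp (z o : nat) (c : cmd) : program :=
  match c with
  | CInc r => [INC r]
  | CDec r => [DEC r (S o)]
  | CSeq c1 c2 => comp z o c1 ++ comp z (o + clen c1) c2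
  | CWhile r c => [DEC r (o + clen c + 3); INC r] ++ comp z (o + 2) c ++ [DEC z o]
  | CIf r c1 c2 =>
      [DEC r (o + clen c1 + 3); INC r] ++ comp z (o + 2) c1 ++
      [DEC z (o + clen c1 + clen c2 + 3)] ++ comp z (o + clen c1 + 3) c2
  end.

Lemma comp_length z c : forall o, length (comp z o c) = clen c.
Proof.
  induction c; intros o; simpl; auto; rewrite ?length_app; simpl; rewrite ?length_app;
    rewrite ?IHc, ?IHc1, ?IHc2; simpl; rewrite ?IHc2; lia.
Qed.

Fixpoint avoids (z : nat) (c : cmd) : Prop :=
  match c with
  | CInc r | CDec r => r <> z
  | CSeq c1 c2 => avoids z c1 /\ avoids z c2
  | CWhile r c => r <> z /\ avoids z c
  | CIf r c1 c2 => r <> z /\ avoids z c1 /\ avoids z c2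
  end.

Lemma avoids_exec z c s s' : exec c s s' -> avoids z c -> s' z = s z.
Proof.
  assert (Hset : forall r v s, r <> z -> set_reg s r v z = s z).
  { intros r v s0 Hne. unfold set_reg. destruct (Nat.eqb_spec z r); congruence. }
  induction 1; simpl; intros Ha; auto; try (apply Hset; tauto).
  - rewrite IHexec2, IHexec1; tauto.
  - rewrite IHexec2, IHexec1; simpl; tauto.
  - tauto.
  - tauto.
Qed.

Definition code_at (P : program) (o : nat) (l : program) : Prop :=
  exists pre post, P = pre ++ l ++ post /\ length pre = o.

Lemma code_at_app P o l1 l2 : code_at P o (l1 ++ l2) ->
  code_at P o l1 /\ code_at P (o + length l1) l2.
Proof.
  intros (pre & post & -> & <-). split.
  - exists pre, (l2 ++ post). now rewrite <- app_assoc.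
  - exists (pre ++ l1), post. rewrite <- !app_assoc. split; auto. now rewrite length_app.
Qed.

Lemma code_at_nth P o i l : code_at P o (i :: l) -> nth_error P o = Some i.
Proof.
  intros (pre & post & -> & <-). rewrite nth_error_app2, Nat.sub_diag by lia. easy.
Qed.

Definition steps (P : program) (s s' : mstate) : Prop := exists n, mrun P n s = s'.

Lemma steps_refl P s : steps P s s.
Proof. now exists 0. Qed.

Lemma steps_trans P s1 s2 s3 : steps P s1 s2 -> steps P s2 s3 -> steps P s1 s3.
Proof.
  intros [n Hn] [m Hm]. exists (n + m). revert s1 Hn.
  induction n as [|n IH]; intros s1 Hn; simpl in *; [now subst|]. now apply IH.
Qed.

Lemma steps_one P s s' : mstep P s = s' -> steps P s s'.
Proof. intros H. now exists 1. Qed.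

Lemma set_reg_same s r : set_reg s r (s r) = s.
Proof.
  apply functional_extensionality. intros q. unfold set_reg.
  destruct (Nat.eqb_spec q r); congruence.
Qed.

Lemma set_reg_set s r v w : set_reg (set_reg s r v) r w = set_reg s r w.
Proof.
  apply functional_extensionality. intros q. unfold set_reg. now destruct (Nat.eqb_spec q r).
Qed.

Lemma steps_test P o r j l s : code_at P o (DEC r j :: INC r :: l) -> s r <> 0 ->
  steps P (o, s) (o + 2, s).
Proof.
  intros Hc Hs. pose proof (code_at_nth _ _ _ _ Hc) as H1.
  destruct (code_at_app P o [DEC r j] (INC r :: l) Hc) as [_ Hc2]. simpl in Hc2.
  apply code_at_nth in Hc2 as H2. apply steps_trans with (S o, set_reg s r (pred (s r))).
  - apply steps_one. simpl. rewrite H1. destruct (s r) as [|n]; easy.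
  - apply steps_one. replace (S o) with (o + 1) by lia. simpl. rewrite H2.
    f_equal; [lia|]. rewrite set_reg_set. unfold set_reg at 2. rewrite Nat.eqb_refl.
    replace (S (pred (s r))) with (s r) by lia. apply set_reg_same.
Qed.

Lemma steps_jump P o r j l s : code_at P o (DEC r j :: l) -> s r = 0 -> steps P (o, s) (j, s).
Proof.
  intros Hc Hs. apply code_at_nth in Hc. apply steps_one. simpl. now rewrite Hc, Hs.
Qed.

Lemma comp_correct z P c s s' : exec c s s' -> avoids z c -> s z = 0 ->
  forall o, code_at P o (comp z o c) -> steps P (o, s) (o + clen c, s').
Proof.
  induction 1 as [r s|r s|c1 c2 s s1 s2 H1 IH1 H2 IH2|r c s Hr|r c s s1 s2 Hr H1 IH1 H2 IH2
    |r c1 c2 s s1 Hr H1 IH1|r c1 c2 s s1 Hr H1 IH1];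
    intros Ha Hz o Hc.
  - apply code_at_nth in Hc. apply steps_one. simpl. rewrite Hc. f_equal. lia.
  - apply code_at_nth in Hc. apply steps_one. simpl. rewrite Hc.
    destruct (s r) as [|n] eqn:E; f_equal; try lia. simpl. rewrite <- E. symmetry.
    apply set_reg_same.
  - destruct Ha as [Ha1 Ha2]. simpl in Hc. apply code_at_app in Hc as [Hc1 Hc2].
    rewrite comp_length in Hc2. eapply steps_trans; [now apply IH1|].
    simpl. rewrite Nat.add_assoc. apply IH2; auto.
    rewrite (avoids_exec z c1 s s1); auto.
  - simpl in Hc |- *. rewrite Nat.add_assoc. eapply steps_jump; eauto.
  - pose proof Ha as [Hne Ha1]. pose proof Hc as Hc0. simpl in Hc.
    eapply steps_trans; [eapply steps_test; eauto|].
    change (DEC r (o + clen c + 3) :: INC r :: comp z (o + 2) c ++ [DEC z o])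
      with ([DEC r (o + clen c + 3); INC r] ++ comp z (o + 2) c ++ [DEC z o]) in Hc.
    apply code_at_app in Hc as [_ Hc]. apply code_at_app in Hc as [Hc1 Hc2].
    rewrite comp_length in Hc2. simpl in Hc1, Hc2.
    eapply steps_trans; [now apply IH1|].
    pose proof (avoids_exec z c s s1 H1 Ha1) as Hz1.
    eapply steps_trans; [eapply steps_jump; eauto; congruence|].
    apply IH2; auto. congruence.
  - destruct Ha as (Hne & Ha1 & Ha2). simpl in Hc.
    eapply steps_trans; [eapply steps_test; eauto|].
    change (DEC r (o + clen c1 + 3) :: INC r :: ?l)
      with ([DEC r (o + clen c1 + 3); INC r] ++ l) in Hc.
    apply code_at_app in Hc as [_ Hc]. apply code_at_app in Hc as [Hc1 Hc2].
    rewrite comp_length in Hc2. simpl in Hc1, Hc2.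
    eapply steps_trans; [now apply IH1|].
    pose proof (avoids_exec z c1 s s1 H1 Ha1) as Hz1.
    simpl. replace (o + (clen c1 + clen c2 + 3)) with (o + clen c1 + clen c2 + 3) by lia.
    eapply steps_jump; eauto. congruence.
  - destruct Ha as (Hne & Ha1 & Ha2). simpl in Hc.
    eapply steps_trans; [eapply steps_jump; eauto|].
    change (DEC r (o + clen c1 + 3) :: INC r :: comp z (o + 2) c1 ++ ?i :: ?l)
      with ([DEC r (o + clen c1 + 3); INC r] ++ comp z (o + 2) c1 ++ [i] ++ l) in Hc.
    apply code_at_app in Hc as [_ Hc]. apply code_at_app in Hc as [_ Hc].
    apply code_at_app in Hc as [_ Hc]. rewrite comp_length in Hc. simpl in Hc.
    replace (o + 2 + clen c1 + 1) with (o + clen c1 + 3) in Hc by lia.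
    simpl. replace (o + (clen c1 + clen c2 + 3)) with (o + clen c1 + 3 + clen c2) by lia.
    now apply IH1.
Qed.

(** Register files with finite support as lists, so that symbolic execution reduces to computation
    with [lset] and [nth]. *)
Definition mk (l : list nat) : nat -> nat := fun r => nth r l 0.

Fixpoint lset (l : list nat) (r v : nat) : list nat :=
  match r, l with
  | 0, [] => [v]
  | 0, _ :: t => v :: t
  | S r', [] => 0 :: lset [] r' v
  | S r', a :: t => a :: lset t r' v
  end.

Lemma set_mk l r v : set_reg (mk l) r v = mk (lset l r v).
Proof.
  apply functional_extensionality. intros q. unfold set_reg, mk. revert l r.
  induction q as [|q IH]; intros l r; destruct r as [|r], l as [|a l]; simpl; auto.
  - now destruct q.
  - rewrite <- IH. destruct (Nat.eqb q r); auto. now destruct q.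
Qed.

Lemma exec_inc_mk r l : exec (CInc r) (mk l) (mk (lset l r (S (nth r l 0)))).
Proof. rewrite <- set_mk. exact (exec_inc r (mk l)). Qed.

Lemma exec_dec_mk r l : exec (CDec r) (mk l) (mk (lset l r (pred (nth r l 0)))).
Proof. rewrite <- set_mk. exact (exec_dec r (mk l)). Qed.

Definition CMove (r1 r2 : nat) : cmd := CWhile r1 (CSeq (CDec r1) (CInc r2)).

Lemma exec_move r1 r2 : r1 <> r2 -> forall n s, s r1 = n ->
  exec (CMove r1 r2) s (set_reg (set_reg s r1 0) r2 (n + s r2)).
Proof.
  intros Hne n. induction n as [|n IH]; intros s Hs.
  - simpl. rewrite <- Hs, set_reg_same, set_reg_same. now apply exec_while_stop.
  - eapply exec_while_loop; [lia|eapply exec_seq; [apply exec_dec|apply exec_inc]|].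
    rewrite Hs. simpl pred.
    assert (H1 : set_reg s r1 n r2 = s r2).
    { unfold set_reg. destruct (Nat.eqb_spec r2 r1); congruence. }
    rewrite H1.
    match goal with |- exec _ ?s1 _ => specialize (IH s1) end.
    assert (H2 : set_reg (set_reg s r1 n) r2 (S (s r2)) r1 = n).
    { unfold set_reg. destruct (Nat.eqb_spec r1 r2); [congruence|]. now rewrite Nat.eqb_refl. }
    specialize (IH H2).
    replace (set_reg (set_reg s r1 0) r2 (S n + s r2)) with
      (set_reg (set_reg (set_reg (set_reg s r1 n) r2 (S (s r2))) r1 0) r2
         (n + set_reg (set_reg s r1 n) r2 (S (s r2)) r2)); auto.
    apply functional_extensionality. intros q. unfold set_reg. rewrite Nat.eqb_refl.
    destruct (Nat.eqb_spec q r2); [lia|]. destruct (Nat.eqb_spec q r1); auto.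
Qed.

Lemma exec_move_mk r1 r2 l : r1 <> r2 ->
  exec (CMove r1 r2) (mk l) (mk (lset (lset l r1 0) r2 (nth r1 l 0 + nth r2 l 0))).
Proof. intros H. rewrite <- !set_mk. now apply (exec_move r1 r2 H (nth r1 l 0) (mk l)). Qed.

Lemma exec_eq c s s' s'' : exec c s s' -> s' = s'' -> exec c s s''.
Proof. now intros H <-. Qed.

(** * Cantor pairing and its inverse on the machine *)

Fixpoint tri (n : nat) : nat := match n with 0 => 0 | S m => S m + tri m end.

Lemma cpair_tri a b : cpair a b = tri (a + b) + b.
Proof.
  unfold cpair. f_equal. generalize (a + b). intros n. symmetry.
  apply Nat.div_unique with 0; [lia|].
  induction n as [|n IH]; [easy|]. cbn [tri]. lia.
Qed.

Definition CUp (r1 r2 r3 : nat) : cmd :=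
  CWhile r1 (CSeq (CDec r1) (CSeq (CInc r2) (CInc r3))).

(* Registers: 0 the remaining input, 1 the result, 2 a constant, 3 the power of two, 4 to 7
   scratch, 8 always zero. *)
Definition CPair : cmd :=
  CSeq (CUp 6 7 5) (CWhile 5 (CSeq (CUp 5 7 6) (CSeq (CDec 6) (CMove 6 5)))).

Ltac mk_eq := apply (f_equal mk); repeat (apply f_equal2; [lia|]); reflexivity.
Ltac loop_mk IH :=
  eapply exec_while_loop; [discriminate
  | repeat (eapply exec_seq; [solve [apply exec_dec_mk | apply exec_inc_mk]|]); apply exec_inc_mk
  | cbn [lset nth pred]; eapply exec_eq; [apply IH|mk_eq]].

Lemma exec_up675 x t c y u b : forall a k,
  exec (CUp 6 7 5) (mk [x;t;c;y;u;a;b;k;0]) (mk [x;t;c;y;u;a + b;0;k + b;0]).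
Proof.
  induction b as [|b IH]; intros a k.
  - rewrite !Nat.add_0_r. now apply exec_while_stop.
  - loop_mk IH.
Qed.

Lemma exec_up576 x t c y u a : forall b k,
  exec (CUp 5 7 6) (mk [x;t;c;y;u;a;b;k;0]) (mk [x;t;c;y;u;0;b + a;k + a;0]).
Proof.
  induction a as [|a IH]; intros b k.
  - rewrite !Nat.add_0_r. now apply exec_while_stop.
  - loop_mk IH.
Qed.

Lemma exec_pair x t c y u a b :
  exec CPair (mk [x;t;c;y;u;a;b;0;0]) (mk [x;t;c;y;u;0;0;cpair a b;0]).
Proof.
  (* Each round adds the current [n] to register 7 and lowers it by one, which sums up to
     [tri n]. *)
  assert (H : forall n k, exec (CWhile 5 (CSeq (CUp 5 7 6) (CSeq (CDec 6) (CMove 6 5))))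
    (mk [x;t;c;y;u;n;0;k;0]) (mk [x;t;c;y;u;0;0;k + tri n;0])).
  { induction n as [|n IH]; intros k.
    - rewrite Nat.add_0_r. now apply exec_while_stop.
    - eapply exec_while_loop; [discriminate| |].
      + eapply exec_seq; [apply exec_up576|].
        eapply exec_seq; [apply exec_dec_mk|apply exec_move_mk; discriminate].
      + cbn [lset nth pred Nat.add]. eapply exec_eq; [eapply exec_eq; [|reflexivity]|].
        * replace (n + 0) with n by lia. apply IH.
        * cbn [tri]. mk_eq. }
  eapply exec_seq; [apply exec_up675|]. eapply exec_eq; [apply H|].
  rewrite cpair_tri. mk_eq.
Qed.

(** Successor along the Cantor enumeration: unpairing [n] means iterating it [n] times from
    [(0, 0)]. *)
Definition nextp (p : nat * nat) : nat * nat :=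
  match p with (S a, b) => (a, S b) | (0, b) => (S b, 0) end.

Lemma iter_nextp n : forall a b, cpair a b = n -> Nat.iter n nextp (0, 0) = (a, b).
Proof.
  induction n as [|n IH]; intros a b H; rewrite cpair_tri in H.
  - destruct a as [|a], b as [|b]; simpl in *; try lia. easy.
  - simpl. destruct b as [|b].
    + destruct a as [|a]; [simpl in H; lia|]. rewrite (IH 0 a); [easy|].
      rewrite cpair_tri. replace (S a + 0) with (S a) in H by lia. cbn [tri] in H. simpl. lia.
    + rewrite (IH (S a) b); [easy|]. rewrite cpair_tri.
      replace (S a + b) with (a + S b) by lia. lia.
Qed.

Definition CUnpair : cmd :=
  CWhile 0 (CSeq (CDec 0) (CIf 5 (CSeq (CDec 5) (CInc 6)) (CSeq (CInc 5) (CMove 6 5)))).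

Lemma exec_unpair c x t c0 y u k :
  exec CUnpair (mk [cpair c x;t;c0;y;u;0;0;k;0]) (mk [0;t;c0;y;u;c;x;k;0]).
Proof.
  assert (H : forall n p, exec CUnpair (mk [n;t;c0;y;u;fst p;snd p;k;0])
    (mk [0;t;c0;y;u;fst (Nat.iter n nextp p);snd (Nat.iter n nextp p);k;0])).
  { induction n as [|n IH]; intros p.
    - now apply exec_while_stop.
    - rewrite Nat.iter_succ_r.
      assert (Hb : exec (CSeq (CDec 0) (CIf 5 (CSeq (CDec 5) (CInc 6)) (CSeq (CInc 5) (CMove 6 5))))
        (mk [S n;t;c0;y;u;fst p;snd p;k;0]) (mk [n;t;c0;y;u;fst (nextp p);snd (nextp p);k;0])).
      { destruct p as [[|a] b]; cbn [nextp fst snd].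
        - eapply exec_seq; [apply exec_dec_mk|]. cbn [lset nth pred].
          apply exec_if_zero; [reflexivity|].
          eapply exec_seq; [apply exec_inc_mk|]. cbn [lset nth].
          eapply exec_eq; [apply exec_move_mk; discriminate|]. cbn [lset nth]. mk_eq.
        - eapply exec_seq; [apply exec_dec_mk|]. cbn [lset nth pred].
          apply exec_if_nonzero; [discriminate|].
          eapply exec_seq; [apply exec_dec_mk|]. cbn [lset nth pred].
          eapply exec_eq; [apply exec_inc_mk|]. cbn [lset nth]. mk_eq. }
      eapply exec_while_loop; [discriminate|exact Hb|apply IH]. }
  specialize (H (cpair c x) (0, 0)). now rewrite (iter_nextp _ c x eq_refl) in H.
Qed.

Fixpoint seqs (c : cmd) (l : list cmd) : cmd :=
  match l with [] => c | d :: l' => CSeq c (seqs d l') end.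

(** Register 0 is a stack of constants. [CPop] brings the top into register 2; the two commands
    below build a list cell from it and the result in register 1, with register 2 as head in
    [CConsL] and as tail in [CConsR]. *)
Definition CPop : cmd := seqs CUnpair [CMove 6 0; CMove 5 2].
Definition CConsL : cmd := seqs (CMove 2 5) [CMove 1 6; CPair; CMove 7 1; CInc 1].
Definition CConsR : cmd := seqs (CMove 1 5) [CMove 2 6; CPair; CMove 7 1; CInc 1].

Ltac move_mk := eapply exec_seq; [apply exec_move_mk; discriminate|]; cbn [lset nth Nat.add];
  rewrite ?Nat.add_0_r.

Lemma exec_pop c x t y : exec CPop (mk [cpair c x;t;0;y;0;0;0;0;0]) (mk [x;t;c;y;0;0;0;0;0]).
Proof.
  eapply exec_seq; [apply exec_unpair|]. move_mk.
  eapply exec_eq; [apply exec_move_mk; discriminate|]. cbn [lset nth]. mk_eq.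
Qed.

Lemma exec_consL x t c y :
  exec CConsL (mk [x;t;c;y;0;0;0;0;0]) (mk [x;S (cpair c t);0;y;0;0;0;0;0]).
Proof.
  move_mk. move_mk. eapply exec_seq; [apply exec_pair|]. move_mk.
  eapply exec_eq; [apply exec_inc_mk|]. cbn [lset nth]. mk_eq.
Qed.

Lemma exec_consR x t c y :
  exec CConsR (mk [x;t;c;y;0;0;0;0;0]) (mk [x;S (cpair t c);0;y;0;0;0;0;0]).
Proof.
  move_mk. move_mk. eapply exec_seq; [apply exec_pair|]. move_mk.
  eapply exec_eq; [apply exec_inc_mk|]. cbn [lset nth]. mk_eq.
Qed.

(** The loop restores the input in register 0, which is still needed as the stack of constants. *)
Definition CExp : cmd :=
  seqs (CMove 0 5) [CInc 3; CWhile 5 (seqs (CDec 5) [CInc 0; CUp 3 4 4; CMove 4 3])].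

Lemma exec_double x t c y : forall u a b k,
  exec (CUp 3 4 4) (mk [x;t;c;y;u;a;b;k;0]) (mk [x;t;c;0;u + 2 * y;a;b;k;0]).
Proof.
  induction y as [|y IH]; intros u a b k.
  - rewrite Nat.add_0_r. now apply exec_while_stop.
  - loop_mk IH.
Qed.

Lemma exec_exp x : exec CExp (mk [x;0;0;0;0;0;0;0;0]) (mk [x;0;0;2 ^ x;0;0;0;0;0]).
Proof.
  assert (H : forall n x0 y, exec (CWhile 5 (seqs (CDec 5) [CInc 0; CUp 3 4 4; CMove 4 3]))
    (mk [x0;0;0;y;0;n;0;0;0]) (mk [x0 + n;0;0;2 ^ n * y;0;0;0;0;0])).
  { induction n as [|n IH]; intros x0 y.
    - rewrite Nat.add_0_r, Nat.mul_1_l. now apply exec_while_stop.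
    - eapply exec_while_loop; [discriminate| |].
      + eapply exec_seq; [apply exec_dec_mk|]. cbn [lset nth pred].
        eapply exec_seq; [apply exec_inc_mk|]. cbn [lset nth].
        eapply exec_seq; [apply exec_double|]. apply exec_move_mk; discriminate.
      + cbn [lset nth]. rewrite Nat.add_0_r. eapply exec_eq; [apply IH|].
        rewrite Nat.pow_succ_r'. apply (f_equal mk).
        repeat (apply f_equal2; [nia|]). reflexivity. }
  move_mk. eapply exec_seq; [apply exec_inc_mk|]. cbn [lset nth].
  eapply exec_eq; [apply H|]. mk_eq.
Qed.

Definition CCopy3 : cmd := CWhile 3 (seqs (CDec 3) [CInc 4; CInc 5; CInc 6]).

Lemma exec_copy3 x t c k y : forall u a b,
  exec CCopy3 (mk [x;t;c;y;u;a;b;k;0]) (mk [x;t;c;0;u + y;a + y;b + y;k;0]).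
Proof.
  induction y as [|y IH]; intros u a b.
  - rewrite !Nat.add_0_r. now apply exec_while_stop.
  - loop_mk IH.
Qed.

Definition CPre : cmd :=
  seqs CExp
    [CPop; CMove 2 1;
     CCopy3; CMove 4 3; CDec 5; CPair; CMove 7 2; CConsL;
     CMove 3 6; CInc 5; CPair; CMove 7 2; CConsL;
     CPop; CConsL; CPop; CConsR; CPop; CConsR;
     CPop; CConsL; CPop; CConsL; CPop; CConsL; CPop; CConsL; CPop; CConsL;
     CMove 1 0].

(** The code of an instance with a hole for [X]: [row] is the table row of [VK], [k2] the other
    rows, [k3] the fields after the table, [k4] to [k8] those before it. The constants are numbered
    in the order in which they are consumed, from the inside out. *)
Definition pre_code (k0 k1 k2 k3 k4 k5 k6 k7 k8 X : nat) : nat :=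
  let row := S (cpair k1 (S (cpair (cpair 1 X) (S (cpair (cpair (X - 1) X) k0))))) in
  S (cpair k8 (S (cpair k7 (S (cpair k6 (S (cpair k5 (S (cpair k4
    (S (cpair (S (cpair row k2)) k3))))))))))).

Definition pre_input (k0 k1 k2 k3 k4 k5 k6 k7 k8 : nat) : nat :=
  cpair k0 (cpair k1 (cpair k2 (cpair k3 (cpair k4 (cpair k5 (cpair k6 (cpair k7 (cpair k8 0)))))))).

Lemma exec_pre k0 k1 k2 k3 k4 k5 k6 k7 k8 :
  let x := pre_input k0 k1 k2 k3 k4 k5 k6 k7 k8 in
  exec CPre (mk [x;0;0;0;0;0;0;0;0])
    (mk [pre_code k0 k1 k2 k3 k4 k5 k6 k7 k8 (2 ^ x);0;0;0;0;0;0;0;0]).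
Proof.
  (* The power is replaced by a variable before [x] is unfolded into the stack, so that it is never
     expanded. *)
  intros x. eapply exec_seq; [apply exec_exp|]. generalize (2 ^ x). intros y. unfold x, pre_input.
  eapply exec_seq; [apply exec_pop|]. move_mk.
  eapply exec_seq; [apply exec_copy3|]. cbn [Nat.add]. move_mk.
  eapply exec_seq; [apply exec_dec_mk|]. cbn [lset nth].
  eapply exec_seq; [apply exec_pair|]. move_mk.
  eapply exec_seq; [apply exec_consL|]. move_mk.
  eapply exec_seq; [apply exec_inc_mk|]. cbn [lset nth].
  eapply exec_seq; [apply exec_pair|]. move_mk.
  eapply exec_seq; [apply exec_consL|].
  eapply exec_seq; [apply exec_pop|]. eapply exec_seq; [apply exec_consL|].
  eapply exec_seq; [apply exec_pop|]. eapply exec_seq; [apply exec_consR|].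
  eapply exec_seq; [apply exec_pop|]. eapply exec_seq; [apply exec_consR|].
  eapply exec_seq; [apply exec_pop|]. eapply exec_seq; [apply exec_consL|].
  eapply exec_seq; [apply exec_pop|]. eapply exec_seq; [apply exec_consL|].
  eapply exec_seq; [apply exec_pop|]. eapply exec_seq; [apply exec_consL|].
  eapply exec_seq; [apply exec_pop|]. eapply exec_seq; [apply exec_consL|].
  eapply exec_seq; [apply exec_pop|]. eapply exec_seq; [apply exec_consL|].
  eapply exec_eq; [apply exec_move_mk; discriminate|]. cbn [lset nth].
  rewrite Nat.add_0_r. unfold pre_code. now rewrite <- Nat.sub_1_r.
Qed.

Lemma avoids_pre : avoids 8 CPre.
Proof. simpl. lia. Qed.

(** * Diagonalisation *)

(** Jumps out of [M] are clamped to its length, so that every way of halting leads to the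
    instruction just after the copy. *)
Definition reloc_instr (o len : nat) (i : instr) : instr :=
  match i with INC r => INC r | DEC r j => DEC r (o + Nat.min j len) end.

Definition reloc (o : nat) (M : program) : program := map (reloc_instr o (length M)) M.

Lemma reloc_run P o M : code_at P o (reloc o M) -> forall n s,
  steps P (o + Nat.min (fst s) (length M), snd s)
          (o + Nat.min (fst (mrun M n s)) (length M), snd (mrun M n s)).
Proof.
  intros Hc n. induction n as [|n IH]; intros s; [apply steps_refl|].
  eapply steps_trans; [|apply (IH (mstep M s))]. destruct s as [pc regs]. cbn [fst snd].
  destruct (nth_error M pc) as [i|] eqn:E.
  - pose proof (nth_error_lt M pc i E) as Hlt.
    assert (HP : nth_error P (o + pc) = Some (reloc_instr o (length M) i)).
    { destruct Hc as (pre & post & -> & <-). rewrite nth_error_app2 by lia.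
      replace (length pre + pc - length pre) with pc by lia.
      rewrite nth_error_app1 by (unfold reloc; now rewrite length_map).
      unfold reloc. now apply map_nth_error. }
    rewrite (Nat.min_l pc) by lia. apply steps_one. unfold mstep. rewrite HP, E.
    destruct i as [r|r j]; cbn [reloc_instr].
    + cbn [fst snd]. f_equal. lia.
    + destruct (regs r); cbn [fst snd]; f_equal. lia.
  - unfold mstep. rewrite E. apply steps_refl.
Qed.

(* [pc = length] means that [M] did not answer 1, [pc = S (length ..)] that it did. *)
Definition diag (M : program) : program :=
  let o := clen CPre in
  comp 8 0 CPre ++ reloc o M ++ [DEC 0 (o + length M + 2); DEC 0 (o + length M + 3)].

Lemma diag_length M : length (diag M) = clen CPre + length M + 2.
Proof.
  unfold diag, reloc. rewrite !length_app, comp_length, length_map. simpl length. lia.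
Qed.

Lemma diag_run M k0 k1 k2 k3 k4 k5 k6 k7 k8 y :
  let x := pre_input k0 k1 k2 k3 k4 k5 k6 k7 k8 in
  halts_with M (pre_code k0 k1 k2 k3 k4 k5 k6 k7 k8 (2 ^ x)) y ->
  exists n, fst (mrun (diag M) n (init_state x)) =
    if Nat.eqb y 1 then S (length (diag M)) else length (diag M).
Proof.
  intros x (n & Hn & Hy). set (fx := pre_code k0 k1 k2 k3 k4 k5 k6 k7 k8 (2 ^ x)) in *.
  set (o := clen CPre).
  assert (Hc1 : code_at (diag M) 0 (comp 8 0 CPre)).
  { exists [], (reloc o M ++ [DEC 0 (o + length M + 2); DEC 0 (o + length M + 3)]). easy. }
  assert (Hc2 : code_at (diag M) o (reloc o M)).
  { exists (comp 8 0 CPre), [DEC 0 (o + length M + 2); DEC 0 (o + length M + 3)].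
    split; [easy|apply comp_length]. }
  assert (Hc3 : code_at (diag M) (o + length M)
                  [DEC 0 (o + length M + 2); DEC 0 (o + length M + 3)]).
  { exists (comp 8 0 CPre ++ reloc o M), []. split.
    - rewrite app_nil_r, <- app_assoc. easy.
    - unfold reloc. now rewrite length_app, length_map, comp_length. }
  assert (Hmk : forall v, init_state v = (0, mk [v;0;0;0;0;0;0;0;0])).
  { intros v. unfold init_state. f_equal. apply functional_extensionality. intros q.
    unfold mk. do 10 (destruct q as [|q]; [easy|]). now destruct q. }
  assert (H1 : steps (diag M) (init_state x) (o, mk [fx;0;0;0;0;0;0;0;0])).
  { rewrite Hmk. apply (comp_correct 8 (diag M) CPre); auto using avoids_pre.
    apply (exec_pre k0 k1 k2 k3 k4 k5 k6 k7 k8). }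
  pose proof (reloc_run (diag M) o M Hc2 n (init_state fx)) as H2.
  rewrite (Nat.min_r (fst (mrun M n (init_state fx)))) in H2 by lia.
  (* The preprocessing leaves all other registers at 0, so [M] starts from exactly its initial
     state. *)
  replace (o + Nat.min (fst (init_state fx)) (length M), snd (init_state fx))
    with (o, mk [fx;0;0;0;0;0;0;0;0]) in H2 by (rewrite Hmk; cbn [fst snd Nat.min]; f_equal; lia).
  pose proof (steps_trans _ _ _ _ H1 H2) as H3. clear H1 H2.
  set (regs := snd (mrun M n (init_state fx))) in *.
  assert (Hlen : length (diag M) = o + length M + 2) by apply diag_length.
  assert (H4 : exists regs', steps (diag M) (o + length M, regs)
            (if Nat.eqb y 1 then S (length (diag M)) else length (diag M), regs')).
  { destruct y as [|y].
    - exists regs. cbn [Nat.eqb]. rewrite Hlen. eapply steps_jump; eauto.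
    - assert (Ha : steps (diag M) (o + length M, regs) (S (o + length M), set_reg regs 0 y)).
      { apply steps_one. apply code_at_nth in Hc3. unfold mstep. now rewrite Hc3, Hy. }
      apply (code_at_app _ _ [_]) in Hc3 as [_ Hc3]. cbn [length] in Hc3.
      replace (o + length M + 1) with (S (o + length M)) in Hc3 by lia.
      destruct y as [|y].
      + exists (set_reg regs 0 0). eapply steps_trans; [exact Ha|]. cbn [Nat.eqb]. rewrite Hlen.
        replace (S (o + length M + 2)) with (o + length M + 3) by lia.
        eapply steps_jump; eauto.
      + exists (set_reg (set_reg regs 0 (S y)) 0 y). eapply steps_trans; [exact Ha|].
        cbn [Nat.eqb]. rewrite Hlen. apply steps_one. apply code_at_nth in Hc3.
        unfold mstep. rewrite Hc3. cbn [set_reg Nat.eqb]. f_equal. lia. }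
  destruct H4 as [regs' H4]. destruct (steps_trans _ _ _ _ H3 H4) as [m Hm].
  exists m. now rewrite Hm.
Qed.

(** * The code of the game and the contradiction *)

Definition regs_bound (Q : program) : nat := S (list_max (map instr_reg Q)).

Lemma regs_bound_spec Q i : In i Q -> instr_reg i < regs_bound Q.
Proof.
  intros H. unfold regs_bound. apply Nat.lt_succ_r.
  pose proof (proj1 (list_max_le (map instr_reg Q) _) (Nat.le_refl _)) as Hall.
  rewrite Forall_forall in Hall. apply Hall. now apply in_map.
Qed.

Definition vs_tail (Q : program) (nr : nat) : list vert :=
  filter (fun v => negb (special v)) (nodup vert_eq_dec (allv Q nr)).

Lemma qv_indep Q nr X v w : v <> VK -> qv Q nr X v w = qv Q nr 1 v w.
Proof. intros H. destruct v; easy. Qed.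

(** All fragments are taken from the game with [X] equal to 1, which exhibits them as constants. *)
Lemma encode_the_game Q nr X : 0 < nr -> 0 < X ->
  encode_instance (the_game Q nr X) 0 1 =
  pre_code
    (enc_list enc_qn (map (fun _ => (0, 1)) (vs_tail Q nr)))
    (enc_qn (0, 1))
    (enc_list (enc_list enc_qn)
       (map (fun v => map (qv Q nr 1 v) (vs Q nr)) (VS Neu true 0 :: VT 0 false :: vs_tail Q nr)))
    (enc_list (fun x => x)
       [enc_list (enc_list (fun x => x)) (g_target (the_game Q nr 1)); 0; 1])
    (enc_list (enc_list (fun x => x)) (g_succ (the_game Q nr 1)))
    (enc_list enc_opt (g_owner (the_game Q nr 1)))
    (g_v0 (the_game Q nr 1)) (g_k (the_game Q nr 1)) (g_nV (the_game Q nr 1)) X.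
Proof.
  intros Hnr HX.
  assert (Hvs : vs Q nr = VK :: VS Neu true 0 :: VT 0 false :: vs_tail Q nr) by reflexivity.
  assert (Hrow : map (qv Q nr X VK) (vs Q nr) =
    (0, 1) :: (1, X) :: (X - 1, X) :: map (fun _ => (0, 1)) (vs_tail Q nr)).
  { rewrite Hvs. cbn [map].
    apply f_equal2; [easy|]. apply f_equal2; [easy|]. apply f_equal2.
    (* For [X] equal to 1 the second numerator vanishes, and the normalised 0/1 happens to coincide
       with [(X - 1, X)]. *)
    - unfold qv, numv. cbn. rewrite Nat.add_0_r.
      destruct X as [|[|X]]; [lia|easy|easy].
    - apply map_ext_in. intros v Hv. apply filter_In in Hv as [_ Hv].
      unfold qv, numv. cbn [vdist map fst snd].
      destruct (vert_eq_dec (VS Neu true 0) v) as [<-|]; [easy|].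
      destruct (vert_eq_dec (VT 0 false) v) as [<-|]; easy. }
  assert (Hprob : g_prob (the_game Q nr X) =
    ((0, 1) :: (1, X) :: (X - 1, X) :: map (fun _ => (0, 1)) (vs_tail Q nr)) ::
    map (fun v => map (qv Q nr 1 v) (vs Q nr)) (VS Neu true 0 :: VT 0 false :: vs_tail Q nr)).
  { transitivity (map (fun v => map (qv Q nr X v) (vs Q nr))
      (VK :: VS Neu true 0 :: VT 0 false :: vs_tail Q nr)); [easy|].
    cbn [map]. rewrite Hrow.
    apply f_equal2; [easy|]. apply f_equal2; [now apply map_ext; intros; apply qv_indep|].
    apply f_equal2; [now apply map_ext; intros; apply qv_indep|].
    apply map_ext_in. intros v Hv. apply filter_In in Hv as [_ Hv].
    apply map_ext. intros w. apply qv_indep. intros ->. easy. }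
  unfold encode_instance. rewrite Hprob. reflexivity.
Qed.

(** The equilibrium needs a run that is inside the code at all times before [N], hence the first
    time of leaving it. *)
Lemma least_stop (f : nat -> nat) L n : L <= f n ->
  exists N, N <= n /\ L <= f N /\ forall m, m < N -> f m < L.
Proof.
  induction n as [n IH] using (well_founded_induction lt_wf). intros Hn.
  destruct (classic (exists m, m < n /\ L <= f m)) as [(m & Hm & Hf)|Hno].
  - destruct (IH m Hm Hf) as (N & H1 & H2 & H3). exists N. repeat split; auto. lia.
  - exists n. repeat split; auto. intros m Hm. destruct (le_lt_dec L (f m)); auto.
    exfalso. eauto.
Qed.

Lemma regs_bounded (f : nat -> nat -> nat) N R :
  exists B, forall n r, n <= N -> r < R -> f n r <= B.
Proof.
  exists (list_max (flat_map (fun n => map (f n) (seq 0 R)) (seq 0 (S N)))).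
  intros n r Hn Hr.
  pose proof (proj1 (list_max_le (flat_map (fun n => map (f n) (seq 0 R)) (seq 0 (S N))) _)
    (Nat.le_refl _)) as Hall.
  rewrite Forall_forall in Hall. apply Hall. apply in_flat_map. exists n.
  split; [apply in_seq; lia|]. apply in_map, in_seq. lia.
Qed.

Lemma NCRSP_good_run c Q nr x n : 0 < nr ->
  fst (mrun Q n (init_state x)) = S (length Q) -> ~ NCRSP_gt c (the_game Q nr (2 ^ x)) 0.
Proof.
  intros Hnr Hn (s0 & Hs0 & Hall).
  destruct (least_stop (fun m => fst (mrun Q m (init_state x))) (length Q) n)
    as (N & HN & Hge & Hlt); [lia|].
  assert (HNend : fst (mrun Q N (init_state x)) = S (length Q)).
  { pose proof (mrun_stuck Q (init_state x) N (n - N) Hge) as Hst.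
    replace (n - N + N) with n in Hst by lia. congruence. }
  destruct (regs_bounded (fun m => snd (mrun Q m (init_state x))) N nr) as [B HB].
  destruct (good_run_NE Q nr x N B Hnr Hlt HNend HB c s0 Hs0) as [HNE HPay].
  specialize (Hall (fun _ => str Q nr x N B)
    ltac:(intros i _; apply str_in_class; auto) HNE).
  rewrite HPay in Hall. simpl in Hall. lra.
Qed.

Lemma NCRSP_bad_run c Q nr x n : 0 < nr -> (forall i, In i Q -> instr_reg i < nr) ->
  0 < length Q -> fst (mrun Q n (init_state x)) = length Q ->
  NCRSP_gt c (the_game Q nr (2 ^ x)) 0.
Proof.
  intros Hnr Hregs Hlen Hn.
  set (G := the_game Q nr (2 ^ x)).
  assert (Hwf : wf_game G) by (apply the_game_wf; auto using pow2_pos).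
  assert (Hno : forall v, owner G v <> Some 0).
  { intros v. unfold G. rewrite owner_dv. destruct (dv Q nr v); simpl; discriminate. }
  (* Since the system owns no vertex, any function is a strategy for it, even one that is not a
     distribution. *)
  exists (fun _ _ => 0%R). split.
  - split; [intros h v _ Ho; now apply Hno in Ho|].
    assert (Hp : pure G 0 (fun _ _ => 0%R)) by (intros h v _ Ho; now apply Hno in Ho).
    assert (Hf : finite_state G 0 (fun _ _ => 0%R)).
    { exists 1, 0, (fun _ _ => 0), (fun _ _ _ => 0%R). repeat split; auto; lia. }
    destruct c; auto.
  - intros env Henv HNE. set (p := update env 0 (fun _ _ => 0%R)) in *.
    assert (Hcl : forall i, 1 <= i <= g_k G -> in_class c G i (p i)).
    { intros i Hi. unfold p, update. destruct (Nat.eqb_spec i 0); [lia|]. now apply Henv. }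
    assert (Hsp : strat_profile G p).
    { intros i Hi. destruct i as [|i]; [|apply Hcl; lia].
      intros h v _ Ho. now apply Hno in Ho. }
    rewrite (Pay_xval G Hwf p Hsp).
    pose proof (xval_bounds G Hwf p Hsp 0 [] (g_v0 G) (v0_valid G Hwf)) as Hb.
    cbn [app] in Hb. cbn [Rbar_lt].
    destruct (Rle_lt_or_eq_dec _ _ (proj1 Hb)) as [Hpos|Hz]; auto.
    exfalso. apply (bad_run_absurd Q nr x Hnr Hregs c p Hsp Hcl HNE (eq_sym Hz) n Hn Hlen).
Qed.

Theorem theorem3 :
  forall c : sclass,
    ~ (exists M : program,
         forall (G : game) (a b : nat),
           valid_instance G a b ->
           exists y, halts_with M (encode_instance G a b) y /\
                     (y = 1%nat <-> NCRSP_gt c G (INR a / INR b)%R)).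
Proof.
  intros c (M & HM).
  (* Program and register count are fixed before the input [x], so the constants packed into [x] do
     not depend on [x]. *)
  set (Q := diag M). set (nr := regs_bound Q).
  assert (Hnr : 0 < nr) by (unfold nr, regs_bound; lia).
  pose proof (fun X => encode_the_game Q nr X Hnr) as Henc.
  match type of Henc with forall X, _ -> _ = pre_code ?k0 ?k1 ?k2 ?k3 ?k4 ?k5 ?k6 ?k7 ?k8 _ =>
    pose proof (diag_run M k0 k1 k2 k3 k4 k5 k6 k7 k8) as Hdiag;
    set (x := pre_input k0 k1 k2 k3 k4 k5 k6 k7 k8) in Hdiag end.
  cbv zeta in Hdiag. specialize (Henc (2 ^ x) (pow2_pos x)).
  assert (Hvalid : valid_instance (the_game Q nr (2 ^ x)) 0 1).
  { split; [apply the_game_wf; auto using pow2_pos|lia]. }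
  destruct (HM _ 0 1 Hvalid) as (y & Hhalt & Hy). rewrite Henc in Hhalt.
  destruct (Hdiag y Hhalt) as [n Hn]. fold Q in Hn.
  replace (INR 0 / INR 1)%R with 0%R in Hy by (simpl; lra).
  destruct (Nat.eqb_spec y 1) as [Hy1|Hy1].
  - apply (NCRSP_good_run c Q nr x n Hnr Hn). now apply Hy.
  - apply Hy1, Hy. apply (NCRSP_bad_run c Q nr x n); auto.
    + intros i Hi. now apply regs_bound_spec.
    + unfold Q. rewrite diag_length. lia.
Qed.
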